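(* Let $S$ be an open subset of the unit circle $\mathbb{T}$ and let $n\ge 0$ be an integer. Then for every $\delta>0$, $$C(\partial^{-n}H^\infty,\delta)=C(\partial^{-n}A_S,\delta).$$
   Context: $\mathbb{D}$ is the open unit disk in $\mathbb{C}$, $\mathbb{T}=\partial\mathbb{D}$. For an integer $n\ge 0$: - $\partial^{-n}H^\infty$ is the algebra of analytic functions $f$ on $\mathbb{D}$ such that $f,f',\ldots,f^{(n)}$ are bounded on $\mathbb{D}$. - For $S\subset\mathbb{T}$ open, $A_S$ is the class of bounded holomorphic functions on $\mathbb{D}$ that extend continuously to $S$ (i.e. to $\mathbb{D}\cup S$), and $\partial^{-n}A_S$ is the algebra of analytic functions $f$ on $\mathbb{D}$ such that $f,f',\ldots,f^{(n)}\in A_S$. For $\mathcal{A}$ one of these algebras, $\mathcal{A}(\ell^2)$ is the corresponding space of $\ell^2$-valued analytic functions on $\mathbb{D}$ (derivatives up to order $n$ bounded, and, for $\partial^{-n}A_S$, extending continuously to $\mathbb{D}\cup S$ as functions into $\ell^2$ with its norm topology), with norm $$\|f\|_{\mathcal{A}(\ell^2)}=\sum_{j=0}^n\frac1{j!}\sup_{z\in\mathbb{D}}\|f^{(j)}(z)\|_{\ell^2}.$$ For $\delta>0$, the best possible estimate on the norm of the solution of the Bezout equation is $$C(\mathcal{A},\delta):=\sup_f\,\inf\Big\{\|g\|_{\mathcal{A}(\ell^2)} : g\in\mathcal{A}(\ell^2),\ g\cdot f:=\sum_k g_kf_k\equiv 1 \text{ on } \mathbb{D}\Big\},$$ where the supremum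 is over all $f=(f_1,f_2,\ldots)\in\mathcal{A}(\ell^2)$ with $\|f\|_{\mathcal{A}(\ell^2)}\le1$ and $\|f(z)\|_{\ell^2}=\big(\sum_k|f_k(z)|^2\big)^{1/2}\ge\delta$ for all $z\in\mathbb{D}$. *)

(* Defs.v *)
From HB Require Import structures.
From mathcomp Require Import all_boot all_order all_algebra.
From mathcomp Require Import all_classical all_reals all_analysis.
From mathcomp.real_closed Require Import complex.

Set Implicit Arguments.
Unset Strict Implicit.
Unset Printing Implicit Defensive.

Import Order.TTheory GRing.Theory Num.Theory.
Import numFieldTopology.Exports numFieldNormedType.Exports.

Local Open Scope ring_scope.
Local Open Scope classical_set_scope.

(* The complex numbers, with the modulus norm and its topology. Keeping R[i]
   behind a constant of type numFieldType lets the normed-module structure of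
   a numFieldType over itself be inferred directly. *)
Definition C (R : realType) : numFieldType := R[i].

(* The modulus as an element of R (the norm `|z| is an element of C R). *)
Definition modulus {R : realType} (z : C R) : R :=
  @ComplexField.Normc.normc R z.

Section Ell2Norm.
Context {R : realType}.
Implicit Types u v : nat -> C R.

Definition square_summable u := cvgn (series (fun k => modulus (u k) ^+ 2)).

Definition l2norm u : R :=
  Num.sqrt (limn (series (fun k => modulus (u k) ^+ 2))).

Lemma modulusE (z : C R) : `|z| = (modulus z)%:C%C.
Proof. by []. Qed.

Lemma modulus_ge0 (z : C R) : 0 <= modulus z.
Proof. by case: z => a b; exact: sqrtr_ge0. Qed.

Lemma modulusD (x y : C R) : modulus (x + y) <= modulus x + modulus y.
Proof. exact: le_normcD. Qed.

Lemma modulusM (x y : C R) : modulus (x * y) = modulus x * modulus y.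
Proof. exact: ComplexField.Normc.normcM. Qed.

Lemma l2_nd u :
  {homo series (fun k => modulus (u k) ^+ 2) : m n / (m <= n)%N >-> m <= n}.
Proof.
by apply/nondecreasing_seqP => n; rewrite seriesSr lerDl sqr_ge0.
Qed.

Lemma l2_partial_le u n : square_summable u ->
  series (fun k => modulus (u k) ^+ 2) n <= l2norm u ^+ 2.
Proof.
move=> su; rewrite /l2norm sqr_sqrtr; last first.
  apply: limr_ge => //; near=> m.
  by rewrite /series/= sumr_ge0// => i _; exact: sqr_ge0.
by apply: nondecreasing_cvgn_le => //; exact: l2_nd.
Unshelve. all: by end_near. Qed.

Lemma l2_bound u (M : R) : 0 <= M ->
  (forall n, series (fun k => modulus (u k) ^+ 2) n <= M ^+ 2) ->
  square_summable u /\ l2norm u <= M.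
Proof.
move=> M0 uM; have su : square_summable u.
  apply: nondecreasing_is_cvgn; first exact: l2_nd.
  by exists (M ^+ 2) => _ [n _ <-]; exact: uM.
split=> //; rewrite -[leRHS]ger0_norm// -sqrtr_sqr.
by rewrite ler_wsqrtr//; apply: limr_le => //; apply: nearW => n; exact: uM.
Qed.

Lemma l2_minkowski (a b c d : R) :
  Num.sqrt ((a + b) ^+ 2 + (c + d) ^+ 2) <=
  Num.sqrt (a ^+ 2 + c ^+ 2) + Num.sqrt (b ^+ 2 + d ^+ 2).
Proof. exact: (le_normcD (a +i* c)%C (b +i* d)%C). Qed.

Lemma l2_series_ge0 u n : 0 <= series (fun k => modulus (u k) ^+ 2) n.
Proof. by rewrite /series/= sumr_ge0// => i _; exact: sqr_ge0. Qed.

Lemma l2_partialD u v n :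
  Num.sqrt (series (fun k => modulus ((u + v) k) ^+ 2) n) <=
  Num.sqrt (series (fun k => modulus (u k) ^+ 2) n) +
  Num.sqrt (series (fun k => modulus (v k) ^+ 2) n).
Proof.
elim: n => [|n ih]; first by rewrite /series/= !big_geq// sqrtr0 addr0.
rewrite !seriesSr.
move: (l2_minkowski (Num.sqrt (series (fun k => modulus (u k) ^+ 2) n))
  (Num.sqrt (series (fun k => modulus (v k) ^+ 2) n))
  (modulus (u n)) (modulus (v n))).
rewrite !sqr_sqrtr ?l2_series_ge0//; apply: le_trans.
rewrite ler_wsqrtr// lerD//.
  rewrite -[leLHS]sqr_sqrtr ?l2_series_ge0//.
  by rewrite lerXn2r// nnegrE ?addr_ge0 ?sqrtr_ge0.
by rewrite lerXn2r ?modulusD// nnegrE ?addr_ge0 ?modulus_ge0.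
Qed.

Lemma l2norm_ge0 u : 0 <= l2norm u. Proof. exact: sqrtr_ge0. Qed.

Lemma l2D u v : square_summable u -> square_summable v ->
  square_summable (u + v) /\ l2norm (u + v) <= l2norm u + l2norm v.
Proof.
move=> su sv; apply: l2_bound; first by rewrite addr_ge0 ?l2norm_ge0.
move=> n; rewrite -[leLHS]sqr_sqrtr ?l2_series_ge0//.
rewrite lerXn2r ?nnegrE ?addr_ge0 ?l2norm_ge0 ?sqrtr_ge0//.
apply: (le_trans (l2_partialD _ _ _)); rewrite lerD//.
  by rewrite -[leRHS]ger0_norm ?l2norm_ge0// -sqrtr_sqr ler_wsqrtr ?l2_partial_le.
by rewrite -[leRHS]ger0_norm ?l2norm_ge0// -sqrtr_sqr ler_wsqrtr ?l2_partial_le.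
Qed.

Lemma l2_seriesZ (a : C R) u :
  series (fun k => modulus ((a *: u) k) ^+ 2) =
  (fun n => modulus a ^+ 2 * series (fun k => modulus (u k) ^+ 2) n).
Proof.
apply/funext => n; rewrite /series/= mulr_sumr; apply: eq_bigr => i _.
by rewrite -exprMn -modulusM.
Qed.

Lemma l2Z (a : C R) u : square_summable u ->
  square_summable (a *: u) /\ l2norm (a *: u) = modulus a * l2norm u.
Proof.
move=> su; rewrite /square_summable /l2norm l2_seriesZ; split.
  exact: (is_cvgM (is_cvg_cst _) su).
rewrite (_ : limn _ = modulus a ^+ 2 *
    limn (series (fun k => modulus (u k) ^+ 2))); last first.
  by apply/cvg_lim => //; exact: (cvgM (cvg_cst _) su).
by rewrite sqrtrM ?sqr_ge0// sqrtr_sqr ger0_norm ?modulus_ge0.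
Qed.

Lemma l2norm0_eq0 u : square_summable u -> l2norm u = 0 -> u = 0.
Proof.
move=> su u0; apply/funext => k; apply: (@ComplexField.Normc.eq0_normc R).
have := l2_partial_le k.+1 su; rewrite u0 expr0n/= seriesSr => h.
have : modulus (u k) ^+ 2 <= 0.
  by apply: le_trans h; rewrite lerDr l2_series_ge0.
by rewrite le_eqVlt ltNge sqr_ge0 orbF sqrf_eq0 => /eqP.
Qed.

End Ell2Norm.

Definition ell2_pred {R : realType} : {pred (nat -> C R)} :=
  mem [set u : nat -> C R | square_summable u].

Lemma ell2_submod_closed (R : realType) : submod_closed (@ell2_pred R).
Proof.
have ell2_0 : square_summable (0 : nat -> C R).
  apply: (proj1 (@l2_bound R 0 0 (lexx _) _)) => n.
  rewrite expr0n/= /series/= big1// => i _.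
  by rewrite !expr0n/= addr0 sqrtr0 expr0n.
split; first by rewrite inE.
move=> a u v; rewrite !inE/= => su sv.
exact: (proj1 (l2D (proj1 (l2Z a su)) sv)).
Qed.

HB.instance Definition _ (R : realType) :=
  GRing.isSubmodClosed.Build (C R) (nat -> C R) (@ell2_pred R)
    (ell2_submod_closed R).

Record ell2 (R : realType) :=
  Ell2 { ell2_seq :> nat -> C R; _ : ell2_seq \in ell2_pred }.

HB.instance Definition _ (R : realType) := [isSub for @ell2_seq R].
HB.instance Definition _ (R : realType) := [Choice of ell2 R by <:].
HB.instance Definition _ (R : realType) :=
  [SubChoice_isSubLmodule of ell2 R by <:].

Lemma ell2P (R : realType) (x : ell2 R) : square_summable x.
Proof. by case: x => u /=; rewrite inE. Qed.
Arguments ell2P {R} x.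

Section Ell2Normed.
Context {R : realType}.
Implicit Types x y : ell2 R.

Let norm x : C R := (l2norm x)%:C%C.

Let ler_normD x y : norm (x + y) <= norm x + norm y.
Proof.
rewrite /norm -[leRHS](rmorphD (real_complex R)) /= [leLHS]/=.
by rewrite (@lecR R) (proj2 (l2D (ell2P x) (ell2P y))).
Qed.

Let normrZ (a : C R) x : norm (a *: x) = `|a| * norm x.
Proof.
rewrite /norm modulusE -[RHS](rmorphM (real_complex R)).
by rewrite -(proj2 (l2Z a (ell2P x))).
Qed.

Let normr0_eq0 x : norm x = 0 -> x = 0.
Proof.
move=> [x0]; apply: val_inj; exact: (l2norm0_eq0 (ell2P x)).
Qed.

HB.instance Definition _ :=
  @Lmodule_isNormed.Build (C R) (ell2 R) norm ler_normD normrZ normr0_eq0.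

Lemma ell2_normE x : `|x| = (l2norm x)%:C%C.
Proof. by []. Qed.

End Ell2Normed.

Section Bezout.
Context {R : realType}.
Local Notation C := (C R).

Definition unit_disk : set C := [set z | `|z| < 1].

Definition unit_circle : set C := [set z | `|z| = 1].

Definition open_in_circle (S : set C) :=
  exists2 U : set C, open U & S = unit_circle `&` U.

(* Functions on the disk are represented by total functions on C, of which
   only the restriction to [unit_disk] matters. *)
Definition holomorphic (V : normedModType C) (f : C -> V) :=
  forall z, unit_disk z -> derivable f z 1.

(* A space of analytic functions, together with its V-valued version for each
   normed space V; the scalar space is obtained for V = C, and the l^2-valued
   one for V = ell2. *)
Definition function_space := forall V : normedModType C, set (C -> V).

Definition Hoo : function_space := fun V f =>
  holomorphic f /\ [bounded f z | z in unit_disk].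

Definition A_ (S : set C) : function_space := fun V f =>
  Hoo f /\ exists2 F : C -> V,
    {within unit_disk `|` S, continuous F} & {in unit_disk, F =1 f}.

(* The space written \partial^{-n} A: f, f', ..., f^(n) all belong to A. *)
Definition integrated (n : nat) (A : function_space) : function_space :=
  fun V f => holomorphic f /\ forall j, (j <= n)%N -> A V (f^`(j)).

Local Open Scope ereal_scope.

Definition sup_norm (f : C -> ell2 R) : \bar R :=
  ereal_sup [set (l2norm (f z))%:E | z in unit_disk].

Definition Cn_norm (n : nat) (f : C -> ell2 R) : \bar R :=
  \sum_(0 <= j < n.+1) (j`!%:R^-1)%:E * sup_norm (f^`(j)).

(* The pairing of l^2 is bilinear: no complex conjugation. *)
Definition bezout_solution (f g : C -> ell2 R) :=
  forall z, unit_disk z ->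
    series (fun k => g z k * f z k)%R @ \oo --> (1 : C)%R.

Definition bezout_data n (A : function_space) (delta : R) :
    set (C -> ell2 R) :=
  [set f | [/\ A _ f, Cn_norm n f <= 1 &
    forall z, unit_disk z -> (delta <= l2norm (f z))%R]].

(* Infima and suprema are taken in the extended reals: the infimum is +oo when
   f admits no solution in A, and the supremum is -oo when there are no data
   (delta > 1). *)
Definition bezout_cost n (A : function_space) (f : C -> ell2 R) : \bar R :=
  ereal_inf [set Cn_norm n g | g in [set g | A _ g /\ bezout_solution f g]].

Definition bezout_const n (A : function_space) (delta : R) : \bar R :=
  ereal_sup [set bezout_cost n A f | f in bezout_data n A delta].

End Bezout.

(* Main.v *)
(* For [C(H^oo) <= C(A_S)], the dilations [f_r z = f (r z)] of H^oo data are data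
   for A_S; solutions for them with a common bound converge weakly, along an
   ultrafilter in [r -> 1], to a solution for [f], and the norm is weakly lower
   semicontinuous.

   For [C(A_S) <= C(H^oo)], let [g] be a bounded solution for [f] in A_S, where
   [S] is the trace of an open set on which the Lipschitz function [d] is
   positive. A function [psi] is a multiplier if for every [g] there is an
   analytic [P], bounded up to order [n], such that [P^(n) - psi g^(n)] extends
   continuously to the closed disk. Multipliers form an algebra which contains
   [z] (integration by parts) and [conj z] (backward shift), so Bernstein
   polynomials make them uniformly dense in the Lipschitz functions. In a
   partition of unity of [{d > 0}] by multipliers [phi_k] close to differences of
   cut-offs of [2^k d], set [delta_k z = P_k (r_k z) - P_k z] and
   [G = g + sum_k delta_k]. For [r_k] close to 1 the lower order derivatives
   barely change, while [G^(n)] is nearly the convex combination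
   [(1 - sum_k phi_k) g^(n) + sum_k phi_k g^(n) (r_k z)], so the norm barely grows
   and the irregular part [g^(n)] disappears at [S]. Where [f] is regular so is
   [g^(n) . f], by the Leibniz formula for [g . f = 1]; hence [G . f - 1] is small
   with its derivatives, and [G / (G . f)] is the required solution.

   Cauchy's estimates are obtained from midpoint sums over squares, Goursat's
   bisection and a winding-number count, in place of contour integrals. *)
Require Import Defs.
From mathcomp Require Import all_boot all_order all_algebra.
From mathcomp Require Import all_classical all_reals all_analysis.
From mathcomp Require Import ring lra.
From mathcomp.real_closed Require Import complex.

Set Implicit Arguments.
Unset Strict Implicit.
Unset Printing Implicit Defensive.

Import Order.TTheory GRing.Theory Num.Theory.
Import numFieldTopology.Exports numFieldNormedType.Exports.

Local Open Scope ring_scope.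
Local Open Scope classical_set_scope.

(** The obstacle is [g^(n)], which is merely bounded: near S the difference [g^(n)(r z) - g^(n)(z)]
    may stay as large as twice the supremum, however close r is to 1. Two facts about [g^(n)] are
    exploited instead: its bound, which convex combinations preserve, and the regularity of its
    pairing with f, since [g^(n) . f] is the only term with [g^(n)] in the n-th derivative of g . f
    = 1. Lower derivatives are Lipschitz and cause no trouble. A cut-off times [g(r z) - g(z)] would
    not be analytic; a multiplier restores analyticity at the price of a remainder continuous on the
    closed disk, which a dilation with r near 1 hardly moves. As f is continuous at S but not
    uniformly so, one dilation cannot serve all of S: the sets [{d >= 2^-k}] are compact in the
    closed disk, each gets its own r_k, and errors of order 2^-k are summable. In the other
    direction limits along an ultrafilter exist for all bounded families at once, which spares the
    extraction of subsequences. *)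

(* A reflexive normaliser for linear identities in a module: [module_] reduces
   an equation between linear combinations of vectors to the equations between
   the coefficients of each vector, which it leaves to [field]. *)
Inductive mexp (K : Type) : Type :=
| MVar of nat | MZero | MAdd of mexp K & mexp K | MOpp of mexp K
| MScale of K & mexp K | MMuln of mexp K & nat.
Arguments MVar {K}. Arguments MZero {K}.

Section ModuleNormaliser.
Context (K : pzRingType) (V : lmodType K).
Implicit Types (e : mexp K) (env : seq V).

Fixpoint mexp_eval env e : V :=
  match e with
  | MVar i => nth 0 env i
  | MZero => 0
  | MAdd e1 e2 => mexp_eval env e1 + mexp_eval env e2
  | MOpp e1 => - mexp_eval env e1
  | MScale c e1 => c *: mexp_eval env e1
  | MMuln e1 n => mexp_eval env e1 *+ n
  end.

Fixpoint mexp_coef e (i : nat) : K :=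
  match e with
  | MVar j => if Nat.eqb i j then 1 else 0
  | MZero => 0
  | MAdd e1 e2 => mexp_coef e1 i + mexp_coef e2 i
  | MOpp e1 => - mexp_coef e1 i
  | MScale c e1 => c * mexp_coef e1 i
  | MMuln e1 n => mexp_coef e1 i *+ n
  end.

Fixpoint mexp_coef_eq n e1 e2 : Prop :=
  match n with
  | 0 => True
  | n'.+1 => mexp_coef e1 n' = mexp_coef e2 n' /\ mexp_coef_eq n' e1 e2
  end.

Lemma mexp_evalE env e :
  mexp_eval env e = \sum_(i < size env) mexp_coef e i *: nth 0 env i.
Proof.
elim: e => /= [j||e1 -> e2 ->|e1 ->|c e1 ->|e1 -> n].
- have NE (i k : nat) : Nat.eqb i k = (i == k).
    by elim: i k => [|i ih] [|k]//=; rewrite ih eqSS.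
  case: (ltnP j (size env)) => jn; last first.
    rewrite nth_default// big1// => i _; rewrite NE.
    by rewrite ltn_eqF ?scale0r// (leq_trans (ltn_ord i)).
  rewrite (bigD1 (Ordinal jn))//= NE eqxx scale1r big1 ?addr0// => i ij.
  by rewrite NE (negbTE ij : (i == j :> nat) = false) scale0r.
- by rewrite big1// => i _; rewrite scale0r.
- by rewrite -big_split; apply: eq_bigr => i _; rewrite scalerDl.
- by rewrite -sumrN; apply: eq_bigr => i _; rewrite scaleNr.
- by rewrite scaler_sumr; apply: eq_bigr => i _; rewrite scalerA.
- by rewrite -sumrMnl; apply: eq_bigr => i _; rewrite scalerMnl.
Qed.

Lemma mexp_eval_eq env e1 e2 :
  mexp_coef_eq (size env) e1 e2 -> mexp_eval env e1 = mexp_eval env e2.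
Proof.
move=> h; rewrite !mexp_evalE; apply: eq_bigr => -[i /= ilt] _; congr (_ *: _).
elim: (size env) ilt h => // n ih; rewrite ltnS leq_eqVlt => /predU1P[->|/ih h].
  by case.
by case=> _ /h.
Qed.

End ModuleNormaliser.

Ltac module_mem x l :=
  lazymatch l with
  | nil => constr:(false)
  | cons x _ => constr:(true)
  | cons _ ?l' => module_mem x l'
  end.

Ltac module_atoms t l :=
  lazymatch t with
  | (?a + ?b)%R => let l1 := module_atoms a l in module_atoms b l1
  | (- ?a)%R => module_atoms a l
  | (_ *: ?a)%R => module_atoms a l
  | (?a *+ _)%R => module_atoms a l
  | 0%R => l
  | _ => lazymatch module_mem t l with
         | true => l
         | false => constr:(cons t l)
         end
  end.

Ltac module_index x l :=
  lazymatch l with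
  | cons x _ => constr:(O)
  | cons _ ?l' => let n := module_index x l' in constr:(S n)
  end.

Ltac module_reify K t l :=
  lazymatch t with
  | (?a + ?b)%R => let a' := module_reify K a l in let b' := module_reify K b l in
                   constr:(@MAdd K a' b')
  | (- ?a)%R => let a' := module_reify K a l in constr:(@MOpp K a')
  | (?c *: ?a)%R => let a' := module_reify K a l in constr:(@MScale K c a')
  | (?a *+ ?n)%R => let a' := module_reify K a l in constr:(@MMuln K a' n)
  | 0%R => constr:(@MZero K)
  | _ => let n := module_index t l in constr:(@MVar K n)
  end.

Ltac module_over K V :=
  cbv beta delta [reverse_coercion];
  lazymatch goal with
  | |- ?x = ?y =>
    let l0 := constr:(@nil V) in
    let l1 := module_atoms x l0 in let l := module_atoms y l1 in
    let x' := module_reify K x l in let y' := module_reify K y l in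
    change (@mexp_eval K V l x' = @mexp_eval K V l y');
    apply: mexp_eval_eq;
    cbn [size mexp_coef_eq mexp_coef Nat.eqb]
  end.

Ltac module_ K V := module_over K V; repeat split; (ring || (field; done)).


(** * Norms with values in the real field *)

Definition nm {R : realType} {V : normedModType (C R)} (x : V) : R :=
  complex.Re `|x|.

Section RealNorm.
Context {R : realType}.
Implicit Types (V : normedModType (C R)) (a z : C R) (r : R).

(** A nonnegative element of [C R] is real, because the order of the complex numbers compares only
    numbers with equal imaginary parts. Passing to [nm] thus loses nothing and moves inequalities to
    an ordered field, where [lra] decides them. *)
Lemma normE V (x : V) : `|x| = (nm x)%:C%C.
Proof.
have := normr_ge0 x; rewrite /nm; case: `|x| => a b.
by rewrite lecE/= => /andP[/eqP -> _].
Qed.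

Lemma nm_ge0 V (x : V) : 0 <= nm x.
Proof. by have := normr_ge0 x; rewrite normE lecR. Qed.

Lemma nmD V (x y : V) : nm (x + y) <= nm x + nm y.
Proof.
have := ler_normD x y.
by rewrite !normE -[X in _ <= X](rmorphD (real_complex R)) lecR.
Qed.

Lemma nmN V (x : V) : nm (- x) = nm x.
Proof. by rewrite /nm normrN. Qed.

Lemma nmB V (x y : V) : nm (x - y) <= nm x + nm y.
Proof. by rewrite -(nmN y) nmD. Qed.

Lemma nm_distC V (x y : V) : nm (x - y) = nm (y - x).
Proof. by rewrite -nmN opprB. Qed.

Lemma nm_tri V (x y z : V) : nm (x - z) <= nm (x - y) + nm (y - z).
Proof. by rewrite (le_trans _ (nmD _ _))// addrA subrK. Qed.

Lemma nm0 V : nm (0 : V) = 0.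
Proof. by rewrite /nm normr0. Qed.

Lemma nm_eq0 V (x : V) : nm x = 0 -> x = 0.
Proof. by move=> x0; apply: normr0_eq0; rewrite normE x0. Qed.

Lemma nm_gt0 V (x : V) : x != 0 -> 0 < nm x.
Proof.
move=> x0; rewrite lt_neqAle nm_ge0 andbT eq_sym.
by apply: contra x0 => /eqP/nm_eq0 ->.
Qed.

Lemma nmZ V a (x : V) : nm (a *: x) = nm a * nm x.
Proof.
have := normrZ a x; rewrite !normE -[RHS](rmorphM (real_complex R)) => -[].
by [].
Qed.

Lemma nmM a z : nm (a * z) = nm a * nm z.
Proof. exact: (nmZ a z). Qed.

Lemma nmV a : nm a^-1 = (nm a)^-1.
Proof.
have [->|a0] := eqVneq a 0; first by rewrite invr0 nm0 invr0.
apply: (mulfI (lt0r_neq0 (nm_gt0 a0))).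
rewrite -nmM !mulfV//; last exact: lt0r_neq0 (nm_gt0 a0).
by rewrite /nm normr1.
Qed.

Lemma nm_modulus z : nm z = modulus z.
Proof. by []. Qed.

Lemma nm_real r : nm (r%:C%C : C R) = `|r|.
Proof. by rewrite nm_modulus /modulus/= expr0n/= addr0 sqrtr_sqr. Qed.

Lemma nm1 : nm (1 : C R) = 1.
Proof. by rewrite /nm normr1. Qed.

Lemma nm_nat n : nm (n%:R : C R) = n%:R.
Proof. by rewrite /nm normr_nat -(rmorph_nat (real_complex R)). Qed.

Lemma nmX z n : nm (z ^+ n) = nm z ^+ n.
Proof. by elim: n => [|n ih]; rewrite ?expr0 ?nm1// !exprS nmM ih. Qed.

Lemma nmMn V (x : V) n : nm (x *+ n) = nm x *+ n.
Proof. by rewrite -scaler_nat nmZ nm_nat mulr_natl. Qed.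

Lemma nm_sum V (I : Type) (s : seq I) (P : pred I) (F : I -> V) :
  nm (\sum_(i <- s | P i) F i) <= \sum_(i <- s | P i) nm (F i).
Proof.
elim/big_ind2 : _ => //; first by rewrite nm0.
by move=> x a y b xa yb; rewrite (le_trans (nmD _ _))// lerD.
Qed.

Lemma nm_l2 (x : ell2 R) : nm x = l2norm x.
Proof. by []. Qed.

Lemma le_nm_Re z : `|complex.Re z| <= nm z.
Proof.
rewrite nm_modulus /modulus; case: z => a b /=.
by rewrite -sqrtr_sqr ler_wsqrtr// lerDl sqr_ge0.
Qed.

Lemma le_nm_Im z : `|complex.Im z| <= nm z.
Proof.
rewrite nm_modulus /modulus; case: z => a b /=.
by rewrite -sqrtr_sqr ler_wsqrtr// lerDr sqr_ge0.
Qed.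

Lemma nm_leRI z : nm z <= `|complex.Re z| + `|complex.Im z|.
Proof.
have {1}-> : z = (complex.Re z)%:C%C + (complex.Im z)%:C%C * 'i%C :> C R.
  by case: z => a b; simpc.
rewrite (le_trans (nmD _ _))// nmM !nm_real/=.
have -> : nm ('i%C : C R) = 1.
  by rewrite nm_modulus /modulus/= expr0n/= add0r expr1n sqrtr1.
by rewrite mulr1.
Qed.

Lemma sqr_nm z : nm z ^+ 2 = complex.Re z ^+ 2 + complex.Im z ^+ 2.
Proof.
by case: z => a b; rewrite nm_modulus /modulus/= sqr_sqrtr ?addr_ge0 ?sqr_ge0.
Qed.

Lemma pos_complex (e : C R) : 0 < e -> e = (complex.Re e)%:C%C /\ 0 < complex.Re e.
Proof. by case: e => a b; rewrite ltcE/= => /andP[/eqP -> ->]. Qed.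

Lemma nbhs_nmP V (x : V) (A : set V) :
  nbhs x A <-> exists2 d, 0 < d & forall y, nm (y - x) < d -> A y.
Proof.
split.
  rewrite -nbhs_ballE => -[e/= /pos_complex[eE e0] xA].
  exists (complex.Re e) => // y xy; apply: xA.
  by rewrite -ball_normE/= eE -opprB normrN normE ltcR.
move=> [d d0 dA]; rewrite -nbhs_ballE; exists d%:C%C => /=; first by rewrite ltcR.
by move=> y; rewrite -ball_normE/= -opprB normrN normE ltcR; exact: dA.
Qed.

End RealNorm.

(** * Complex derivatives of vector-valued functions *)

Section ComplexDerivative.
Context {R : realType}.
Implicit Types (V : normedModType (C R)).

(** The remainder form avoids the quotient: it is trivial at [w = 0], adds up under bilinear
    operations, and follows at once from a quadratic bound on the remainder, which is how limits of
    functions are differentiated below. *)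
Definition cd V (f : C R -> V) (z : C R) (d : V) :=
  forall e : R, 0 < e -> exists2 r : R, 0 < r &
    forall w, nm w < r -> nm (f (z + w) - f z - w *: d) <= e * nm w.

Lemma cdP V (f : C R -> V) z d :
  cd f z d <-> h^-1 *: (f (h + z) - f z) @[h --> 0^'] --> d.
Proof.
split=> [fd|fd e e0].
  apply/cvgrPdist_le => e /pos_complex[eE e0].
  have [r r0 fr] := fd _ e0.
  apply/nbhs_nmP; exists r => // h; rewrite subr0 => hr h0.
  have fh := fr _ hr; rewrite eE normE lecR nm_distC.
  have -> : h^-1 *: (f (h + z) - f z) - d = h^-1 *: (f (z + h) - f z - h *: d).
    by rewrite [RHS]scalerBr scalerA mulVf// scale1r (addrC z).
  by rewrite nmZ nmV mulrC ler_pdivrMr// nm_gt0.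
have eC : 0 < e%:C%C :> C R by rewrite ltcR.
move/cvgrPdist_le : fd => /(_ _ eC) /nbhs_nmP[r r0 fr].
exists r => // w wr; have [->|w0] := eqVneq w 0.
  by rewrite addr0 subrr sub0r scale0r oppr0 !nm0 mulr0.
have := fr w; rewrite subr0 => /(_ wr w0); rewrite normE lecR => h; rewrite nm_distC in h.
have -> : f (z + w) - f z - w *: d = w *: (w^-1 *: (f (w + z) - f z) - d).
  by rewrite [RHS]scalerBr scalerA mulfV// scale1r (addrC z).
by rewrite nmZ mulrC ler_wpM2r ?nm_ge0.
Qed.

Lemma cd_derive1 V (f : C R -> V) z d : cd f z d -> f^`() z = d.
Proof. by move=> /cdP fd; rewrite /derive1; apply/cvg_lim. Qed.

Lemma derivable_cd V (f : C R -> V) z : derivable f z 1 <-> exists d, cd f z d.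
Proof.
rewrite /derivable.
rewrite (_ : (fun h => h^-1 *: ((f \o shift z) (h *: 1) - f z)) =
   (fun h => h^-1 *: (f (h + z) - f z))); last first.
  by apply/funext => h /=; rewrite /GRing.scale/= mulr1.
split=> [/cvg_ex[d fd]|[d /cdP fd]]; first by exists d; apply/cdP.
by apply/cvg_ex; exists d.
Qed.

Lemma derivable_cd1 V (f : C R -> V) z : derivable f z 1 -> cd f z (f^`() z).
Proof. by move=> /derivable_cd[d fd]; rewrite (cd_derive1 fd). Qed.

Lemma cd_local V (f g : C R -> V) z d (r : R) : 0 < r ->
  (forall w, nm w < r -> f (z + w) = g (z + w)) -> cd f z d -> cd g z d.
Proof.
move=> r0 fg fd e e0; have [s s0 fs] := fd _ e0.
exists (Num.min r s); first by rewrite lt_min r0.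
move=> w; rewrite lt_min => /andP[wr ws].
by have := fs _ ws; rewrite fg// -{2}(addr0 z) fg ?nm0// addr0.
Qed.

Lemma cd_cst V (c : V) z : cd (fun=> c) z 0.
Proof.
move=> e e0; exists 1 => // w _.
by rewrite subrr scaler0 subr0 nm0 mulr_ge0 ?nm_ge0// ltW.
Qed.

Lemma cd_id z : cd (fun w : C R => w) z (1 : C R).
Proof.
move=> e e0; exists 1 => // w _.
rewrite /GRing.scale/= mulr1 (_ : z + w - z - w = 0); last by ring.
by rewrite nm0 mulr_ge0 ?nm_ge0// ltW.
Qed.

Lemma cdD V (f g : C R -> V) z d d' :
  cd f z d -> cd g z d' -> cd (fun w => f w + g w) z (d + d').
Proof.
move=> fd gd e e0; have e2 : 0 < e / 2 by lra.
have [r r0 fr] := fd _ e2; have [s s0 gs] := gd _ e2.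
exists (Num.min r s); first by rewrite lt_min r0.
move=> w; rewrite lt_min => /andP[/fr fw /gs gw].
have -> : f (z + w) + g (z + w) - (f z + g z) - w *: (d + d') =
  (f (z + w) - f z - w *: d) + (g (z + w) - g z - w *: d').
  by module_ (C R) V.
apply: (le_trans (nmD _ _)).
by rewrite (_ : e * nm w = e / 2 * nm w + e / 2 * nm w) ?lerD//; lra.
Qed.

Lemma cd_cont V (f : C R -> V) z d : cd f z d ->
  forall e : R, 0 < e -> exists2 r : R, 0 < r &
    forall w, nm w < r -> nm (f (z + w) - f z) <= e.
Proof.
move=> fd e e0; have [r r0 fr] := fd 1 ltr01.
have K : 0 < 1 + nm d by rewrite ltr_pwDl ?nm_ge0.
exists (Num.min r (e / (1 + nm d))); first by rewrite lt_min r0 divr_gt0.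
move=> w; rewrite lt_min => /andP[/fr fw]; rewrite ltr_pdivlMr// => we.
have -> : f (z + w) - f z = (f (z + w) - f z - w *: d) + w *: d by rewrite subrK.
apply: (le_trans (nmD _ _)); rewrite nmZ.
by move: fw we; rewrite mul1r mulrDr mulr1; lra.
Qed.

(** One product rule for scalar multiples, products of numbers and the pairing of l^2. The remainder
    splits into the two first-order remainders and the pairing of [w *: d] with the increment of
    [g], which is of smaller order than [w]. *)
Lemma cd_bilin (V1 V2 V3 : normedModType (C R)) (b : V1 -> V2 -> V3) f g z d d' :
  (forall x x' y, b (x + x') y = b x y + b x' y) ->
  (forall x y y', b x (y + y') = b x y + b x y') ->
  (forall a x y, b (a *: x) y = a *: b x y) ->
  (forall a x y, b x (a *: y) = a *: b x y) ->
  (forall x y, nm (b x y) <= nm x * nm y) ->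
  cd f z d -> cd g z d' -> cd (fun w => b (f w) (g w)) z (b d (g z) + b (f z) d').
Proof.
move=> bDl bDr bZl bZr bn fd gd e e0.
have bNl x y : b (- x) y = - b x y by rewrite -scaleN1r bZl scaleN1r.
have bNr x y : b x (- y) = - b x y by rewrite -scaleN1r bZr scaleN1r.
(* [K] bounds every factor that meets an error [e1], so each of the three terms costs at most a
   third of [e]. *)
pose K := 1 + nm (g z) + nm (f z) + nm d.
have K0 : 0 < K.
  by have := nm_ge0 (g z); have := nm_ge0 (f z); have := nm_ge0 d; rewrite /K; lra.
pose e1 := Num.min 1 (e / (3 * K)).
have e10 : 0 < e1 by rewrite lt_min ltr01 divr_gt0// mulr_gt0.
have e1e : e1 * K <= e / 3.
  rewrite (_ : e / 3 = e / (3 * K) * K); last by field; exact: lt0r_neq0.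
  by rewrite ler_pM2r// ge_min lexx orbT.
have [r r0 fr] := fd _ e10; have [s s0 gs] := gd _ e10.
have [t t0 gt] := cd_cont gd e10.
exists (Num.min r (Num.min s t)); first by rewrite !lt_min r0 s0.
move=> w; rewrite !lt_min => /and3P[/fr fw /gs gw /gt gw'].
set F := f (z + w) in fw *; set G := g (z + w) in gw gw' *.
have -> : b F G - b (f z) (g z) - w *: (b d (g z) + b (f z) d') =
   b (F - f z - w *: d) G + (b (f z) (G - g z - w *: d') + w *: b d (G - g z)).
  by rewrite !(bDl, bDr, bNl, bNr, bZl, bZr); module_ (C R) V3.
have w0 := nm_ge0 w; have G1 : nm G <= nm (g z) + e1.
  by have := nmD (G - g z) (g z); rewrite subrK; lra.
have e11 : e1 <= 1 by rewrite ge_min lexx.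
apply: (le_trans (nmD _ _)); apply: (@le_trans _ _
   (e1 * K * nm w + (e1 * K * nm w + e1 * K * nm w))); last first.
  by have := ler_wpM2r w0 e1e; lra.
have gz := nm_ge0 (g z); have fz := nm_ge0 (f z); have d0 := nm_ge0 d.
have gK : nm (g z) + e1 <= K by rewrite /K; lra.
have fK : nm (f z) <= K by rewrite /K; lra.
have dK : nm d <= K by rewrite /K; lra.
apply: lerD.
  apply: (le_trans (bn _ _)); rewrite [leRHS]mulrAC.
  by apply: ler_pM => //; rewrite ?nm_ge0// (le_trans G1).
apply: (le_trans (nmD _ _)); apply: lerD.
  apply: (le_trans (bn _ _)); rewrite [leRHS]mulrAC [leLHS]mulrC.
  by apply: ler_pM => //; rewrite ?nm_ge0.
rewrite nmZ mulrC ler_wpM2r//; apply: (le_trans (bn _ _)); rewrite [leLHS]mulrC.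
by apply: ler_pM => //; rewrite ?nm_ge0.
Qed.

Lemma cdZ V (f : C R -> C R) (g : C R -> V) z d d' :
  cd f z d -> cd g z d' -> cd (fun w => f w *: g w) z (d *: g z + f z *: d').
Proof.
apply: (cd_bilin (b := fun (a : C R) (x : V) => a *: x)).
- by move=> a c x; rewrite scalerDl.
- by move=> a x y; rewrite scalerDr.
- by move=> c a x; rewrite scalerA.
- by move=> a x y; rewrite !scalerA mulrC.
- by move=> a x; rewrite nmZ.
Qed.

Lemma cdM (f g : C R -> C R) z d d' :
  cd f z d -> cd g z d' -> cd (fun w => f w * g w) z (d * g z + f z * d').
Proof. exact: cdZ. Qed.

Lemma cdcZ V (a : C R) (g : C R -> V) z d' :
  cd g z d' -> cd (fun w => a *: g w) z (a *: d').
Proof. by move=> gd; have := cdZ (cd_cst a z) gd; rewrite scale0r add0r. Qed.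

Lemma cdN V (g : C R -> V) z d : cd g z d -> cd (fun w => - g w) z (- d).
Proof.
move=> gd; rewrite -scaleN1r (_ : (fun w => - g w) = (fun w => -1 *: g w)).
  exact: cdcZ.
by apply/funext => w; rewrite scaleN1r.
Qed.

Lemma cdB V (f g : C R -> V) z d d' :
  cd f z d -> cd g z d' -> cd (fun w => f w - g w) z (d - d').
Proof. by move=> fd gd; apply: cdD => //; exact: cdN. Qed.

Lemma cd_affine V (f : C R -> V) (a c z : C R) d :
  cd f (a + c * z) d -> cd (fun w => f (a + c * w)) z (c *: d).
Proof.
move=> fd e e0; have K : 0 < 1 + nm c by rewrite ltr_pwDl ?nm_ge0.
have [r r0 fr] := fd (e / (1 + nm c)) (divr_gt0 e0 K).
exists (r / (1 + nm c)); first exact: divr_gt0.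
move=> w; rewrite ltr_pdivlMr// => wr.
have cw : nm (c * w) <= (1 + nm c) * nm w by rewrite nmM ler_wpM2r ?nm_ge0// lerDr.
have /fr : nm (c * w) < r by rewrite (le_lt_trans cw)// mulrC.
rewrite (_ : a + c * z + c * w = a + c * (z + w)); last by ring.
rewrite scalerA (mulrC w) => h; apply: (le_trans h).
by rewrite mulrAC ler_pdivrMr// -mulrA ler_wpM2l ?(ltW e0)// [leRHS]mulrC.
Qed.

Lemma cdV (f : C R -> C R) z d : f z != 0 -> cd f z d ->
  cd (fun w => (f w)^-1) z (- d * (f z)^-1 ^+ 2).
Proof.
move=> f0 fd e e0; set F := f z in f0 *.
have F0 := nm_gt0 f0; have d0 := nm_ge0 d.
(* Close to [z] the inverse of [f] is at most [2 / nm F]. The two terms of the identity below then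
   carry the weights [2 / nm F ^+ 2] and [2 * nm d / nm F ^+ 3], which [e1] and [e3] turn into
   halves of [e]. *)
pose e1 := e * nm F ^+ 2 / 4.
have e10 : 0 < e1 by rewrite divr_gt0// mulr_gt0// exprn_gt0.
have e2 : 0 < nm F / 2 by rewrite divr_gt0.
pose e3 := e * nm F ^+ 3 / (4 * (1 + nm d)).
have K : 0 < 1 + nm d by lra.
have e30 : 0 < e3 by rewrite divr_gt0// ?mulr_gt0// exprn_gt0.
have [r r0 fr] := fd _ e10; have [s s0 fs] := cd_cont fd e2.
have [t t0 ft] := cd_cont fd e30.
exists (Num.min r (Num.min s t)); first by rewrite !lt_min r0 s0.
move=> w; rewrite !lt_min => /and3P[/fr fw /fs gw /ft hw].
set G := f (z + w) in fw gw hw *.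
have G2 : nm F / 2 <= nm G.
  have : nm F <= nm (G - F) + nm G.
    by have := nmD (F - G) G; rewrite subrK nm_distC.
  by lra.
have G0 : G != 0.
  by apply/eqP => G0; move: G2; rewrite G0 nm0; lra.
have w0 := nm_ge0 w; rewrite /GRing.scale/=.
have -> : G^-1 - F^-1 - w * (- d * F^-1 ^+ 2) =
   - (G - F - w * d) * (G^-1 * F^-1) + w * d * ((G - F) * (G^-1 * (F^-1 * F^-1))).
  by field; rewrite f0 G0.
have Gi : nm G^-1 <= 2 * (nm F)^-1.
  rewrite nmV -[leRHS](invrK) invfM invrK lef_pV2 ?posrE//; last first.
  - by rewrite mulr_gt0.
  - by rewrite (lt_le_trans _ G2).
  by rewrite mulrC.
have Fi := nmV F; have Fi0 : 0 <= (nm F)^-1 by rewrite invr_ge0 ltW.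
apply: (le_trans (nmD _ _)); rewrite !nmM nmN Fi.
apply: (@le_trans _ _ (e / 2 * nm w + e / 2 * nm w)); last by lra.
apply: lerD.
  apply: (@le_trans _ _ (e1 * nm w * (2 * (nm F)^-1 * (nm F)^-1))).
    by apply: ler_pM => //; rewrite ?nm_ge0 ?mulr_ge0 ?nm_ge0// ler_wpM2r.
  rewrite /e1 le_eqVlt; apply/orP; left; apply/eqP; field; exact: lt0r_neq0.
apply: (@le_trans _ _ (nm w * (1 + nm d) * (e3 * (2 * (nm F)^-1 * ((nm F)^-1 * (nm F)^-1))))).
  apply: ler_pM; rewrite ?mulr_ge0 ?nm_ge0//.
    by rewrite ler_wpM2l// lerDr.
  by apply: ler_pM; rewrite ?mulr_ge0 ?nm_ge0// ler_wpM2r// mulr_ge0.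
rewrite /e3 le_eqVlt; apply/orP; left; apply/eqP; field.
by rewrite !lt0r_neq0.
Qed.

Lemma cd_comp_shift V (f : C R -> V) (a z : C R) d :
  cd f (z + a) d -> cd (fun w => f (w + a)) z d.
Proof.
move=> fd; have := @cd_affine _ f a 1 z d.
rewrite mul1r addrC scale1r => /(_ fd).
by rewrite (_ : (fun w => f (a + 1 * w)) = fun w => f (w + a))//; apply/funext => w; rewrite mul1r addrC.
Qed.

End ComplexDerivative.

(** * Limits along ultrafilters and completeness of the complex numbers and of l^2 *)

Section VectorLimits.
Context {R : realType}.
Implicit Types (V : normedModType (C R)).

(** The filter is a parameter so that ordinary limits and limits along an ultrafilter share their
    rules. *)
Definition vcv V (F : set_system nat) (z : nat -> V) (l : V) :=
  forall e : R, 0 < e -> \forall m \near F, nm (z m - l) <= e.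

Lemma vcvP V (z : nat -> V) l : z @ \oo --> l <-> vcv \oo z l.
Proof.
split=> [zl e e0|zl].
  have eC : 0 < e%:C%C :> C R by rewrite ltcR.
  move/cvgrPdist_le : zl => /(_ _ eC); apply: filterS => m.
  by rewrite normE lecR nm_distC.
apply/cvgrPdist_le => e /pos_complex[-> e0]; have := zl _ e0.
by apply: filterS => m; rewrite normE lecR nm_distC.
Qed.

Lemma vcv_cvg V (F : set_system nat) {FF : Filter F} (z : nat -> V) l :
  vcv F z l -> (fun m => nm (z m)) @ F --> nm l.
Proof.
move=> zl; apply/cvgrPdist_le => e /zl; apply: filterS => m; apply: le_trans.
rewrite ler_norml; apply/andP; split.
  have := nmD (z m - l) l; rewrite subrK; lra.
have := nmD (l - z m) (z m); rewrite subrK nm_distC; lra.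
Qed.

Lemma vcv_le V (F : set_system nat) {FF : ProperFilter F} (z : nat -> V) l (B : R) :
  vcv F z l -> (\forall m \near F, nm (z m) <= B) -> nm l <= B.
Proof. by move=> /vcv_cvg; exact: cvgr_to_le. Qed.

Lemma vcv_cst V (F : set_system nat) {FF : Filter F} (c : V) : vcv F (fun=> c) c.
Proof. by move=> e e0; apply: filterE => m; rewrite subrr nm0 ltW. Qed.

Lemma vcvD V (F : set_system nat) {FF : Filter F} (z z' : nat -> V) l l' :
  vcv F z l -> vcv F z' l' -> vcv F (fun m => z m + z' m) (l + l').
Proof.
move=> zl zl' e e0; have e2 : 0 < e / 2 by lra.
apply: filterS2 (zl _ e2) (zl' _ e2) => m h h'.
rewrite opprD addrACA; apply: (le_trans (nmD _ _)).
by move: h h'; lra.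
Qed.

Lemma vcvZ V (F : set_system nat) {FF : Filter F} (a : C R) (z : nat -> V) l :
  vcv F z l -> vcv F (fun m => a *: z m) (a *: l).
Proof.
move=> zl e e0; have a0 : 0 < 1 + nm a by rewrite ltr_pwDl ?nm_ge0.
apply: filterS (zl _ (divr_gt0 e0 a0)) => m; rewrite -scalerBr nmZ => h.
apply: (@le_trans _ _ ((1 + nm a) * (e / (1 + nm a)))).
  by apply: ler_pM; rewrite ?nm_ge0// lerDr.
by rewrite mulrC divfK// lt0r_neq0.
Qed.

Lemma vcvN V (F : set_system nat) {FF : Filter F} (z : nat -> V) l :
  vcv F z l -> vcv F (fun m => - z m) (- l).
Proof.
by move=> zl e /zl; apply: filterS => m; rewrite -opprD nmN.
Qed.

Lemma vcvB V (F : set_system nat) {FF : Filter F} (z z' : nat -> V) l l' :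
  vcv F z l -> vcv F z' l' -> vcv F (fun m => z m - z' m) (l - l').
Proof. by move=> zl zl'; apply: vcvD => //; exact: vcvN. Qed.

Lemma vcv_unique V (F : set_system nat) {FF : ProperFilter F} (z : nat -> V) l l' :
  vcv F z l -> vcv F z l' -> l = l'.
Proof.
move=> zl zl'; apply/eqP; rewrite -subr_eq0; apply/eqP/nm_eq0/eqP.
rewrite eq_le nm_ge0 andbT; apply: (vcv_le (vcvB zl zl')).
by apply: filterE => m; rewrite subrr nm0.
Qed.

Lemma vcv_ooP V (z : nat -> V) l :
  vcv \oo z l <-> forall e : R, 0 < e -> exists N, forall m, (N <= m)%N -> nm (z m - l) <= e.
Proof.
split=> zl e /zl; first by move=> [N _ zN]; exists N => m Nm; exact: zN.
by move=> [N zN]; exists N.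
Qed.

Definition cauchy_seq V (z : nat -> V) := forall e : R, 0 < e ->
  exists N, forall i j, (N <= i)%N -> (N <= j)%N -> nm (z i - z j) <= e.

Definition complete_space V := forall z : nat -> V, cauchy_seq z -> exists l, vcv \oo z l.

Lemma cauchy_seq_bounded V (z : nat -> V) : cauchy_seq z ->
  exists B : R, forall m, nm (z m) <= B.
Proof.
move=> /(_ 1 ltr01)[N zN].
exists (1 + nm (z N) + \sum_(i < N) nm (z i)) => m; case: (leqP N m) => Nm.
  have := zN _ _ Nm (leqnn N); have := nmD (z m - z N) (z N); rewrite subrK.
  have : 0 <= \sum_(i < N) nm (z i) by rewrite sumr_ge0// => i _; exact: nm_ge0.
  by lra.
rewrite (bigD1 (Ordinal Nm))//=.
have : 0 <= \sum_(i < N | i != Ordinal Nm) nm (z i).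
  by rewrite sumr_ge0// => i _; exact: nm_ge0.
by have := nm_ge0 (z N); lra.
Qed.

(* The last hypothesis only asks for a limit along [U] in a sense for which closed
   balls are closed, such as weak convergence. *)
Lemma cauchy_seq_cvg V (U : set_system nat) {UU : ProperFilter U} (z : nat -> V) :
  \oo `<=` U -> cauchy_seq z ->
  (exists l, forall i (B : R), (\forall j \near U, nm (z i - z j) <= B) -> nm (z i - l) <= B) ->
  exists l, vcv \oo z l.
Proof.
move=> ooU zC [l zl]; exists l; apply/vcv_ooP => e /zC[N zN].
exists N => m Nm; apply: zl; apply: ooU; exists N => // j Nj; exact: zN.
Qed.

End VectorLimits.

Section UltraLimits.
Context {R : realType}.
Context (U : set_system nat) (UU : UltraFilter U).
Local Instance U_proper : ProperFilter U := ultra_proper.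

(** A segment is compact, so the image filter has a cluster point, and an ultrafilter converges to
    each of its cluster points. *)
Lemma ultra_cvg_real (x : nat -> R) (B : R) :
  (forall m, `|x m| <= B) -> exists l : R, x @ U --> l.
Proof.
move=> xB; have [|l [_ lU]] := @segment_compact R (- B) B (x @ U).
  apply: (@filterE _ U) => m /=.
  rewrite in_itv/= -ler_norml; exact: xB.
exists l => A lA; have [//|UA] := @in_ultra_setVsetC _ U (x @^-1` A) UU.
have [|y [Ay]] := lU (~` A) A _ lA; last by move=> /Ay.
exact: UA.
Qed.

Lemma ultra_cvg_complex (z : nat -> C R) (B : R) :
  (forall m, nm (z m) <= B) -> exists l, vcv U z l.
Proof.
move=> zB.
have [a za] := @ultra_cvg_real (fun m => complex.Re (z m)) B
  (fun m => le_trans (le_nm_Re _) (zB m)).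
have [b zb] := @ultra_cvg_real (fun m => complex.Im (z m)) B
  (fun m => le_trans (le_nm_Im _) (zB m)).
exists (a +i* b)%C => e e0; have e2 : 0 < e / 2 by lra.
move/cvgrPdist_le : za => /(_ _ e2) za; move/cvgrPdist_le : zb => /(_ _ e2) zb.
apply: filterS2 za zb => m; rewrite distrC (distrC b) => ha hb.
apply: (le_trans (nm_leRI _)); rewrite /=.
rewrite (_ : complex.Re _ = complex.Re (z m) - a); last by case: (z m).
rewrite (_ : complex.Im _ = complex.Im (z m) - b); last by case: (z m).
by move: ha hb; lra.
Qed.

End UltraLimits.

Lemma exists_ultra_nat : exists U : set_system nat, UltraFilter U /\ \oo `<=` U.
Proof. exact: ultraFilterLemma. Qed.

Section Completeness.
Context {R : realType}.

Lemma complete_complex : complete_space (C R : normedModType (C R)).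
Proof.
move=> z zC; have [U [UU ooU]] := exists_ultra_nat.
have [B zB] := cauchy_seq_bounded zC.
have [l zl] := ultra_cvg_complex UU zB.
apply: (cauchy_seq_cvg (UU := ultra_proper) ooU zC); exists l => i M.
have UP : ProperFilter U by exact: ultra_proper.
by apply: vcv_le; apply: vcvB => //; exact: vcv_cst.
Qed.

Lemma ell2_coord_le (u : ell2 R) k : nm (u k) <= nm u.
Proof.
have := l2_partial_le k.+1 (ell2P u); rewrite seriesSr => h.
rewrite -(@ler_pXn2r _ 2) ?nnegrE ?nm_ge0//; apply: le_trans h.
by rewrite lerDr l2_series_ge0.
Qed.

Lemma ell2_partial_cvg (F : set_system nat) {FF : Filter F} (u : nat -> nat -> C R)
    (w : nat -> C R) N : (forall k, vcv F (fun m => u m k) (w k)) ->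
  (fun m => series (fun k => modulus (u m k) ^+ 2) N) @ F -->
   series (fun k => modulus (w k) ^+ 2) N.
Proof.
move=> uw; rewrite /series/=; elim: N => [|N ih].
  rewrite big_geq//; apply: cvg_near_cst; apply: filterE => m.
  by rewrite big_geq.
rewrite big_nat_recr//=.
rewrite (_ : (fun m => _) = (fun m => \sum_(0 <= k < N) modulus (u m k) ^+ 2 +
  modulus (u m N) * modulus (u m N))); last first.
  by apply/funext => m; rewrite big_nat_recr//= expr2.
by apply: cvgD => //; rewrite expr2; apply: cvgM; exact: (vcv_cvg (uw N)).
Qed.

(** Fatou's lemma for coordinatewise limits: a partial sum involves finitely many coordinates, hence
    passes to the limit together with its bound [B ^+ 2]. *)
Lemma ell2_weak_limit (F : set_system nat) {FF : ProperFilter F} (u : nat -> ell2 R)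
    (w : nat -> C R) (B : R) : (forall k, vcv F (fun m => u m k) (w k)) ->
  0 <= B -> (\forall m \near F, nm (u m) <= B) -> square_summable w /\ l2norm w <= B.
Proof.
move=> uw B0 uB; apply: l2_bound => // N.
apply: (@cvgr_to_le _ F FF _ _ _ _ (@ell2_partial_cvg F _ (fun m => u m) w N uw)).
apply: filterS uB => m umB.
apply: (le_trans (l2_partial_le N (ell2P (u m)))).
by rewrite lerXn2r ?nnegrE ?l2norm_ge0.
Qed.

Lemma ell2_weak_lsc (F : set_system nat) {FF : ProperFilter F} (u : nat -> ell2 R)
    (v : ell2 R) (B : R) : (forall k, vcv F (fun m => u m k) (v k)) ->
  (\forall m \near F, nm (u m) <= B) -> nm v <= B.
Proof.
move=> uv uB; have B0 : 0 <= B.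
  by near F => m; apply: (le_trans (nm_ge0 (u m))); near: m.
exact: (ell2_weak_limit uv B0 uB).2.
Unshelve. all: by end_near. Qed.

(** Weak compactness of balls: along an ultrafilter all coordinates converge at once, so no diagonal
    subsequence has to be chosen. *)
Lemma ell2_weak_compact (U : set_system nat) (UU : UltraFilter U) (u : nat -> ell2 R)
    (B : R) : (forall m, nm (u m) <= B) ->
  exists2 v : ell2 R, nm v <= B & forall k, vcv U (fun m => u m k) (v k).
Proof.
move=> uB; have B0 : 0 <= B by rewrite (le_trans (nm_ge0 (u 0%N))).
have /choice[w uw] : forall k, exists l, vcv U (fun m => u m k) l.
  move=> k; apply: (@ultra_cvg_complex _ U UU _ B) => m.
  by rewrite (le_trans (ell2_coord_le _ _)).
have UP : ProperFilter U by exact: ultra_proper.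
have [|sw wB] := @ell2_weak_limit U UP u w B uw B0; first exact: filterE.
have w2 : w \in ell2_pred by rewrite inE.
by exists (Ell2 w2).
Qed.

Lemma complete_ell2 : complete_space (ell2 R).
Proof.
move=> z zC; have [U [UU ooU]] := exists_ultra_nat.
have UP : ProperFilter U by exact: ultra_proper.
have [B zB] := cauchy_seq_bounded zC.
have [l _ zl] := ell2_weak_compact UU zB.
apply: (cauchy_seq_cvg (UU := UP) ooU zC); exists l => i M.
apply: (@ell2_weak_lsc U UP (fun j => z i - z j) (z i - l)) => k.
exact: (vcvB (vcv_cst (z i k)) (zl k)).
Qed.

End Completeness.

(** * The bilinear pairing of l^2 *)

Section Pairing.
Context {R : realType}.
Implicit Types u v : ell2 R.

Lemma cauchy_schwarz_partial u v n :
  \sum_(0 <= k < n) nm (u k) * nm (v k) <= nm u * nm v.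
Proof.
have [u0|u0] := eqVneq (nm u) 0.
  rewrite big1 ?u0 ?mul0r// => k _; apply/eqP; rewrite mulf_eq0; apply/orP; left.
  by rewrite eq_le nm_ge0 andbT -u0 ell2_coord_le.
have [v0|v0] := eqVneq (nm v) 0.
  rewrite big1 ?v0 ?mulr0// => k _; apply/eqP; rewrite mulf_eq0; apply/orP; right.
  by rewrite eq_le nm_ge0 andbT -v0 ell2_coord_le.
have u1 : 0 < nm u by rewrite lt_neqAle eq_sym u0 nm_ge0.
have v1 : 0 < nm v by rewrite lt_neqAle eq_sym v0 nm_ge0.
(* The weight [t] balances the two sums: [t / 2 * nm u ^+ 2] and [(2 * t)^-1 * nm v ^+ 2] are each
   half of [nm u * nm v]. *)
pose t := nm v / nm u; have t0 : 0 < t by exact: divr_gt0.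
apply: (@le_trans _ _ (\sum_(0 <= k < n)
   (t / 2 * modulus (u k) ^+ 2 + (2 * t)^-1 * modulus (v k) ^+ 2))).
  apply: ler_sum => k _; rewrite -!nm_modulus.
  set a := nm (u k); set b := nm (v k).
  have : 0 <= (t * a - b) ^+ 2 / (2 * t) by rewrite divr_ge0 ?sqr_ge0// ltW// mulr_gt0.
  suff -> : (t * a - b) ^+ 2 / (2 * t) =
    t / 2 * a ^+ 2 + (2 * t)^-1 * b ^+ 2 - a * b by lra.
  by field; exact: lt0r_neq0.
rewrite big_split/= -!mulr_sumr.
have hu := l2_partial_le n (ell2P u); have hv := l2_partial_le n (ell2P v).
rewrite -!nm_l2 in hu hv.
apply: (@le_trans _ _ (t / 2 * nm u ^+ 2 + (2 * t)^-1 * nm v ^+ 2)).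
  apply: lerD; apply: ler_wpM2l => //; first by rewrite ltW// divr_gt0.
  by rewrite invr_ge0 ltW// mulr_gt0.
rewrite le_eqVlt; apply/orP; left; apply/eqP; rewrite /t; field.
by rewrite u0 v0.
Qed.

(** Absolute convergence: the sums of [nm (u k) * nm (v k)] increase and stay below [nm u * nm v],
    and their increments dominate those of the pairing. Hence [pair] is a genuine limit for all
    arguments. *)
Lemma pair_cauchy u v : cauchy_seq (series (fun k => u k * v k) : nat -> C R).
Proof.
pose s := series (fun k => nm (u k) * nm (v k)).
have s_nd : {homo s : m n / (m <= n)%N >-> m <= n}.
  by apply/nondecreasing_seqP => n; rewrite /s seriesSr lerDl mulr_ge0 ?nm_ge0.
have s_cv : cvgn s.
  apply: nondecreasing_is_cvgn => //; exists (nm u * nm v) => _ [n _ <-].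
  exact: cauchy_schwarz_partial.
move=> e e0; have e2 : 0 < e / 2 by lra.
have [N _ sN] := (cvgrPdist_le _ _).1 s_cv _ e2; exists N.
suff H i j : (N <= i)%N -> (i <= j)%N ->
    nm (series (fun k => u k * v k) j - series (fun k => u k * v k) i : C R) <= e.
  move=> i j Ni Nj; case/orP: (leq_total i j) => ij; last exact: H.
  by rewrite nm_distC; exact: H.
move=> Ni ij; rewrite sub_series_geq//.
apply: (le_trans (nm_sum _ _ _)).
under eq_bigr do rewrite nmM.
rewrite -sub_series_geq// -/s.
have := sN _ Ni; have := sN _ (leq_trans Ni ij); rewrite /= !ler_norml -/s; lra.
Qed.

Definition pair u v : C R :=
  xget 0 [set l | vcv \oo (series (fun k => u k * v k)) l].

Lemma pair_cv u v : vcv \oo (series (fun k => u k * v k)) (pair u v).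
Proof.
by rewrite /pair; case: xgetP => // h; have [l] := complete_complex (pair_cauchy u v) => /h.
Qed.

Lemma pairE u v l : vcv \oo (series (fun k => u k * v k)) l -> pair u v = l.
Proof. exact: vcv_unique (pair_cv u v). Qed.

Lemma pair_le u v : nm (pair u v) <= nm u * nm v.
Proof.
apply: (vcv_le (pair_cv u v)); apply: filterE => n.
apply: (le_trans (nm_sum _ _ _)); under eq_bigr do rewrite nmM.
exact: cauchy_schwarz_partial.
Qed.

Lemma pairC u v : pair u v = pair v u.
Proof.
apply: pairE; have := pair_cv v u.
by rewrite (_ : (fun k => v k * u k) = (fun k => u k * v k))//; apply/funext => k; rewrite mulrC.
Qed.

Lemma pairDl u u' v : pair (u + u') v = pair u v + pair u' v.
Proof.
apply: pairE; rewrite (_ : series _ = fun n => series (fun k => u k * v k) n +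
  series (fun k => u' k * v k) n); first exact: vcvD (pair_cv _ _) (pair_cv _ _).
by apply/funext => n; rewrite /series/= -big_split; apply: eq_bigr => k _; exact: mulrDl.
Qed.

Lemma pairZl a u v : pair (a *: u) v = a *: pair u v.
Proof.
apply: pairE; rewrite (_ : series _ = fun n => a *: series (fun k => u k * v k) n).
  exact: vcvZ (pair_cv _ _).
apply/funext => n; rewrite /series/= scaler_sumr; apply: eq_bigr => k _.
exact: (esym (mulrA _ _ _)).
Qed.

Lemma pairDr u v v' : pair u (v + v') = pair u v + pair u v'.
Proof. by rewrite pairC pairDl pairC (pairC v'). Qed.

Lemma pairZr a u v : pair u (a *: v) = a *: pair u v.
Proof. by rewrite pairC pairZl pairC. Qed.

Lemma pairNl u v : pair (- u) v = - pair u v.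
Proof. by rewrite -scaleN1r pairZl scaleN1r. Qed.

Lemma pairNr u v : pair u (- v) = - pair u v.
Proof. by rewrite pairC pairNl pairC. Qed.

Lemma pairBl u u' v : pair (u - u') v = pair u v - pair u' v.
Proof. by rewrite pairDl pairNl. Qed.

Lemma pairBr u v v' : pair u (v - v') = pair u v - pair u v'.
Proof. by rewrite pairDr pairNr. Qed.

Lemma pair0l v : pair 0 v = 0.
Proof. by rewrite -(scale0r (0 : ell2 R)) pairZl scale0r. Qed.

(** Truncating the pairing at [N] amounts to pairing with the tail [t] of [v], whose size does not
    depend on [u]. This is what carries coordinatewise convergence of a bounded family through the
    pairing. *)
Lemma ell2_tail_small v (e : R) : 0 < e -> exists N0, forall N, (N0 <= N)%N ->
  exists2 t : ell2 R, nm t <= e &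
    forall u, series (fun k => u k * v k) N = pair u v - pair u t.
Proof.
move=> e0; have e2 : 0 < e ^+ 2 by rewrite exprn_gt0.
have [N0 _ vN] := (cvgrPdist_le _ _).1 (ell2P v) _ e2.
exists N0 => N /vN/=; rewrite ler_norml => /andP[_ hN].
pose w k : C R := if (k < N)%N then 0 else v k.
have wle n : series (fun k => modulus (w k) ^+ 2) n <= e ^+ 2.
  case: (leqP n N) => nN.
    rewrite /series/= big_nat big1 ?ltW// => i /andP[_ iN].
    by rewrite /w (leq_trans iN nN) -nm_modulus nm0 expr0n.
  apply: le_trans hN; have := nondecreasing_cvgn_le (l2_nd v) (ell2P v) n.
  suff -> : series (fun k => modulus (w k) ^+ 2) n =
    series (fun k => modulus (v k) ^+ 2) n - series (fun k => modulus (v k) ^+ 2) N by lra.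
  rewrite sub_series_geq ?(ltnW nN)// /series/= (big_cat_nat _ (ltnW nN))//=.
  rewrite big_nat big1 ?add0r; last first.
    by move=> i /andP[_ iN]; rewrite /w iN -nm_modulus nm0 expr0n.
  by apply: eq_big_nat => i /andP[Ni _]; rewrite /w ltnNge Ni.
have [sw we] := l2_bound (ltW e0) wle.
have w2 : w \in ell2_pred by rewrite inE.
exists (Ell2 w2) => // u; rewrite -pairNr -pairDr; apply/esym/pairE/vcv_ooP => d d0.
exists N => m Nm; rewrite [X in X - _](_ : _ = series (fun k => u k * v k) N).
  by rewrite subrr nm0 ltW.
rewrite /series/= (big_cat_nat _ Nm)//= [X in _ + X]big_nat [X in _ + X]big1 ?addr0.
  apply: eq_big_nat => i /andP[_ iN].
  by rewrite [X in _ * X](_ : _ = v i - w i)// /w iN subr0.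
move=> i /andP[Ni _]; rewrite [X in _ * X](_ : _ = v i - w i)// /w ltnNge Ni subrr.
by rewrite mulr0.
Qed.

Lemma bezout_solutionP (f g : C R -> ell2 R) :
  bezout_solution f g <-> forall z, unit_disk z -> pair (g z) (f z) = 1.
Proof.
split=> fg z /fg; first by move=> /vcvP/pairE.
by move=> <-; apply/vcvP; exact: pair_cv.
Qed.

End Pairing.

Section HalvingLimits.
Context {R : realType}.

Lemma half_expn_small (c e : R) : 0 < e -> exists n, c / 2 ^+ n <= e.
Proof.
move=> e0; pose x := `|c| / e.
have x0 : 0 <= x by rewrite divr_ge0// ltW.
exists (Num.bound x); rewrite ler_pdivrMr ?exprn_gt0//.
have h1 : x <= 2 ^+ Num.bound x.
  apply: (le_trans (ltW (archi_boundP x0))).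
  by rewrite -natrX ler_nat ltnW// ltn_expl.
have -> : c = c / e * e by rewrite divfK ?lt0r_neq0.
rewrite [leRHS]mulrC ler_pM2r//; apply: le_trans h1.
by rewrite /x ler_pM2r ?invr_gt0// ler_norm.
Qed.

(** The steps after [n] add up to at most [c / 2 ^+ n]. The explicit rate matters: in the bisections
    it compares the distance to the limit with the size of the current square or segment. *)
Lemma halving_cvg (V : normedModType (C R)) (z : nat -> V) (c : R) :
  complete_space V -> (forall n, nm (z n.+1 - z n) <= c / 2 ^+ n.+1) ->
  exists l, forall n, nm (z n - l) <= c / 2 ^+ n.
Proof.
move=> VC zc; have c0 : 0 <= c.
  have := le_trans (nm_ge0 _) (zc 0%N); rewrite expr1.
  by rewrite pmulr_lge0 ?invr_gt0.
have zd n j : nm (z (n + j)%N - z n) <= c / 2 ^+ n - c / 2 ^+ (n + j).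
  elim: j => [|j ih]; first by rewrite addn0 subrr nm0 subrr.
  have := nm_tri (z (n + j.+1)%N) (z (n + j)%N) (z n).
  have := zc (n + j)%N; rewrite addnS.
  have -> : c / 2 ^+ (n + j).+1 = c / 2 ^+ (n + j) / 2.
    by rewrite exprS; field; rewrite expf_neq0.
  by move: ih; lra.
have zb n j : (n <= j)%N -> nm (z j - z n) <= c / 2 ^+ n.
  move=> nj; have := zd n (j - n)%N; rewrite subnKC// => h.
  apply: (le_trans h); rewrite gerBl.
  by rewrite divr_ge0// exprn_ge0.
have [|l zl] := VC z.
  move=> e e0; have e2 : 0 < e / 2 by lra.
  have [N cN] := half_expn_small c e2; exists N => i j Ni Nj.
  have := nm_tri (z i) (z N) (z j); have := zb _ _ Ni; have := zb _ _ Nj.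
  by rewrite (nm_distC (z N)); lra.
exists l => n; apply/ler_addgt0Pl => e e0.
have [N zN] := (vcv_ooP _ _).1 zl _ e0.
have := zN _ (leq_maxl N n); have := zb _ _ (leq_maxr N n).
have := nm_tri (z n) (z (maxn N n)) l; rewrite (nm_distC (z n) (z (maxn _ _))); lra.
Qed.

End HalvingLimits.

(** * Cauchy estimates by discrete contour sums *)

Section DiscreteContours.
Context {R : realType}.
Local Notation C := (C R).
Local Notation i := ('i%C : C).
Implicit Types (V : normedModType C) (x y z m p : C).

Lemma nm_i : nm i = 1 :> R.
Proof. by rewrite nm_modulus /modulus/= expr0n/= add0r expr1n sqrtr1. Qed.

(* The composite midpoint rule with [2 ^ k] nodes on the segment from [x] to
   [y]. *)
Fixpoint seg V (F : C -> V) (k : nat) x y : V :=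
  match k with
  | 0 => (y - x) *: F ((x + y) / 2)
  | k'.+1 => seg F k' x ((x + y) / 2) + seg F k' ((x + y) / 2) y
  end.

(** The square has centre [m] and half-diagonal [p]. With these parameters its four quarters are
    squares of half-diagonal [p / 2], and multiplication by [i] permutes the edges. *)
Definition loop V (F : C -> V) k m p : V :=
  seg F k (m + p) (m + i * p) + seg F k (m + i * p) (m - p) +
  (seg F k (m - p) (m - i * p) + seg F k (m - i * p) (m + p)).

Lemma seg_anti V (F : C -> V) k x y : seg F k y x = - seg F k x y.
Proof.
elim: k x y => [|k ih] x y /=; first by rewrite (addrC y x) -scaleNr opprB.
by rewrite (addrC y x) (ih x) (ih _ y) opprD [LHS]addrC.
Qed.

(** Closure under midpoints is the right amount of convexity, since nodes and endpoints of [seg]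
    arise from repeated halving. *)
Definition midconvex (A : C -> Prop) := forall x y, A x -> A y -> A ((x + y) / 2).

Lemma midconvex_ball c (r : R) : midconvex (fun z => nm (z - c) <= r).
Proof.
move=> x y xr yr; have -> : (x + y) / 2 - c = 2^-1 * ((x - c) + (y - c)) by field.
rewrite nmM nmV nm_nat; have := nmD (x - c) (y - c); lra.
Qed.

Lemma seg_bound V (F : C -> V) (A : C -> Prop) (B : R) k x y : midconvex A ->
  (forall z, A z -> nm (F z) <= B) -> A x -> A y ->
  nm (seg F k x y) <= nm (y - x) * B.
Proof.
move=> Ac FB; elim: k x y => [|k ih] x y Ax Ay /=.
  by rewrite nmZ ler_wpM2l ?nm_ge0// FB//; exact: Ac.
have Am := Ac _ _ Ax Ay; apply: (le_trans (nmD _ _)).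
have := ih _ _ Ax Am; have := ih _ _ Am Ay.
have -> : y - (x + y) / 2 = 2^-1 * (y - x) by field.
have -> : (x + y) / 2 - x = 2^-1 * (y - x) by field.
rewrite nmM nmV nm_nat; lra.
Qed.

Lemma segD V (F G : C -> V) k x y :
  seg (fun z => F z + G z) k x y = seg F k x y + seg G k x y.
Proof.
elim: k x y => [|k ih] x y /=; first by rewrite scalerDr.
by rewrite !ih addrACA.
Qed.

Lemma segN V (F : C -> V) k x y : seg (fun z => - F z) k x y = - seg F k x y.
Proof.
elim: k x y => [|k ih] x y /=; first by rewrite scalerN.
by rewrite !ih opprD.
Qed.

Lemma seg_scale V (F : C -> C) (v : V) k x y :
  seg (fun z => F z *: v) k x y = (seg F k x y : C) *: v.
Proof.
elim: k x y => [|k ih] x y /=; first by rewrite scalerA.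
by rewrite !ih scalerDl.
Qed.

(** The midpoint rule is exact on affine functions at every level [k], so the linear part of [F] in
    Goursat's argument drops out without a limit. *)
Lemma seg_affine V (c d : V) k x y : seg (fun z => c + z *: d) k x y =
  (y - x) *: c + ((y ^+ 2 - x ^+ 2) / 2) *: d.
Proof.
elim: k x y => [|k ih] x y /=; first by module_ (Defs.C R) V.
by rewrite !ih; module_ (Defs.C R) V.
Qed.

Lemma loopD V (F G : C -> V) k m p :
  loop (fun z => F z + G z) k m p = loop F k m p + loop G k m p.
Proof. by rewrite /loop !segD; module_ (Defs.C R) V. Qed.

Lemma loopN V (F : C -> V) k m p : loop (fun z => - F z) k m p = - loop F k m p.
Proof. by rewrite /loop !segN; module_ (Defs.C R) V. Qed.

Lemma loop_scale V (F : C -> C) (v : V) k m p :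
  loop (fun z => F z *: v) k m p = (loop F k m p : C) *: v.
Proof. by rewrite /loop !seg_scale !scalerDl. Qed.

Lemma loop_affine V (c d : V) k m p : loop (fun z => c + z *: d) k m p = 0.
Proof. by rewrite /loop !seg_affine; module_ (Defs.C R) V. Qed.

(** Halving each outer edge turns level [k.+1] into level [k] on the halves. The inner edges are run
    through in both directions and cancel by [seg_anti], exactly and not only in the limit. *)
Lemma loop_split V (F : C -> V) k m p : loop F k.+1 m p =
  loop F k (m + p / 2) (p / 2) + loop F k (m + i * p / 2) (p / 2) +
  (loop F k (m - p / 2) (p / 2) + loop F k (m - i * p / 2) (p / 2)).
Proof.
rewrite /loop /=.
pose e0 := m + p / 2 + i * p / 2.
pose e1 := m - p / 2 + i * p / 2.
pose e2 := m - p / 2 - i * p / 2.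
pose e3 := m + p / 2 - i * p / 2.
pose c0 := m + p.
pose c1 := m + i * p.
pose c2 := m - p.
pose c3 := m - i * p.
have -> : (m + p + (m + i * p)) / 2 = e0 by rewrite /e0; field.
have -> : (m + i * p + (m - p)) / 2 = e1 by rewrite /e1; field.
have -> : (m - p + (m - i * p)) / 2 = e2 by rewrite /e2; field.
have -> : (m - i * p + (m + p)) / 2 = e3 by rewrite /e3; field.
have -> : m + p / 2 + p / 2 = c0 by rewrite /c0; field.
have -> : m + p / 2 + i * (p / 2) = e0 by rewrite /e0; field.
have -> : m + p / 2 - p / 2 = m by field.
have -> : m + p / 2 - i * (p / 2) = e3 by rewrite /e3; field.
have -> : m + i * p / 2 + p / 2 = e0 by rewrite /e0; field.
have -> : m + i * p / 2 + i * (p / 2) = c1 by rewrite /c1; field.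
have -> : m + i * p / 2 - p / 2 = e1 by rewrite /e1; field.
have -> : m + i * p / 2 - i * (p / 2) = m by field.
have -> : m - p / 2 + p / 2 = m by field.
have -> : m - p / 2 + i * (p / 2) = e1 by rewrite /e1; field.
have -> : m - p / 2 - p / 2 = c2 by rewrite /c2; field.
have -> : m - p / 2 - i * (p / 2) = e2 by rewrite /e2; field.
have -> : m - i * p / 2 + p / 2 = e3 by rewrite /e3; field.
have -> : m - i * p / 2 + i * (p / 2) = m by field.
have -> : m - i * p / 2 - p / 2 = e2 by rewrite /e2; field.
have -> : m - i * p / 2 - i * (p / 2) = c3 by rewrite /c3; field.
rewrite -/c0 -/c1 -/c2 -/c3.
rewrite (seg_anti F k m e0) (seg_anti F k m e1) (seg_anti F k m e2) (seg_anti F k m e3).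
by module_ (Defs.C R) V.
Qed.

(** The constant 8 comes from four edges, each of length at most [2 * nm p]; the true length is the
    square root of 2 times [nm p]. *)
Lemma loop_bound V (F : C -> V) (B : R) k m p :
  (forall z, nm (z - m) <= nm p -> nm (F z) <= B) ->
  nm (loop F k m p) <= 8 * nm p * B.
Proof.
move=> FB; have Ac := @midconvex_ball m (nm p).
have ip : nm (i * p) = nm p by rewrite nmM nm_i mul1r.
have B0 : 0 <= B by rewrite (le_trans (nm_ge0 _) (FB m _))// subrr nm0 nm_ge0.
have A1 : nm (m + p - m) <= nm p by rewrite addrC addKr.
have A2 : nm (m + i * p - m) <= nm p by rewrite addrC addKr ip.
have A3 : nm (m - p - m) <= nm p by rewrite addrC addKr nmN.
have A4 : nm (m - i * p - m) <= nm p by rewrite addrC addKr nmN ip.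
have K x y : nm (x - m) <= nm p -> nm (y - m) <= nm p ->
    nm (seg F k x y) <= 2 * nm p * B.
  move=> Ax Ay; apply: (le_trans (seg_bound k Ac FB Ax Ay)).
  rewrite ler_wpM2r//; have := nm_tri y m x; rewrite (nm_distC m); lra.
rewrite /loop; apply: (le_trans (nmD _ _)).
have := nmD (seg F k (m + p) (m + i * p)) (seg F k (m + i * p) (m - p)).
have := nmD (seg F k (m - p) (m - i * p)) (seg F k (m - i * p) (m + p)).
have := K _ _ A1 A2; have := K _ _ A2 A3; have := K _ _ A3 A4; have := K _ _ A4 A1.
lra.
Qed.

(** Vanishing for fine meshes plays the role of a zero contour integral, without a limit having to
    be defined. *)
Definition loop_null V (F : C -> V) m p := forall e : R, 0 < e ->
  \forall k \near \oo, nm (loop F k m p) <= e.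

(* Goursat's lemma: if the loop around a square does not tend to 0, then the
   bound [e |p|^2] is violated infinitely often on one of the four subsquares,
   hence on a nested sequence of squares, which contradicts differentiability
   at its limit point. *)
Lemma goursat V (F : C -> V) m p :
  (forall z, nm (z - m) <= nm p -> exists d, cd F z d) -> loop_null F m p.
Proof.
move=> Fd; have [->|p0] := eqVneq p 0.
  move=> e e0; apply: nearW => k; suff -> : loop F k m 0 = 0 by rewrite nm0 ltW.
  have s0 x : seg F k x x = 0.
    elim: k => [|k ih] /=; first by rewrite subrr scale0r.
    by rewrite (_ : (x + x) / 2 = x) ?ih ?addr0//; field.
  by rewrite /loop !(mulr0, subr0, addr0, s0).
apply: contrapT => /existsNP[e0 /not_implyP[e00 H]].
have pp := nm_gt0 p0; pose e := e0 / nm p ^+ 2.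
have e1 : 0 < e by rewrite divr_gt0// exprn_gt0.
pose bad m p := forall K, exists k, (K <= k)%N /\ e * nm p ^+ 2 < nm (loop F k m p).
have bad0 : bad m p.
  move=> K; apply: contrapT => h; apply: H; exists K => // k Kk.
  rewrite leNgt; apply/negP => lk; apply: h; exists k => //.
  by rewrite /e divfK// expf_neq0// lt0r_neq0.
have nmp2 q : nm (q / 2 : C) = nm q / 2 by rewrite nmM nmV nm_nat.
have child m1 q : exists m2, bad m1 q -> nm (m2 - m1) <= nm q / 2 /\ bad m2 (q / 2).
  apply: contrapT => /forallNP h.
  have good m2 : nm (m2 - m1) <= nm q / 2 -> exists K, forall k, (K <= k)%N ->
      nm (loop F k m2 (q / 2)) <= e * nm q ^+ 2 / 4.
    move=> mq; have /not_implyP[_ /not_andP[//|/existsNP[K /forallNP hK]]] := h m2.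
    exists K => k Kk; have /not_andP[//|/negP] := hK k.
    by rewrite -leNgt nmp2 expr_div_n => hk; rewrite -mulrA; move: hk; lra.
  have /not_implyP[bmq _] := h m1.
  have iq : nm (i * q / 2) = nm q / 2 by rewrite nmp2 nmM nm_i mul1r.
  have [|K1 h1] := good (m1 + q / 2); first by rewrite addrC addKr nmp2.
  have [|K2 h2] := good (m1 + i * q / 2); first by rewrite addrC addKr iq.
  have [|K3 h3] := good (m1 - q / 2); first by rewrite addrC addKr nmN nmp2.
  have [|K4 h4] := good (m1 - i * q / 2); first by rewrite addrC addKr nmN iq.
  (* The successor excludes level 0, so that [loop_split] applies and leaves a level [k] still
     beyond the four thresholds. *)
  have [[|k] []//] := bmq (maxn (maxn K1 K2) (maxn K3 K4)).+1.
  rewrite ltnS !geq_max => /andP[/andP[/h1{}h1 /h2{}h2] /andP[/h3{}h3 /h4{}h4]].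
  rewrite ltNge => /negP; apply; rewrite loop_split.
  apply: (le_trans (nmD _ _)).
  have := nmD (loop F k (m1 + q / 2) (q / 2)) (loop F k (m1 + i * q / 2) (q / 2)).
  have := nmD (loop F k (m1 - q / 2) (q / 2)) (loop F k (m1 - i * q / 2) (q / 2)).
  by move: h1 h2 h3 h4; lra.
have /choice[ch chP] : forall a : C * C, exists m2, bad a.1 a.2 ->
  nm (m2 - a.1) <= nm a.2 / 2 /\ bad m2 (a.2 / 2) by move=> [a1 a2]; exact: child.
pose ms := fix ms n : C := if n is n'.+1 then ch (ms n', p / 2 ^+ n') else m.
have pn n : nm (p / 2 ^+ n) = nm p / 2 ^+ n by rewrite nmM nmV nmX nm_nat.
have pS n : p / 2 ^+ n / 2 = p / 2 ^+ n.+1.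
  by rewrite exprS; field; rewrite expf_neq0.
have badn n : bad (ms n) (p / 2 ^+ n).
  elim: n => [|n ih]; first by rewrite /= expr0 divr1.
  by have [_] := chP (ms n, p / 2 ^+ n) ih; rewrite /= pS.
have [l ml] : exists l, forall n, nm (ms n - l) <= nm p / 2 ^+ n.
  apply: halving_cvg; first exact: complete_complex.
  move=> n; have [h _] := chP (ms n, p / 2 ^+ n) (badn n).
  by apply: (le_trans h); rewrite /= -nmp2 pS pn.
have [|d Fl] := Fd l.
  by have := ml 0%N; rewrite /= expr0 divr1 nm_distC.
(* [loop_bound] costs a factor 8 and the distance to [l], at most [2 * nm q], a factor 2; with 32
   the loop is at most half of [e * nm q ^+ 2]. *)
have e32 : 0 < e / 32 by rewrite divr_gt0.
have [r r0 Fr] := Fl _ e32.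
have r4 : 0 < r / 4 by lra.
have [n pnr] := half_expn_small (nm p) r4.
have [k [_]] := badn n 0%N; rewrite ltNge => /negP; apply.
set q := p / 2 ^+ n.
have qE : nm q = nm p / 2 ^+ n by exact: pn.
pose G z := F z - F l - (z - l) *: d.
have -> : F = fun z => G z + ((F l - l *: d) + z *: d).
  by apply/funext => z; rewrite /G; module_ (Defs.C R) V.
rewrite loopD loop_affine addr0.
apply: (@le_trans _ _ (8 * nm q * (e / 32 * (2 * nm q)))); last first.
  have : 0 <= e * (nm q * nm q) by apply: mulr_ge0; rewrite ?(ltW e1)// mulr_ge0 ?nm_ge0.
  by rewrite expr2; lra.
apply: loop_bound => z zq.
have zl : nm (z - l) <= 2 * nm q.
  have := nm_tri z (ms n) l; have := ml n; rewrite -qE; lra.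
have /Fr : nm (z - l) < r by rewrite (le_lt_trans zl)// qE; lra.
rewrite (addrC l) subrK => h; apply: (le_trans h).
by rewrite ler_wpM2l// ltW.
Qed.

(* The twelve small squares of the annulus avoid the centre [w]. *)
Lemma loop_null_half V (F : C -> V) w p :
  (forall z, 0 < nm (z - w) -> nm (z - w) <= 2 * nm p -> exists d, cd F z d) ->
  forall e : R, 0 < e -> \forall k \near \oo,
   nm (loop F k.+2 w p - loop F k.+1 w (p / 2)) <= e.
Proof.
move=> Fd e e0; have [->|p0] := eqVneq p 0.
  apply: nearW => k; have Z j : loop F j w 0 = 0.
    have s0 x : seg F j x x = 0.
      elim: j => [|j ih] /=; first by rewrite subrr scale0r.
      by rewrite (_ : (x + x) / 2 = x) ?ih ?addr0//; field.
    by rewrite /loop !(mulr0, subr0, addr0, s0).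
  by rewrite mul0r !Z subr0 nm0 ltW.
have pp := nm_gt0 p0; have e12 : 0 < e / 12 by lra.
have p4 : nm (p / 2 / 2) = nm p / 4.
  by rewrite !nmM !nmV !nm_nat; field.
(* In units of a quarter of [p] the small square has centre [b] relative to [w] and radius 1, so its
   points lie between 1 and 4 units away from [w]: off the singularity, and inside the domain. *)
have good (c b : C) : c = w + b * (p / 2 / 2) -> 2 <= nm b <= 3 ->
    \forall k \near \oo, nm (loop F k c (p / 2 / 2)) <= e / 12.
  move=> cE /andP[b2 b3].
  have cw : nm (c - w) = nm b * (nm p / 4) by rewrite cE addrC addKr nmM p4.
  have h2 : 2 * (nm p / 4) <= nm b * (nm p / 4) by rewrite ler_pM2r//; lra.
  have h3 : nm b * (nm p / 4) <= 3 * (nm p / 4) by rewrite ler_pM2r//; lra.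
  apply: goursat => // z; rewrite p4 => zc; apply: Fd.
    by have := nm_tri c z w; rewrite cw (nm_distC c z); lra.
  by have := nm_tri z c w; rewrite cw; lra.
have n21 (s : C) : nm s = 1 -> complex.Re s = 0 -> 2 <= nm (2 + s : C) <= 3.
  move=> s1 s0; apply/andP; split; last first.
    by have := nmD (2 : C) s; rewrite nm_nat s1; lra.
  have := le_nm_Re (2 + s : C); rewrite (_ : complex.Re _ = 2).
    by rewrite ger0_norm.
  have -> : (2 : C) = (2 : R)%:C%C by rewrite (rmorph_nat (real_complex R) 2).
  by case: s s0 {s1} => a b /= ->; rewrite addr0.
have ii : i * i = -1 :> C by rewrite -expr2 sqr_i.
have ri (b : C) : nm (i * b) = nm b by rewrite nmM nm_i mul1r.
have t1 : 2 <= nm (3 : C) <= 3 by rewrite nm_nat; apply/andP; split; lra.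
have t2 : 2 <= nm (2 + i : C) <= 3 by apply: n21 => //; exact: nm_i.
have t3 : 2 <= nm (2 - i : C) <= 3.
  by apply: n21 => /=; rewrite ?oppr0// nmN nm_i.
have t4 : 2 <= nm (3 * i : C) <= 3 by rewrite mulrC ri.
have t5 : 2 <= nm (2 * i + 1 : C) <= 3.
  by rewrite (_ : 2 * i + 1 = i * (2 - i)) ?ri// mulrBr ii; ring.
have t6 : 2 <= nm (2 * i - 1 : C) <= 3.
  by rewrite (_ : 2 * i - 1 = i * (2 + i)) ?ri// mulrDr ii; ring.
have tN (b : C) : 2 <= nm b <= 3 -> 2 <= nm (- b) <= 3 by rewrite nmN.
have h1 := good (w + p / 2 + p / 2 / 2) 3 ltac:(by field) t1.
have h2 := good (w + p / 2 + i * (p / 2) / 2) (2 + i) ltac:(by field) t2.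
have h3 := good (w + p / 2 - i * (p / 2) / 2) (2 - i) ltac:(by field) t3.
have h4 := good (w + i * p / 2 + i * (p / 2) / 2) (3 * i) ltac:(by field) t4.
have h5 := good (w + i * p / 2 + p / 2 / 2) (2 * i + 1) ltac:(by field) t5.
have h6 := good (w + i * p / 2 - p / 2 / 2) (2 * i - 1) ltac:(by field) t6.
have h7 := good (w - p / 2 - p / 2 / 2) (- 3) ltac:(by field) (tN _ t1).
have h8 := good (w - p / 2 - i * (p / 2) / 2) (- (2 + i)) ltac:(by field) (tN _ t2).
have h9 := good (w - p / 2 + i * (p / 2) / 2) (- (2 - i)) ltac:(by field) (tN _ t3).
have h10 := good (w - i * p / 2 - i * (p / 2) / 2) (- (3 * i)) ltac:(by field) (tN _ t4).
have h11 := good (w - i * p / 2 - p / 2 / 2) (- (2 * i + 1)) ltac:(by field) (tN _ t5).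
have h12 := good (w - i * p / 2 + p / 2 / 2) (- (2 * i - 1)) ltac:(by field) (tN _ t6).
apply: filterS (filterI h1 (filterI h2 (filterI h3 (filterI h4 (filterI h5 (filterI h6 (filterI h7 (filterI h8 (filterI h9 (filterI h10 (filterI h11 h12))))))))))) => k.
case=> g1 [g2 [g3 [g4 [g5 [g6 [g7 [g8 [g9 [g10 [g11 g12]]]]]]]]]].
rewrite !loop_split.
have -> : w + p / 2 - p / 2 / 2 = w + p / 2 / 2 by field.
have -> : w + i * p / 2 - i * (p / 2) / 2 = w + i * (p / 2) / 2 by field.
have -> : w - p / 2 + p / 2 / 2 = w - p / 2 / 2 by field.
have -> : w - i * p / 2 + i * (p / 2) / 2 = w - i * (p / 2) / 2 by field.
move: (p / 2 / 2) g1 g2 g3 g4 g5 g6 g7 g8 g9 g10 g11 g12 => q.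
set L := loop F k => g1 g2 g3 g4 g5 g6 g7 g8 g9 g10 g11 g12.
have -> : L (w + p / 2 + q) q + L (w + p / 2 + i * (p / 2) / 2) q +
    (L (w + q) q + L (w + p / 2 - i * (p / 2) / 2) q) +
  (L (w + i * p / 2 + q) q + L (w + i * p / 2 + i * (p / 2) / 2) q +
    (L (w + i * p / 2 - q) q + L (w + i * (p / 2) / 2) q)) +
  (L (w - q) q + L (w - p / 2 + i * (p / 2) / 2) q +
    (L (w - p / 2 - q) q + L (w - p / 2 - i * (p / 2) / 2) q) +
  (L (w - i * p / 2 + q) q + L (w - i * (p / 2) / 2) q +
    (L (w - i * p / 2 - q) q + L (w - i * p / 2 - i * (p / 2) / 2) q))) -
  (L (w + q) q + L (w + i * (p / 2) / 2) q + (L (w - q) q + L (w - i * (p / 2) / 2) q)) =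
  \sum_(x <- [:: L (w + p / 2 + q) q; L (w + p / 2 + i * (p / 2) / 2) q;
    L (w + p / 2 - i * (p / 2) / 2) q; L (w + i * p / 2 + q) q;
    L (w + i * p / 2 + i * (p / 2) / 2) q; L (w + i * p / 2 - q) q;
    L (w - p / 2 + i * (p / 2) / 2) q; L (w - p / 2 - q) q;
    L (w - p / 2 - i * (p / 2) / 2) q; L (w - i * p / 2 + q) q;
    L (w - i * p / 2 - q) q; L (w - i * p / 2 - i * (p / 2) / 2) q]) x.
  by rewrite !big_cons big_nil; module_ (Defs.C R) V.
apply: (le_trans (nm_sum _ _ _)); rewrite !big_cons big_nil.
lra.
Qed.

End DiscreteContours.

Section CauchyEstimate.
Context {R : realType}.
Local Notation C := (C R).
Local Notation i := ('i%C : C).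
Implicit Types (V : normedModType C) (x y z w p q : C).

Lemma Re_nat_div (n : nat) (z : C) : complex.Re (z / n%:R) = complex.Re z / n%:R.
Proof.
have -> : (n%:R : C)^-1 = (n%:R^-1 : R)%:C%C.
  by rewrite fmorphV/= rmorph_nat.
by case: z => a b /=; rewrite mulr0 subr0.
Qed.

Lemma Im_nat_div (n : nat) (z : C) : complex.Im (z / n%:R) = complex.Im z / n%:R.
Proof.
have -> : (n%:R : C)^-1 = (n%:R^-1 : R)%:C%C.
  by rewrite fmorphV/= rmorph_nat.
by case: z => a b /=; rewrite mulr0 add0r.
Qed.

Lemma ReD (z w : C) : complex.Re (z + w) = complex.Re z + complex.Re w.
Proof. by case: z; case: w. Qed.

Lemma ImD (z w : C) : complex.Im (z + w) = complex.Im z + complex.Im w.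
Proof. by case: z; case: w. Qed.

(* The edge from [q] to [i q] of the square with centre 0. *)
Definition edge q z :=
  1 <= complex.Re (z / q) + complex.Im (z / q) /\ nm z <= nm q.

Lemma midconvex_edge q : midconvex (edge q).
Proof.
move=> x y [x1 xq] [y1 yq]; split.
  have -> : (x + y) / 2 / q = (x / q + y / q) / 2.
    by rewrite -mulrDl mulrAC.
  by rewrite Re_nat_div Im_nat_div ReD ImD; lra.
rewrite nmM nmV nm_nat; have := nmD x y; lra.
Qed.

Lemma edge_start q : q != 0 -> edge q q.
Proof. by move=> q0; split; rewrite ?mulfV//= addr0. Qed.

Lemma edge_end q : q != 0 -> edge q (i * q).
Proof. by move=> q0; split; rewrite ?mulfK//= ?add0r// nmM nm_i mul1r. Qed.

Lemma edge_nm q z : q != 0 -> edge q z -> nm q / 2 <= nm z.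
Proof.
move=> q0 [h _]; have qq := nm_gt0 q0.
have h1 := le_nm_Re (z / q); have h2 := le_nm_Im (z / q).
have h3 : 2^-1 <= nm (z / q).
  move: h1 h2; rewrite !ler_norml => /andP[_ h1] /andP[_ h2]; lra.
by move: h3; rewrite nmM nmV ler_pdivlMr// mulrC.
Qed.

(** Around 0 every edge runs from some [q] to [i * q], so estimates on one edge serve for all
    four. *)
Lemma loop0_edges V (F : C -> V) k p : loop F k 0 p =
  seg F k p (i * p) + seg F k (i * p) (i * (i * p)) +
  (seg F k (i * (i * p)) (i * (i * (i * p))) +
   seg F k (i * (i * (i * p))) (i * (i * (i * (i * p))))).
Proof.
have ii x : i * (i * x) = - x by rewrite mulrA -expr2 sqr_i mulN1r.
by rewrite /loop !add0r !(ii, mulrN, opprK).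
Qed.

Lemma i_neq0 : i != 0.
Proof. by apply/eqP => i0; have := nm_i (R := R); rewrite i0 nm0; lra. Qed.

(** In contrast with [loop_bound], the bound on [F] is asked only on an annulus containing the
    edges, so [F] may be singular at the centre. *)
Lemma loop0_bound V (F : C -> V) (B : R) k p : p != 0 ->
  (forall z, nm p / 2 <= nm z -> nm z <= nm p -> nm (F z) <= B) ->
  nm (loop F k 0 p) <= 8 * nm p * B.
Proof.
move=> p0 FB.
have K q : q != 0 -> nm q = nm p -> nm (seg F k q (i * q)) <= 2 * nm p * B.
  move=> q0 qp; have B0 : 0 <= B.
    by rewrite (le_trans (nm_ge0 _) (FB p _ _))//; have := nm_ge0 p; lra.
  have qB z : edge q z -> nm (F z) <= B.
    by move=> zq; apply: FB; rewrite -?qp; [exact: edge_nm|case: zq].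
  apply: (le_trans (seg_bound k (@midconvex_edge q) qB (edge_start q0) (edge_end q0))).
  rewrite ler_wpM2r//; have := nmB (i * q) q; rewrite nmM nm_i qp; lra.
have iN q : nm (i * q) = nm q by rewrite nmM nm_i mul1r.
have h1 := K p p0 erefl.
have h2 := K (i * p) (mulf_neq0 i_neq0 p0) (iN p).
have h3 := K (i * (i * p)) (mulf_neq0 i_neq0 (mulf_neq0 i_neq0 p0)).
have h4 := K (i * (i * (i * p))) (mulf_neq0 i_neq0 (mulf_neq0 i_neq0 (mulf_neq0 i_neq0 p0))).
rewrite !iN in h3 h4; move: (h3 erefl) (h4 erefl) => {}h3 {}h4.
rewrite loop0_edges; apply: (le_trans (nmD _ _)).
have := nmD (seg F k p (i * p)) (seg F k (i * p) (i * (i * p))).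
have := nmD (seg F k (i * (i * p)) (i * (i * (i * p))))
  (seg F k (i * (i * (i * p))) (i * (i * (i * (i * p))))).
by move: h1 h2 h3 h4; lra.
Qed.

Lemma seg_Im_ge (F : C -> C) (A : C -> Prop) (v : C) (c : R) k x y (t : R) :
  midconvex A -> (forall z, A z -> c <= complex.Im (v * F z)) ->
  0 <= t -> y - x = t%:C%C * v -> A x -> A y ->
  c * t <= complex.Im (seg F k x y : C).
Proof.
move=> Ac Fc; elim: k x y t => [|k ih] x y t t0 xy Ax Ay /=.
  rewrite /GRing.scale/= xy -mulrA.
  rewrite (_ : complex.Im _ = t * complex.Im (v * F ((x + y) / 2))).
    by rewrite mulrC ler_wpM2l// Fc//; exact: Ac.
  by case: (v * _) => a b /=; rewrite mul0r addr0.
have Am := Ac _ _ Ax Ay; rewrite ImD.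
have t2 : 0 <= t / 2 by rewrite divr_ge0.
have th : (t / 2)%:C%C = t%:C%C / 2 :> C by rewrite rmorphM/= fmorphV/= rmorph_nat.
have e1 : (x + y) / 2 - x = (t / 2)%:C%C * v.
  by rewrite th mulrAC -xy; field.
have e2 : y - (x + y) / 2 = (t / 2)%:C%C * v.
  by rewrite th mulrAC -xy; field.
have := ih _ _ _ t2 e1 Ax Am; have := ih _ _ _ t2 e2 Am Ay; lra.
Qed.

(** On the edge put s = z / q = a + b i. The integrand has imaginary part Im ((i - 1) / s) = (a + b)
    / |s|^2, which is at least 1 because a + b >= 1 and |s| <= 1. The exact integral would be pi /
    2. *)
Lemma edge_winding k q : q != 0 ->
  1 <= complex.Im (seg (fun z : C => z^-1 : C) k q (i * q) : C).
Proof.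
move=> q0.
have := @seg_Im_ge (fun z : C => z^-1) (edge q) (i * q - q) 1 k q (i * q) 1.
rewrite mulr1; apply => //.
- exact: midconvex_edge.
- move=> z [z1 z2]; have zq := edge_nm q0 (conj z1 z2).
  have qq := nm_gt0 q0.
  have z0 : z != 0 by apply/eqP => z0; move: zq; rewrite z0 nm0; lra.
  have -> : (i * q - q) * z^-1 = (i - 1) / (z / q).
    by field; rewrite q0 z0.
  have s1 : nm (z / q) <= 1 by rewrite nmM nmV ler_pdivrMr// mul1r.
  have s2 : nm (z / q) ^+ 2 <= 1 by rewrite expr_le1// nm_ge0.
  have s0 : z / q != 0 by rewrite mulf_neq0// invr_neq0.
  have s3 : 0 < nm (z / q) ^+ 2 by rewrite exprn_gt0// nm_gt0.
  move: (z / q) z1 s0 s1 s2 s3 => s; rewrite sqr_nm; case: s => a b /= z1 s0 s1 s2 s3.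
  rewrite (_ : 0 - 1 = -1)// ?sub0r//.
  have -> : -1 * (- (b / (a ^+ 2 + b ^+ 2))) + (1 - 0) * (a / (a ^+ 2 + b ^+ 2)) =
     (a + b) / (a ^+ 2 + b ^+ 2) by rewrite subr0; field; rewrite lt0r_neq0.
  by rewrite ler_pdivlMr// mul1r (le_trans s2).
- by rewrite mul1r.
- exact: edge_start.
- exact: edge_end.
Qed.

(** The lower bound 4, valid at every level, replaces the value 2 pi i: only a quantity bounded away
    from 0 is divided out later. *)
Lemma loop_winding k p : p != 0 -> 4 <= nm (loop (fun z : C => z^-1 : C) k 0 p : C).
Proof.
move=> p0; apply: le_trans (le_trans (ler_norm _) (le_nm_Im _)).
rewrite loop0_edges !ImD.
have := edge_winding k p0.
have := edge_winding k (mulf_neq0 i_neq0 p0).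
have := edge_winding k (mulf_neq0 i_neq0 (mulf_neq0 i_neq0 p0)).
have := edge_winding k (mulf_neq0 i_neq0 (mulf_neq0 i_neq0 (mulf_neq0 i_neq0 p0))).
lra.
Qed.

(** Cauchy's theorem with an exceptional point. By [loop_null_half] the loop can be moved to an
    arbitrarily small square at a negligible cost, and there [o(1 / nm z)] times the perimeter is
    small. *)
Lemma loop_null_exceptional V (F : C -> V) p : p != 0 ->
  (forall z, 0 < nm z -> nm z <= 2 * nm p -> exists d, cd F z d) ->
  (forall e : R, 0 < e -> exists2 r : R, 0 < r &
     forall z, 0 < nm z -> nm z < r -> nm (F z) <= e / nm z) ->
  loop_null F 0 p.
Proof.
move=> p0 Fd Fo.
have pp := nm_gt0 p0.
have pn n : nm (p / 2 ^+ n) = nm p / 2 ^+ n by rewrite nmM nmV nmX nm_nat.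
have pS n : p / 2 ^+ n / 2 = p / 2 ^+ n.+1.
  by rewrite exprS; field; rewrite expf_neq0.
(* Each halving of the square uses up one level of subdivision, hence [k + n] against [k]. *)
have H n (e : R) : 0 < e -> exists K, forall k, (K <= k)%N ->
    nm (loop F (k + n).+1 0 p - loop F k.+1 0 (p / 2 ^+ n)) <= e.
  elim: n e => [|n ih] e e0.
    by exists 0%N => k _; rewrite addn0 expr0 divr1 subrr nm0 ltW.
  have e2 : 0 < e / 2 by lra.
  have [K hK] := ih _ e2.
  have [|K' _ hK'] := @loop_null_half _ _ F 0 (p / 2 ^+ n) _ _ e2.
    move=> z; rewrite subr0 pn => z0 zp; apply: Fd => //; apply: (le_trans zp).
    rewrite ler_pM2l// ler_pdivrMr ?exprn_gt0// ler_peMr ?(ltW pp)//.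
    by rewrite exprn_ege1// ler1n.
  exists (maxn K K') => k; rewrite geq_max => /andP[Kk K'k].
  have h := hK _ (leqW Kk); have /= := hK' _ K'k; rewrite pS => h'.
  rewrite addnS -addSn.
  have := nm_tri (loop F (k.+1 + n).+1 0 p) (loop F k.+2 0 (p / 2 ^+ n))
     (loop F k.+1 0 (p / 2 ^+ n.+1)).
  by move: h h'; lra.
move=> e e0.
(* On the small square [q] the inverse of [nm z] is at most [2 / nm q], and
   [8 * nm q * (e / 32) * (2 / nm q)] is [e / 2]. *)
have e32 : 0 < e / 32 by lra.
have [r r0 Fr] := Fo _ e32.
have r2 : 0 < r / 2 by lra.
have [n pr] := half_expn_small (nm p) r2.
have e2 : 0 < e / 2 by lra.
have [K hK] := H n _ e2; exists (K + n).+1 => // -[|k] /= Kk; first by [].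
rewrite ltnS in Kk.
have nk : (n <= k)%N by rewrite (leq_trans _ Kk)// leq_addl.
have := hK (k - n)%N; rewrite subnK// => /(_ _).
rewrite leq_subRL// addnC => /(_ Kk) h.
have q0 : p / 2 ^+ n != 0 by rewrite mulf_neq0// invr_neq0// expf_neq0.
have qq := nm_gt0 q0.
have : nm (loop F (k - n).+1 0 (p / 2 ^+ n)) <=
    8 * nm (p / 2 ^+ n) * (e / 32 * (2 / nm (p / 2 ^+ n))).
  apply: loop0_bound => // z z1 z2; have z0 : 0 < nm z by lra.
  apply: (le_trans (Fr _ z0 _)); first by rewrite (le_lt_trans z2)// pn; lra.
  rewrite ler_pM2l// -[leRHS]invrK lef_pV2 ?posrE ?invr_gt0 ?divr_gt0// invfM invrK.
  by rewrite mulrC.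
have -> : 8 * nm (p / 2 ^+ n) * (e / 32 * (2 / nm (p / 2 ^+ n))) = e / 2.
  by field; exact: lt0r_neq0.
have := nmD (loop F k.+1 0 p - loop F (k - n).+1 0 (p / 2 ^+ n))
  (loop F (k - n).+1 0 (p / 2 ^+ n)); rewrite subrK.
by move: h; lra.
Qed.

(** The function [G z = (h z - h 0 - z D) / z^2] has null loops, so [D] times the loop of [1 / z]
    equals the loop of [(h z - h 0) / z^2] up to a small error. With [nm p = 1 / 2] the latter is at
    most [8 * (1 / 2) * 16 * (2 * M) = 128 * M]; dividing by the winding bound 4 gives 32. *)
Lemma cauchy_estimate_unit V (h : C -> V) (M : R) D :
  (forall z, nm z <= 1 -> exists d, cd h z d) -> (forall z, nm z <= 1 -> nm (h z) <= M) ->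
  cd h 0 D -> nm D <= 32 * M.
Proof.
move=> hd hM h0.
(* The exceptional-point lemma asks for differentiability up to [2 * nm p], which is the radius 1
   available here. *)
pose p : C := 2^-1; have pE : nm p = 2^-1 by rewrite nmV nm_nat.
have p0 : p != 0 by rewrite invr_neq0.
pose G z := z^-1 ^+ 2 *: (h z - h 0 - z *: D).
have Gnull : loop_null G 0 p.
  apply: loop_null_exceptional => //.
    move=> z z0 zp; have zn : z != 0 by apply/eqP => zE; move: z0; rewrite zE nm0 ltxx.
    have [|d hzd] := hd z; first by move: zp; rewrite pE; lra.
    have c1 := cdV zn (cd_id z); have c2 := cdM c1 c1.
    have c3 := cdB (cdB hzd (cd_cst (h 0) z)) (cdZ (cd_id z) (cd_cst D z)).
    by have := cdZ c2 c3 => c4; eexists; exact: c4.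
  move=> e e0; have [r r0 hr] := h0 _ e0; exists r => // z z0 zr.
  have := hr z zr; rewrite add0r => hz; rewrite /G nmZ nmX nmV.
  have -> : e / nm z = (nm z)^-1 ^+ 2 * (e * nm z) by field; exact: lt0r_neq0.
  by rewrite ler_wpM2l// exprn_ge0// invr_ge0 ltW.
apply/ler_addgt0Pl => e e0.
have [K _ hK] := Gnull _ e0; have /= hk := hK K (leqnn K).
have GE : (fun z => z^-1 *: D) = fun z => z^-1 ^+ 2 *: (h z - h 0) + - G z.
  apply/funext => z; rewrite /G; have [->|z0] := eqVneq z 0.
    by rewrite invr0 expr0n/= !scale0r subr0.
  by module_over (Defs.C R) V; repeat split; field.
have := loop_scale (fun z : C => z^-1 : C) D K 0 p; rewrite GE loopD loopN => lE.
have B : nm (loop (fun z => z^-1 ^+ 2 *: (h z - h 0)) K 0 p) <= 8 * nm p * (16 * (2 * M)).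
  apply: loop0_bound => // z; rewrite pE => z1 z2; rewrite nmZ.
  apply: ler_pM; rewrite ?nm_ge0//.
    rewrite nmX nmV (_ : 16 = 4 ^+ 2 :> R); last by ring.
    rewrite lerXn2r ?nnegrE// ?invr_ge0 ?nm_ge0// -[leRHS]invrK lef_pV2 ?posrE//; lra.
  have := nmB (h z) (h 0); have := hM 0; have := hM z; rewrite nm0.
  by move=> h1 h2; have {}h1 := h1 ltac:(lra); have {}h2 := h2 ltac:(lra); lra.
have W := loop_winding K p0; have := congr1 nm lE; rewrite nmZ => E.
have := nmB (loop (fun z => z^-1 ^+ 2 *: (h z - h 0)) K 0 p) (loop G K 0 p).
have : 4 * nm D <= nm (loop (fun z : C => z^-1 : C) K 0 p : C) * nm D.
  by rewrite ler_wpM2r// nm_ge0.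
by rewrite -E; move: B hk; rewrite pE; lra.
Qed.

Lemma cauchy_estimate V (h : C -> V) (c : C) (r M : R) D : 0 < r ->
  (forall z, nm (z - c) <= r -> exists d, cd h z d) ->
  (forall z, nm (z - c) <= r -> nm (h z) <= M) -> cd h c D -> nm D <= 32 * M / r.
Proof.
move=> r0 hd hM hc; have rE : nm (r%:C%C : C) = r by rewrite nm_real gtr0_norm.
have cr z : nm z <= 1 -> nm (c + r%:C%C * z - c) <= r.
  by move=> z1; rewrite addrC addKr nmM rE ler_piMr// ltW.
rewrite ler_pdivlMr// mulrC -{1}rE -nmZ.
apply: (@cauchy_estimate_unit _ (fun z => h (c + r%:C%C * z))).
- by move=> z /cr/hd[d hzd]; exists (r%:C%C *: d); exact: cd_affine.
- by move=> z /cr/hM.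
- by apply: cd_affine; rewrite mulr0 addr0.
Qed.

(** A bisection replaces integration along the segment. If the slope [K] of [h] between [x] and [y]
    exceeded [B], one of the two halves would again have slope at least [K], and so on; at the
    common limit this contradicts a derivative of norm at most [B]. *)
Lemma mean_value_bound V (h : C -> V) (c : C) (r B : R) x y :
  (forall z, nm (z - c) <= r -> exists2 d, cd h z d & nm d <= B) ->
  nm (x - c) <= r -> nm (y - c) <= r -> nm (h y - h x) <= B * nm (y - x).
Proof.
move=> hd xr yr; have [->|xy] := eqVneq y x; first by rewrite !subrr !nm0 mulr0.
have dp : 0 < nm (y - x) by rewrite nm_gt0// subr_eq0.
rewrite leNgt; apply/negP => lt.
pose K := nm (h y - h x) / nm (y - x).
have BK : B < K by rewrite /K ltr_pdivlMr.
pose bad (a : C * C) := [/\ nm (a.1 - c) <= r, nm (a.2 - c) <= r &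
  K * nm (a.2 - a.1) <= nm (h a.2 - h a.1)].
have child (a : C * C) : exists b : C * C, bad a ->
    [/\ bad b, b.2 - b.1 = (a.2 - a.1) / 2 & nm (b.1 - a.1) <= nm (a.2 - a.1) / 2].
  case: a => a1 a2; pose m := (a1 + a2) / 2.
  have m1 : m - a1 = (a2 - a1) / 2 by rewrite /m; field.
  have m2 : a2 - m = (a2 - a1) / 2 by rewrite /m; field.
  have n2 (q : C) : nm (q / 2) = nm q / 2 by rewrite nmM nmV nm_nat.
  case: (leP (K * nm (m - a1)) (nm (h m - h a1))) => h1.
    exists (a1, m) => -[/= r1 r2 hh]; rewrite subrr nm0 divr_ge0 ?nm_ge0//.
    by split=> //; split=> //=; exact: midconvex_ball.
  exists (m, a2) => -[/= r1 r2 hh]; rewrite m1 n2; split=> //; split=> //=.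
    exact: midconvex_ball.
  have := nm_tri (h a2) (h m) (h a1); move: h1 hh; rewrite m1 m2 n2; lra.
have /choice[ch chP] := child.
pose s n := iter n ch (x, y).
have s0 : bad (x, y) by split=> //=; rewrite /K divfK// lt0r_neq0.
have sbad n : bad (s n) by elim: n => // n /chP[].
have sd n : nm ((s n).2 - (s n).1) = nm (y - x) / 2 ^+ n.
  elim: n => [|n ih]; first by rewrite expr0 divr1.
  have [_ -> _] := chP _ (sbad n); rewrite nmM nmV nm_nat ih exprS.
  by field; rewrite expf_neq0.
have [l sl] : exists l, forall n, nm ((s n).1 - l) <= nm (y - x) / 2 ^+ n.
  apply: (@halving_cvg R (C : normedModType C)); first exact: complete_complex.
  move=> n; have [_ _ h1] := chP _ (sbad n); apply: (le_trans h1).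
  by rewrite sd exprS le_eqVlt; apply/orP; left; apply/eqP; field; rewrite expf_neq0.
have lr : nm (l - c) <= r.
  apply/ler_addgt0Pl => e e0; have [n ne] := half_expn_small (nm (y - x)) e0.
  have := nm_tri l (s n).1 c; have [h1 _ _] := sbad n; have := sl n.
  by rewrite (nm_distC l (s n).1); lra.
have [d hl dB] := hd _ lr.
(* The endpoints [a] and [b] lie within [nm (b - a)] and [2 * nm (b - a)] of [l], so the remainders
   sum to three quarters of [(K - B) * nm (b - a)], short of the whole gap. *)
have e0 : 0 < (K - B) / 4 by rewrite divr_gt0// subr_gt0.
have [t t0 ht] := hl _ e0; have t4 : 0 < t / 4 by lra.
have [n ne] := half_expn_small (nm (y - x)) t4.
have [_ _] := sbad n; have := sl n; rewrite -sd; move: ne; rewrite -sd.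
have dpos : 0 < nm ((s n).2 - (s n).1) by rewrite sd divr_gt0// exprn_gt0.
move: (s n) dpos => [a b] /= dpos ne al hbad.
have bl : nm (b - l) <= 2 * nm (b - a) by have := nm_tri b a l; lra.
have := ht (a - l) ltac:(lra); have := ht (b - l) ltac:(lra).
rewrite !(addrC l) !subrK => hb ha.
have : nm (h b - h a) <= nm (h b - h l - (b - l) *: d) +
   nm (h a - h l - (a - l) *: d) + nm (b - a) * nm d.
  rewrite -nmZ.
  have -> : h b - h a = (h b - h l - (b - l) *: d) -
     (h a - h l - (a - l) *: d) + (b - a) *: d by module_ (Defs.C R) V.
  by apply: (le_trans (nmD _ _)); rewrite lerD2r nmB.
have h1 : (K - B) / 4 * nm (b - l) <= (K - B) / 4 * (2 * nm (b - a)) by rewrite ler_pM2l.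
have h2 : (K - B) / 4 * nm (a - l) <= (K - B) / 4 * nm (b - a) by rewrite ler_pM2l.
have h3 : nm (b - a) * nm d <= nm (b - a) * B by rewrite ler_pM2l.
have h4 : 0 < (K - B) * nm (b - a) by rewrite mulr_gt0// subr_gt0.
by move: hbad ha hb h1 h2 h3 h4; lra.
Qed.

End CauchyEstimate.

(** * Differentiability of the derivative *)

Section Regularity.
Context {R : realType}.
Local Notation C := (C R).
Implicit Types (V : normedModType C) (z w c : C).

Definition cd_ball V (f : C -> V) c (r : R) :=
  forall z, nm (z - c) <= r -> cd f z ((derive1 f) z).

Lemma cd_ball_sub V (f : C -> V) c (r : R) c' (r' : R) :
  cd_ball f c r -> nm (c' - c) + r' <= r -> cd_ball f c' r'.
Proof. by move=> fd cr z zc; apply: fd; have := nm_tri z c' c; lra. Qed.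

Lemma deriv_bound V (f : C -> V) c (r M : R) : 0 < r -> cd_ball f c r ->
  (forall z, nm (z - c) <= r -> nm (f z) <= M) ->
  forall z, nm (z - c) <= r / 2 -> nm ((derive1 f) z) <= 64 * M / r.
Proof.
move=> r0 fd fM z zc; have r2 : 0 < r / 2 by lra.
have sub w : nm (w - z) <= r / 2 -> nm (w - c) <= r by have := nm_tri w z c; lra.
have -> : 64 * M / r = 32 * M / (r / 2) by field; exact: lt0r_neq0.
apply: (@cauchy_estimate _ _ f z) => //.
- by move=> w /sub/fd h; exists ((derive1 f) w).
- by move=> w /sub/fM.
- by apply: fd; lra.
Qed.

(** No second derivative is available yet. Cauchy's estimate is applied to [f (z + w) - f z], which
    is of size [nm w] by the mean value bound, and whose derivative at [c] is the difference in
    question. *)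
Lemma deriv_lipschitz V (f : C -> V) c (r M : R) : 0 < r -> cd_ball f c r ->
  (forall z, nm (z - c) <= r -> nm (f z) <= M) ->
  forall w, nm w <= r / 4 ->
   nm ((derive1 f) (c + w) - (derive1 f) c) <= 2 ^+ 14 * M / r ^+ 2 * nm w.
Proof.
move=> r0 fd fM w wr; have B1 := deriv_bound r0 fd fM.
have r4 : 0 < r / 4 by lra.
have sh z : nm (z - c) <= r / 4 -> nm (z + w - c) <= r / 2.
  by have := nm_tri (z + w) z c; rewrite (addrC z) addrK; lra.
have Fd z : nm (z - c) <= r / 4 ->
    cd (fun z => f (z + w) - f z) z ((derive1 f) (z + w) - (derive1 f) z).
  move=> zc; apply: cdB; last by apply: fd; lra.
  by apply: cd_comp_shift; apply: fd; have := sh z zc; lra.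
have FM z : nm (z - c) <= r / 4 -> nm (f (z + w) - f z) <= 64 * M / r * nm w.
  move=> zc; have -> : nm w = nm (z + w - z) by rewrite addrC addKr.
  apply: (@mean_value_bound _ _ f c (r / 2)); [|lra|exact: sh].
  by move=> y yc; exists ((derive1 f) y); [apply: fd; lra|exact: B1].
(* The constants multiply to [32 * 64 * 4 = 2 ^+ 13], one factor 2 below the stated one. *)
have -> : 2 ^+ 14 * M / r ^+ 2 * nm w = 32 * (64 * M / r * nm w) / (r / 4) * 2.
  by field; exact: lt0r_neq0.
have : nm ((derive1 f) (c + w) - (derive1 f) c) <= 32 * (64 * M / r * nm w) / (r / 4).
  apply: (@cauchy_estimate _ _ (fun z => f (z + w) - f z) c) => //.
    by move=> z /Fd h; eexists; exact: h.
  by apply: Fd; rewrite subrr nm0 ltW.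
have := nm_ge0 ((derive1 f) (c + w) - (derive1 f) c); lra.
Qed.

(** The mean value bound on [f (c + z) - z *: f' c], whose derivative [f' (c + z) - f' c] is
    controlled by [deriv_lipschitz]. *)
Lemma taylor2 V (f : C -> V) c (r M : R) : 0 < r -> cd_ball f c r ->
  (forall z, nm (z - c) <= r -> nm (f z) <= M) ->
  forall w, nm w <= r / 4 ->
   nm (f (c + w) - f c - w *: (derive1 f) c) <= 2 ^+ 14 * M / r ^+ 2 * nm w ^+ 2.
Proof.
move=> r0 fd fM w wr; set L := 2 ^+ 14 * M / r ^+ 2.
have L0 : 0 <= L.
  rewrite divr_ge0 ?exprn_ge0 ?(ltW r0)// mulr_ge0//.
  by rewrite (le_trans (nm_ge0 _) (fM c _))// subrr nm0 ltW.
pose g z := f (c + z) - z *: (derive1 f) c.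
have -> : f (c + w) - f c - w *: (derive1 f) c = g w - g 0.
  by rewrite /g addr0; module_ (Defs.C R) V.
have -> : L * nm w ^+ 2 = L * nm w * nm (w - 0) by rewrite subr0 expr2 mulrA.
apply: (@mean_value_bound _ _ g 0 (nm w)); rewrite ?subrr ?nm0 ?nm_ge0 ?subr0//.
move=> z; rewrite subr0 => zw; exists ((derive1 f) (c + z) - (derive1 f) c).
  apply: cdB; last first.
    by have := cdZ (cd_id z) (cd_cst ((derive1 f) c) z); rewrite scale1r scaler0 addr0.
  have := @cd_affine _ _ f c 1 z ((derive1 f) (c + z)).
  rewrite mul1r scale1r (_ : (fun w => _) = fun w => f (c + w)).
    by apply; apply: fd; rewrite addrC addKr; lra.
  by apply/funext => y; rewrite mul1r.
apply: (le_trans (deriv_lipschitz r0 fd fM (le_trans zw wr))).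
by rewrite ler_wpM2l.
Qed.

(** The difference quotient [dq v] of f' at [c] is the derivative at [c] of the quotient [q v] of
    [f]. By [taylor2] the functions [q v] tend to f' uniformly near [c], so Cauchy's estimate on
    [q u - q v] makes the [dq v] a Cauchy family; completeness provides the second derivative. *)
Lemma deriv_derivable V (f : C -> V) c (r M : R) : complete_space V -> 0 < r ->
  cd_ball f c r -> (forall z, nm (z - c) <= r -> nm (f z) <= M) ->
  exists D, cd (derive1 f) c D.
Proof.
move=> VC r0 fd fM; set L := 2 ^+ 14 * M / r ^+ 2.
have M0 : 0 <= M by rewrite (le_trans (nm_ge0 _) (fM c _))// subrr nm0 ltW.
have L0 : 0 <= L by rewrite divr_ge0 ?exprn_ge0 ?(ltW r0)// mulr_ge0.
pose q v z := v^-1 *: (f (z + v) - f z).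
pose dq v := v^-1 *: ((derive1 f) (c + v) - (derive1 f) c).
(* This is [32 * (4 * L) / (r / 2)]: Cauchy's estimate with radius [r / 2], where [4 * L] is the
   Taylor constant for the halved radius. *)
pose K := 256 * L / r.
have r2 : 0 < r / 2 by lra.
have qf v z : v != 0 -> nm v <= r / 8 -> nm (z - c) <= r / 2 ->
    nm (q v z - (derive1 f) z) <= 4 * L * nm v.
  move=> v0 vr zc.
  have fzd : cd_ball f z (r / 2) by apply: (cd_ball_sub fd); lra.
  have fzM y : nm (y - z) <= r / 2 -> nm (f y) <= M.
    by move=> yz; apply: fM; have := nm_tri y z c; lra.
  have v8 : nm v <= r / 2 / 4 by lra.
  have := taylor2 r2 fzd fzM v8.
  have -> : 2 ^+ 14 * M / (r / 2) ^+ 2 = 4 * L by rewrite /L; field; exact: lt0r_neq0.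
  have -> : f (z + v) - f z - v *: (derive1 f) z = v *: (q v z - (derive1 f) z).
    by rewrite /q; module_over (Defs.C R) V; repeat split; field.
  by rewrite nmZ expr2 mulrCA ler_pM2l// nm_gt0.
have dqK u v : u != 0 -> v != 0 -> nm u <= r / 8 -> nm v <= r / 8 ->
    nm (dq u - dq v) <= K * (nm u + nm v).
  move=> u0 v0 ur vr.
  have -> : K * (nm u + nm v) = 32 * (4 * L * (nm u + nm v)) / (r / 2).
    by rewrite /K; field; exact: lt0r_neq0.
  have sh (x z : C) : nm x <= r / 8 -> nm (z - c) <= r / 2 -> nm (z + x - c) <= r.
    by have := nm_tri (z + x) z c; rewrite (addrC z) addrK; lra.
  have qd x z : nm x <= r / 8 -> nm (z - c) <= r / 2 ->
      cd (q x) z (x^-1 *: ((derive1 f) (z + x) - (derive1 f) z)).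
    move=> xr zc; apply: cdcZ; apply: cdB; last by apply: fd; lra.
    by apply: cd_comp_shift; apply: fd; exact: sh.
  apply: (@cauchy_estimate _ _ (fun z => q u z - q v z) c) => //.
  - by move=> z zc; eexists; apply: cdB; exact: qd.
  - move=> z zc; have := qf _ _ u0 ur zc; have := qf _ _ v0 vr zc.
    have := nm_tri (q u z) ((derive1 f) z) (q v z); rewrite (nm_distC (derive1 f z) (q v z)); lra.
  - by apply: cdB; apply: qd => //; rewrite subrr nm0 ltW.
have K0 : 0 <= K by apply: divr_ge0; [exact: mulr_ge0|exact: ltW].
pose v n : C := (r / 8 / 2 ^+ n)%:C%C.
have v0 n : 0 < r / 8 / 2 ^+ n by rewrite divr_gt0 ?exprn_gt0//; lra.
have vE n : nm (v n) = r / 8 / 2 ^+ n by rewrite nm_real gtr0_norm.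
have vn0 n : v n != 0.
  by apply/eqP => vn; have := v0 n; rewrite -vE vn nm0 ltxx.
have vr n : nm (v n) <= r / 8.
  rewrite vE ler_pdivrMr ?exprn_gt0// ler_peMr//; first by lra.
  by rewrite exprn_ege1// ler1n.
have [|D DE] := @halving_cvg _ _ (fun n => dq (v n)) (4 * K * (r / 8)) VC.
  move=> n; apply: (le_trans (dqK _ _ (vn0 _) (vn0 _) (vr _) (vr _))).
  rewrite !vE exprS.
  have -> : K * (r / 8 / (2 * 2 ^+ n) + r / 8 / 2 ^+ n) =
    3 * (K * (r / 8 / (2 * 2 ^+ n))) by field; rewrite expf_neq0.
  have -> : 4 * K * (r / 8) / (2 * 2 ^+ n) = 4 * (K * (r / 8 / (2 * 2 ^+ n))).
    by field; rewrite expf_neq0.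
  have : 0 <= K * (r / 8 / (2 * 2 ^+ n)) by rewrite -exprS mulr_ge0// ltW.
  lra.
have dD u : u != 0 -> nm u <= r / 8 -> nm (dq u - D) <= K * nm u.
  move=> u0 ur; apply/ler_addgt0Pl => e e0; have e2 : 0 < e / 2 by lra.
  have [n1 h1] := half_expn_small (4 * K * (r / 8)) e2.
  have := nm_tri (dq u) (dq (v n1)) D; have := DE n1.
  have := dqK _ _ u0 (vn0 n1) ur (vr n1); rewrite vE mulrDr.
  have : K * (r / 8 / 2 ^+ n1) <= 4 * K * (r / 8) / 2 ^+ n1.
    have : 0 <= K * (r / 8 / 2 ^+ n1) by rewrite mulr_ge0// ltW.
    have -> : 4 * K * (r / 8) / 2 ^+ n1 = 4 * (K * (r / 8 / 2 ^+ n1)) by ring.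
    lra.
  move: h1; lra.
exists D => e e0; exists (Num.min (r / 8) (e / (1 + K))).
  by rewrite lt_min; apply/andP; split; [lra|apply: divr_gt0 => //; lra].
move=> w; rewrite lt_min => /andP[w8]; rewrite ltr_pdivlMr; last by lra.
move=> we; have [->|w0] := eqVneq w 0.
  by rewrite addr0 subrr scale0r subr0 !nm0 mulr0.
have -> : (derive1 f) (c + w) - (derive1 f) c - w *: D = w *: (dq w - D).
  by rewrite /dq; module_over (Defs.C R) V; repeat split; field.
rewrite nmZ mulrC ler_wpM2r ?nm_ge0//.
have := dD _ w0 (ltW w8); have := nm_ge0 w; move: we; rewrite mulrDr mulr1; lra.
Qed.

End Regularity.

(** * Holomorphic functions on the disk and their derivatives *)

Section Disk.
Context {R : realType}.
Local Notation C := (C R).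
Implicit Types (V : normedModType C) (z w c : C).

Lemma unit_diskE z : unit_disk z <-> nm z < 1.
Proof.
rewrite /unit_disk/= normE.
by rewrite (_ : (1 : C) = (1 : R)%:C%C)// ltcR.
Qed.

Definition hol V (f : C -> V) := forall z, nm z < 1 -> cd f z ((derive1 f) z).

Lemma hol_intro V (f : C -> V) :
  (forall z, nm z < 1 -> exists d, cd f z d) -> hol f.
Proof. by move=> fd z /fd[d fz]; rewrite (cd_derive1 fz). Qed.

Lemma holomorphicP V (f : C -> V) : holomorphic f <-> hol f.
Proof.
split=> fh z; first by move=> /unit_diskE/fh/derivable_cd1.
by move=> /unit_diskE/fh fz; apply/derivable_cd; exists ((derive1 f) z).
Qed.

Lemma hol_ball V (f : C -> V) c (r : R) : hol f -> nm c + r < 1 -> cd_ball f c r.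
Proof.
move=> fh cr z zc; apply: fh; have := nmD (z - c) c; rewrite subrK; lra.
Qed.

Lemma hol_local V (f g : C -> V) :
  (forall z, nm z < 1 -> f z = g z) -> hol f -> hol g.
Proof.
move=> fg fh; apply: hol_intro => z z1; exists ((derive1 f) z).
apply: (@cd_local _ _ f _ _ _ (1 - nm z)); rewrite ?subr_gt0//; last exact: fh.
by move=> w wz; apply: fg; have := nmD z w; lra.
Qed.

(** Compactness of the closed disc: points where [f] exceeds every integer have a limit along an
    ultrafilter, and [f] is bounded near that limit. *)
Lemma hol_locally_bounded V (f : C -> V) (r : R) : hol f -> r < 1 ->
  exists M, forall z, nm z <= r -> nm (f z) <= M.
Proof.
move=> fh r1; apply: contrapT => /forallNP H.
have /choice[z zP] : forall m : nat, exists z, nm z <= r /\ m%:R < nm (f z).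
  move=> m; have /existsNP[z /not_implyP[zr /negP]] := H m%:R.
  by rewrite -ltNge => fz; exists z.
have [U [UU ooU]] := exists_ultra_nat.
have UP : ProperFilter U by exact: ultra_proper.
have [l zl] := ultra_cvg_complex UU (fun m => (zP m).1).
have lr : nm l <= r by apply: (vcv_le zl); apply: filterE => m; case: (zP m).
have [s s0 fs] := cd_cont (fh l (le_lt_trans lr r1)) ltr01.
have s2 : 0 < s / 2 by lra.
have N0 : 0 <= 1 + nm (f l) by rewrite addr_ge0// nm_ge0.
have ub : U [set m | (Num.bound (1 + nm (f l)) <= m)%N].
  by apply: ooU; exists (Num.bound (1 + nm (f l))).
have [m [mN ml]] := filter_ex (filterI ub (zl _ s2)).
have := fs (z m - l) (le_lt_trans ml _); rewrite (addrC l) subrK => /(_ ltac:(lra)).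
have [_] := zP m; have := archi_boundP N0.
have : (Num.bound (1 + nm (f l)))%:R <= m%:R :> R by rewrite ler_nat.
have := nmD (f (z m) - f l) (f l); rewrite subrK; lra.
Qed.

Lemma hol_derive V (f : C -> V) : complete_space V -> hol f -> hol (derive1 f).
Proof.
move=> VC fh; apply: hol_intro => z z1; pose r := (1 - nm z) / 2.
have r0 : 0 < r by rewrite /r; lra.
have zr : nm z + r < 1 by rewrite /r; lra.
have [M fM] := hol_locally_bounded fh zr.
apply: (@deriv_derivable _ _ f z r M) => //; first exact: hol_ball.
by move=> w wz; apply: fM; have := nmD (w - z) z; rewrite subrK; lra.
Qed.

Lemma hol_derive1n V (f : C -> V) j : complete_space V -> hol f -> hol (derive1n j f).
Proof. by move=> VC fh; elim: j => // j ih; exact: hol_derive. Qed.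

Lemma hol_locally_lipschitz V (f : C -> V) (r : R) : complete_space V ->
  hol f -> r < 1 -> exists2 K, 0 <= K & forall x y, nm x <= r -> nm y <= r ->
    nm (f y - f x) <= K * nm (y - x).
Proof.
move=> VC fh r1; have [M fM] := hol_locally_bounded (hol_derive VC fh) r1.
exists (Num.max 0 M); first by rewrite le_max lexx.
move=> x y xr yr; apply: (@mean_value_bound _ _ f 0 r); rewrite ?subr0//.
move=> z; rewrite subr0 => zr; exists ((derive1 f) z); first by apply: fh; lra.
by rewrite le_max fM ?orbT.
Qed.

Lemma disk_lipschitz V (f : C -> V) (M : R) : hol f ->
  (forall z, nm z < 1 -> nm ((derive1 f) z) <= M) ->
  forall x y, nm x < 1 -> nm y < 1 -> nm (f y - f x) <= M * nm (y - x).
Proof.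
move=> fh fM x y x1 y1.
apply: (@mean_value_bound _ _ f 0 (Num.max (nm x) (nm y))).
- move=> z; rewrite subr0 => zr; have z1 : nm z < 1.
    by rewrite (le_lt_trans zr)// gt_max x1.
  by exists ((derive1 f) z); [exact: fh|exact: fM].
- by rewrite subr0 le_max lexx.
- by rewrite subr0 le_max lexx orbT.
Qed.

Definition lucv V (F : nat -> C -> V) (f : C -> V) := forall r e : R, r < 1 -> 0 < e ->
  exists N, forall m, (N <= m)%N -> forall z, nm z <= r -> nm (F m z - f z) <= e.

(** Weierstrass' theorem. Cauchy's estimate makes the derivatives at [z] a Cauchy sequence, and the
    Taylor constant is the same for all large [m], so the quadratic bound passes to the limit. *)
Lemma lucv_hol V (F : nat -> C -> V) (f : C -> V) : complete_space V ->
  (forall m, hol (F m)) -> lucv F f -> hol f.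
Proof.
move=> VC Fh Ff; apply: hol_intro => z z1; pose r := (1 - nm z) / 2.
have r0 : 0 < r by rewrite /r; lra.
have zr : nm z + r < 1 by rewrite /r; lra.
have br w : nm (w - z) <= r -> nm w <= nm z + r.
  by have := nmD (w - z) z; rewrite subrK; lra.
have Fb m : cd_ball (F m) z r by exact: hol_ball.
have [|D DE] := VC (fun m => (derive1 (F m)) z).
  move=> e e0; have e1 : 0 < e * r / 64 by rewrite divr_gt0// mulr_gt0.
  have [N FN] := Ff _ _ zr e1; exists N => m l Nm Nl.
  rewrite (_ : e = 32 * (e * r / 64 + e * r / 64) / r); last first.
    by field; exact: lt0r_neq0.
  apply: (@cauchy_estimate _ _ (fun w => F m w - F l w) z) => //.
  - move=> w wz; exists ((derive1 (F m)) w - (derive1 (F l)) w); apply: cdB; exact: Fb.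
  - move=> w /br wz; have := FN _ Nm _ wz; have := FN _ Nl _ wz.
    have := nm_tri (F m w) (f w) (F l w); rewrite (nm_distC (f w) (F l w)); lra.
  - by apply: cdB; apply: Fb; rewrite subrr nm0 ltW.
have [N0 FN0] := Ff _ 1 zr ltr01.
have [M0 FM0] := hol_locally_bounded (Fh N0) zr.
(* From [N0] on, each [F m] is within 1 of [f], hence within 2 of [F N0]. *)
pose M := M0 + 2.
have FM m : (N0 <= m)%N -> forall w, nm (w - z) <= r -> nm (F m w) <= M.
  move=> Nm w /br wz; have := FN0 _ Nm _ wz; have := FN0 _ (leqnn _) _ wz.
  have := FM0 _ wz; have := nm_tri (F m w) (f w) (F N0 w).
  have := nmD (F m w - F N0 w) (F N0 w); rewrite subrK (nm_distC (f w) (F N0 w)) /M; lra.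
exists D => e e0; set L := 2 ^+ 14 * M / r ^+ 2.
have L0 : 0 <= L.
  have : 0 <= M by rewrite (le_trans (nm_ge0 _) (FM N0 (leqnn _) z _))// subrr nm0 ltW.
  by move=> h; rewrite divr_ge0 ?exprn_ge0 ?(ltW r0)// mulr_ge0.
exists (Num.min (r / 4) (e / (1 + L))).
  by rewrite lt_min; apply/andP; split; [lra|apply: divr_gt0 => //; lra].
move=> w; rewrite lt_min => /andP[w4]; rewrite ltr_pdivlMr; last by lra.
move=> we; have w0 := nm_ge0 w.
apply: (@le_trans _ _ (L * nm w ^+ 2)); last first.
  by rewrite expr2 mulrA ler_wpM2r//; move: we; rewrite mulrDr mulr1; lra.
have Fpt y : nm y < 1 -> vcv \oo (fun m => F m y) (f y).
  by move=> y1; apply/vcv_ooP => d d0; have [N FN] := Ff _ _ y1 d0;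
     exists N => m Nm; apply: FN.
have zw1 : nm (z + w) < 1 by have := nmD z w; rewrite /r in w4; lra.
apply: (@vcv_le _ _ \oo _ (fun m => F m (z + w) - F m z - w *: (derive1 (F m)) z)).
  by apply: vcvB; [apply: vcvB; exact: Fpt|exact: vcvZ].
exists N0 => // m Nm; apply: (taylor2 r0 (Fb m) (FM m Nm)); exact: ltW.
Qed.

Lemma lucv_derive V (F : nat -> C -> V) (f : C -> V) : complete_space V ->
  (forall m, hol (F m)) -> lucv F f -> lucv (fun m => (derive1 (F m))) (derive1 f).
Proof.
move=> VC Fh Ff r e r1 e0; have fh := lucv_hol VC Fh Ff.
pose d := (1 - Num.max 0 r) / 2; have m1 : Num.max 0 r < 1 by rewrite gt_max ltr01.
have d0 : 0 < d by rewrite /d; lra.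
have rm : r <= Num.max 0 r by rewrite le_max lexx orbT.
have rd : r + d < 1 by rewrite /d; lra.
have e1 : 0 < e * d / 32 by rewrite divr_gt0// mulr_gt0.
have [N FN] := Ff _ _ rd e1; exists N => m Nm z zr.
rewrite (_ : e = 32 * (e * d / 32) / d); last by field; exact: lt0r_neq0.
have zd w : nm (w - z) <= d -> nm w <= r + d.
  by have := nmD (w - z) z; rewrite subrK; lra.
apply: (@cauchy_estimate _ _ (fun w => F m w - f w) z) => //.
- move=> w /zd wd; exists ((derive1 (F m)) w - (derive1 f) w); apply: cdB.
    by apply: Fh; lra.
  by apply: fh; lra.
- by move=> w /zd; exact: FN.
- by apply: cdB; [apply: Fh|apply: fh]; lra.
Qed.

Lemma lucv_derive1n V (F : nat -> C -> V) (f : C -> V) j : complete_space V ->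
  (forall m, hol (F m)) -> lucv F f -> lucv (fun m => (derive1n j (F m))) (derive1n j f).
Proof.
move=> VC Fh Ff; elim: j => // j ih; apply: lucv_derive => // m.
exact: hol_derive1n.
Qed.

End Disk.

(** * Formulas for higher derivatives *)

Section Jets.
Context {R : realType}.
Local Notation C := (C R).
Implicit Types (V : normedModType C) (z w c : C).

Lemma cd_sum V (I : Type) (s : seq I) (F : I -> C -> V) (D : I -> V) z :
  (forall i, cd (F i) z (D i)) ->
  cd (fun w => \sum_(i <- s) F i w) z (\sum_(i <- s) D i).
Proof.
move=> FD; elim: s => [|i s ih].
  rewrite big_nil (_ : (fun w => _) = fun=> 0); first exact: cd_cst.
  by apply/funext => w; rewrite big_nil.
rewrite big_cons (_ : (fun w => _) = fun w => F i w + \sum_(i <- s) F i w).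
  exact: cdD.
by apply/funext => w; rewrite big_cons.
Qed.

Lemma cdMn V (F : C -> V) D z k : cd F z D -> cd (fun w => F w *+ k) z (D *+ k).
Proof.
move=> FD; rewrite -scaler_nat (_ : (fun w => _) = fun w => k%:R *: F w).
  exact: cdcZ.
by apply/funext => w; rewrite scaler_nat.
Qed.

(** The tool for every formula on higher derivatives below: exhibit a sequence in which each term
    differentiates to the next. Equality on the disk suffices because differentiation is local. *)
Lemma jets_unique V (f : C -> V) (F : nat -> C -> V) n :
  (forall z, nm z < 1 -> F 0%N z = f z) ->
  (forall j z, (j < n)%N -> nm z < 1 -> cd (F j) z (F j.+1 z)) ->
  forall j, (j <= n)%N -> forall z, nm z < 1 -> derive1n j f z = F j z.
Proof.
move=> F0 FS; elim=> [|j ih] jn z z1; first by rewrite F0.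
apply: cd_derive1; apply: (@cd_local _ _ (F j) _ _ _ (1 - nm z)).
- by rewrite subr_gt0.
- move=> w wz; apply/esym; apply: (ih (ltnW jn)).
  by have := nmD z w; lra.
- exact: FS.
Qed.

Definition smooth V (f : C -> V) := forall j, hol (derive1n j f).

Lemma smooth_hol V (f : C -> V) : complete_space V -> hol f -> smooth f.
Proof. by move=> VC fh j; exact: hol_derive1n. Qed.

Lemma derive1n_local V (f g : C -> V) j : smooth f ->
  (forall z, nm z < 1 -> f z = g z) ->
  forall z, nm z < 1 -> derive1n j f z = derive1n j g z.
Proof.
move=> fs fg z z1; apply/esym.
apply: (@jets_unique _ g (fun j => derive1n j f) j) => //.
by move=> k w _ w1; exact: fs.
Qed.

Lemma smoothD V (f g : C -> V) : smooth f -> smooth g ->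
  smooth (fun z => f z + g z) /\ forall j z, nm z < 1 ->
    derive1n j (fun z => f z + g z) z = derive1n j f z + derive1n j g z.
Proof.
move=> fs gs; have E j z : nm z < 1 ->
    derive1n j (fun z => f z + g z) z = derive1n j f z + derive1n j g z.
  move=> z1; apply: (@jets_unique _ _ (fun j z => derive1n j f z + derive1n j g z) j) => //.
  by move=> k w _ w1; apply: cdD; [exact: fs|exact: gs].
split=> // j; apply: (@hol_local _ _ (fun z => derive1n j f z + derive1n j g z)).
  by move=> z /E ->.
by apply: hol_intro => z z1; eexists; apply: cdD; [exact: fs|exact: gs].
Qed.

Lemma smoothcZ V (a : C) (f : C -> V) : smooth f ->
  smooth (fun z => a *: f z) /\ forall j z, nm z < 1 ->
    derive1n j (fun z => a *: f z) z = a *: derive1n j f z.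
Proof.
move=> fs; have E j z : nm z < 1 ->
    derive1n j (fun z => a *: f z) z = a *: derive1n j f z.
  move=> z1; apply: (@jets_unique _ _ (fun j z => a *: derive1n j f z) j) => //.
  by move=> k w _ w1; apply: cdcZ; exact: fs.
split=> // j; apply: (@hol_local _ _ (fun z => a *: derive1n j f z)).
  by move=> z /E ->.
by apply: hol_intro => z z1; eexists; apply: cdcZ; exact: fs.
Qed.

Lemma smoothB V (f g : C -> V) : smooth f -> smooth g ->
  smooth (fun z => f z - g z) /\ forall j z, nm z < 1 ->
    derive1n j (fun z => f z - g z) z = derive1n j f z - derive1n j g z.
Proof.
move=> fs gs; have [gs' gE] := smoothcZ (-1) gs.
have [h hE] := smoothD fs gs'.
have E : (fun z => f z - g z) = fun z => f z + -1 *: g z.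
  by apply/funext => z; rewrite scaleN1r.
rewrite E; split=> // j z z1; by rewrite hE// gE// scaleN1r.
Qed.

Lemma smooth_dilate V (r : C) (f : C -> V) : nm r <= 1 -> smooth f ->
  smooth (fun z => f (r * z)) /\ forall j z, nm z < 1 ->
    derive1n j (fun z => f (r * z)) z = r ^+ j *: derive1n j f (r * z).
Proof.
move=> r1 fs.
have rz z : nm z < 1 -> nm (r * z) < 1.
  by move=> z1; rewrite nmM (le_lt_trans _ z1)// ler_piMl ?nm_ge0.
have D j z : nm z < 1 -> cd (fun z => r ^+ j *: derive1n j f (r * z)) z
    (r ^+ j.+1 *: derive1n j.+1 f (r * z)).
  move=> z1; rewrite exprSr -scalerA; apply: cdcZ.
  have := @cd_affine _ _ (derive1n j f) 0 r z (derive1n j.+1 f (r * z)).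
  rewrite add0r (_ : (fun w => _) = fun w => derive1n j f (r * w)).
    by apply; apply: fs; exact: rz.
  by apply/funext => w; rewrite add0r.
have E j z : nm z < 1 ->
    derive1n j (fun z => f (r * z)) z = r ^+ j *: derive1n j f (r * z).
  move=> z1; apply: (@jets_unique _ _ (fun j z => r ^+ j *: derive1n j f (r * z)) j) => //.
    by move=> w _; rewrite scale1r.
  by move=> k w _; exact: D.
split=> // j; apply: (@hol_local _ _ (fun z => r ^+ j *: derive1n j f (r * z))).
  by move=> z /E ->.
by apply: hol_intro => z z1; eexists; exact: D.
Qed.

(** Bundling lets one Leibniz formula serve scalar multiples and the pairing. *)
Structure bilin V1 V2 V3 := Bilin {
  bilin_fun :> V1 -> V2 -> V3;
  bilinDl : forall x x' y, bilin_fun (x + x') y = bilin_fun x y + bilin_fun x' y;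
  bilinDr : forall x y y', bilin_fun x (y + y') = bilin_fun x y + bilin_fun x y';
  bilinZl : forall a x y, bilin_fun (a *: x) y = a *: bilin_fun x y;
  bilinZr : forall a x y, bilin_fun x (a *: y) = a *: bilin_fun x y;
  bilin_le : forall x y, nm (bilin_fun x y) <= nm x * nm y }.

Definition scale_bilin V : bilin C V V.
Proof.
refine (@Bilin C V V (fun a x => a *: x) _ _ _ _ _).
- by move=> a c x; rewrite scalerDl.
- by move=> a x y; rewrite scalerDr.
- by move=> c a x; rewrite scalerA.
- by move=> a x y; rewrite !scalerA mulrC.
- by move=> a x; rewrite nmZ.
Defined.

Definition pair_bilin : bilin (ell2 R) (ell2 R) C :=
  @Bilin (ell2 R) (ell2 R) C pair pairDl pairDr pairZl pairZr pair_le.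

Definition leibniz V1 V2 V3 (b : bilin V1 V2 V3) f g j z : V3 :=
  \sum_(i < j.+1) b (derive1n i f z) (derive1n (j - i) g z) *+ 'C(j, i).

Lemma cd_leibniz V1 V2 V3 (b : bilin V1 V2 V3) f g j z : smooth f -> smooth g ->
  nm z < 1 -> cd (leibniz b f g j) z (leibniz b f g j.+1 z).
Proof.
move=> fs gs z1.
suff -> : leibniz b f g j.+1 z = \sum_(i < j.+1)
    (b (derive1n i.+1 f z) (derive1n (j - i) g z) +
     b (derive1n i f z) (derive1n (j - i).+1 g z)) *+ 'C(j, i).
  apply: (@cd_sum _ _ (index_enum 'I_j.+1)
    (fun i w => b (derive1n i f w) (derive1n (j - i) g w) *+ 'C(j, i))) => i.
  apply: cdMn; apply: (@cd_bilin _ _ _ _ b _ _ _ _ _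
    (@bilinDl _ _ _ b) (@bilinDr _ _ _ b) (@bilinZl _ _ _ b) (@bilinZr _ _ _ b)
    (@bilin_le _ _ _ b)); [exact: fs|exact: gs].
pose X i := b (derive1n i f z) (derive1n (j.+1 - i) g z).
have XE : \sum_(i < j.+1) (b (derive1n i.+1 f z) (derive1n (j - i) g z) +
     b (derive1n i f z) (derive1n (j - i).+1 g z)) *+ 'C(j, i) =
   \sum_(i < j.+1) X i.+1 *+ 'C(j, i) + \sum_(i < j.+1) X i *+ 'C(j, i).
  rewrite -big_split/=; apply: eq_bigr => i _; rewrite mulrnDl /X subSS subSn//.
  by rewrite -ltnS.
rewrite XE /leibniz -[LHS]/(\sum_(i < j.+2) X i *+ 'C(j.+1, i)) big_ord_recl bin0.
under eq_bigr do rewrite lift0 binS mulrnDr.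
rewrite big_split/= [LHS]addrA [LHS]addrC; congr (_ + _).
(* The added term has binomial coefficient 0; with it both sums can be split off at index 0 and
   joined by Pascal's rule. *)
have -> : \sum_(i < j.+1) X i *+ 'C(j, i) = \sum_(i < j.+2) X i *+ 'C(j, i).
  by rewrite [RHS]big_ord_recr/= bin_small// mulr0n addr0.
by rewrite [RHS]big_ord_recl bin0.
Qed.

Lemma smooth_bilin V1 V2 V3 (b : bilin V1 V2 V3) f g : smooth f -> smooth g ->
  smooth (fun z => b (f z) (g z)) /\ forall j z, nm z < 1 ->
    derive1n j (fun z => b (f z) (g z)) z = leibniz b f g j z.
Proof.
move=> fs gs; have E j z : nm z < 1 ->
    derive1n j (fun z => b (f z) (g z)) z = leibniz b f g j z.
  move=> z1; apply: (@jets_unique _ _ (leibniz b f g) j) => //.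
    by move=> w w1; rewrite /leibniz big_ord_recl big_ord0 addr0 bin0.
  by move=> k w _; exact: cd_leibniz.
split=> // j; apply: (@hol_local _ _ (leibniz b f g j)).
  by move=> z /E ->.
by apply: hol_intro => z z1; eexists; exact: cd_leibniz.
Qed.

End Jets.

(** * Translation of the definitions into real estimates *)

Section Bridges.
Context {R : realType}.
Local Notation C := (C R).
Local Notation l2 := (ell2 R).
Implicit Types (z w c s : C) (f g h : C -> l2).

Lemma bounded_diskP V (h : C -> (V : normedModType C)) :
  [bounded h z | z in unit_disk] <-> exists M, forall z, nm z < 1 -> nm (h z) <= M.
Proof.
split=> [[M0 [M0r hM]]|[M hM]].
  have M0E : M0 = (complex.Re M0)%:C%C by rewrite (RRe_real M0r).
  have /hM hb : M0 < (complex.Re M0 + 1)%:C%C.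
    by rewrite {1}M0E ltcR ltrDl.
  by exists (complex.Re M0 + 1) => z /unit_diskE /hb; rewrite /= normE lecR.
exists M%:C%C; split; first by apply/complex_realP; exists M.
move=> x Mx z /unit_diskE /hM hz /=; rewrite normE; apply: le_trans (ltW Mx).
by rewrite lecR.
Qed.

Definition bddn n f := forall j, (j <= n)%N ->
  exists M, forall z, nm z < 1 -> nm (derive1n j f z) <= M.

Lemma integrated_HooP n f : integrated n Hoo f <-> hol f /\ bddn n f.
Proof.
split=> [[/holomorphicP fh fA]|[fh fb]].
  by split=> // j /fA[_ /bounded_diskP].
split; first exact/holomorphicP.
move=> j jn; split; last by apply/bounded_diskP; exact: fb.
by apply/holomorphicP; exact: (hol_derive1n j complete_ell2 fh).
Qed.

(** The Cauchy criterion expresses continuous extension to [s] without naming the limit, so boundary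
    values need not be carried through sums, products and quotients. *)
Definition cauchy_at V (h : C -> (V : normedModType C)) s := forall e : R, 0 < e ->
  exists2 d : R, 0 < d & forall x y, nm x < 1 -> nm y < 1 ->
    nm (x - s) < d -> nm (y - s) < d -> nm (h x - h y) <= e.

Lemma within_cvgP V (A : set C) (F : C -> (V : normedModType C)) s :
  F x @[x --> within A (nbhs s)] --> F s <-> forall e : R, 0 < e ->
  exists2 d : R, 0 < d & forall x, A x -> nm (x - s) < d -> nm (F x - F s) <= e.
Proof.
split=> [/cvgrPdist_le Fs e e0|Fs].
  have eC : 0 < e%:C%C :> C by rewrite ltcR.
  have /nbhs_nmP[d d0 hd] := Fs _ eC; exists d => // x Ax xs.
  by have := hd x xs Ax; rewrite normE lecR nm_distC.
apply/cvgrPdist_le => e /pos_complex[-> e0]; have [d d0 hd] := Fs _ e0.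
apply/nbhs_nmP; exists d => // x xs Ax.
by rewrite normE lecR nm_distC; exact: hd.
Qed.

Lemma circle_approx s (d : R) : nm s = 1 -> 0 < d ->
  exists2 x, nm x < 1 & nm (x - s) < d.
Proof.
move=> s1 d0; pose t := Num.min 1 (d / 2).
have t0 : 0 < t by rewrite lt_min ltr01 divr_gt0.
have t1 : t <= 1 by rewrite ge_min lexx.
have td : t <= d / 2 by rewrite ge_min lexx orbT.
exists ((1 - t)%:C%C * s).
  by rewrite nmM s1 mulr1 nm_real ger0_norm; lra.
have -> : (1 - t)%:C%C * s - s = - (t%:C%C * s) by rewrite rmorphB/=; ring.
rewrite nmN nmM s1 mulr1 nm_real gtr0_norm//; lra.
Qed.

(** Completeness turns the Cauchy criterion into a limit [l s] at each point of [S]. That these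
    limits vary continuously along [S] follows by approximating a point of [S] from inside the
    disk. *)
Lemma A_P V (S : set C) (h : C -> (V : normedModType C)) : complete_space V ->
  S `<=` unit_circle -> hol h ->
  (exists2 F : C -> V, {within unit_disk `|` S, continuous F} &
     {in unit_disk, F =1 h}) <-> forall s, S s -> cauchy_at h s.
Proof.
move=> VC SC hh; split.
  move=> [F /subspace_continuousP Fc Fh] s Ss e e0.
  have e2 : 0 < e / 2 by lra.
  have /within_cvgP/(_ _ e2)[d d0 hd] := Fc s (or_intror Ss).
  exists d => // x y x1 y1 xs ys.
  have FE z : nm z < 1 -> F z = h z by move=> /unit_diskE z1; apply: Fh; rewrite inE.
  rewrite -!FE//.
  have := hd x (or_introl ((unit_diskE x).2 x1)) xs.
  have := hd y (or_introl ((unit_diskE y).2 y1)) ys.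
  have := nm_tri (F x) (F s) (F y); rewrite (nm_distC (F s) (F y)); lra.
move=> hS.
have lim s : exists l : V, S s -> forall e : R, 0 < e -> exists2 d : R, 0 < d &
    forall x, nm x < 1 -> nm (x - s) < d -> nm (h x - l) <= e.
  have [Ss|nS] := pselect (S s); last by exists 0.
  have s1 : nm s = 1 by have := SC _ Ss; rewrite /unit_circle/= normE => -[].
  have /choice[x xP] : forall m : nat, exists x, nm x < 1 /\ nm (x - s) < 1 / 2 ^+ m.
    move=> m; have [|x x1 xs] := @circle_approx s (1 / 2 ^+ m) s1.
      by rewrite divr_gt0// exprn_gt0.
    by exists x.
  have xN (d : R) : 0 < d -> exists N, forall m, (N <= m)%N -> nm (x m - s) < d.
    move=> d0; have [N hN] := half_expn_small (1 : R) d0; exists N => m Nm.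
    apply: (lt_le_trans (xP m).2); apply: le_trans hN.
    by rewrite ler_pM2l// lef_pV2 ?posrE ?exprn_gt0// ler_eXn2l// ltr1n.
  have [|l hl] := VC (h \o x).
    move=> e e0; have [d d0 hd] := hS s Ss e e0; have [N xNd] := xN d d0.
    by exists N => i j Ni Nj /=; apply: hd; rewrite ?(xP _).1 ?xNd//; apply: xNd.
  exists l => _ e e0; have [d d0 hd] := hS s Ss e e0; exists d => // y y1 ys.
  have [N xNd] := xN d d0.
  apply: (@vcv_le _ _ \oo _ (fun m => h y - h (x m))).
    by apply: vcvB => //; exact: vcv_cst.
  by exists N => // m Nm /=; apply: hd => //; [exact: (xP m).1|exact: xNd].
have {lim}/choice[l lP] := lim.
have [F [FE Fl]] : exists F : C -> V, (forall z, nm z < 1 -> F z = h z) /\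
    (forall z, nm z = 1 -> F z = l z).
  by exists (fun z => if nm z < 1 then h z else l z); split=> z ->; rewrite ?ltxx.
exists F; last by move=> z; rewrite inE => /unit_diskE /FE.
apply/subspace_continuousP => z; rewrite /setU/= => zDS; apply/within_cvgP => e e0.
have [z1|z1] := ltP (nm z) 1.
  have [d d0 hd] := cd_cont (hh z z1) e0.
  exists (Num.min d (1 - nm z)); first by rewrite lt_min d0 subr_gt0.
  move=> x _; rewrite lt_min => /andP[xd xz].
  have x1 : nm x < 1 by have := nmD (x - z) z; rewrite subrK; lra.
  rewrite !FE//.
  by have := hd (x - z) xd; rewrite (addrC z) subrK.
have Sz : S z by case: zDS => // /unit_diskE; rewrite ltNge z1.
have FS y : S y -> F y = l y.
  by move=> /SC; rewrite /unit_circle/= normE => -[y1]; exact: Fl.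
have e2 : 0 < e / 2 by lra.
have [d d0 hd] := lP z Sz _ e2; exists d => // x xDS xz.
rewrite (FS z)//; have [x1|x1] := ltP (nm x) 1.
  by rewrite FE//; have := hd x x1 xz; lra.
have Sx : S x by case: xDS => // /unit_diskE; rewrite ltNge x1.
have [d' d'0 hd'] := lP x Sx _ e2.
have x1' : nm x = 1 by have := SC _ Sx; rewrite /unit_circle/= normE => -[].
(* The second bound keeps [y] within [d] of [z], so that [y] compares with both limits [l x] and
   [l z]. *)
have [|y y1 yx] := @circle_approx x (Num.min d' (d - nm (x - z))) x1'.
  by rewrite lt_min d'0 subr_gt0.
move: yx; rewrite lt_min => /andP[yd' yd].
rewrite FS//; have := hd' y y1 yd'; have := hd y y1.
have := nm_tri y x z; have := nm_tri (l x) (h y) (l z).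
rewrite (nm_distC (l x) (h y)) => h1 h2 h3 h4.
have {}h3 := h3 ltac:(lra); lra.
Qed.

Lemma integrated_AP n (S : set C) f : S `<=` unit_circle ->
  integrated n (A_ S) f <-> [/\ hol f, bddn n f &
    forall j s, (j <= n)%N -> S s -> cauchy_at (derive1n j f) s].
Proof.
move=> SC; split.
  move=> [/holomorphicP fh fA].
  have fH : integrated n Hoo f by split; [exact/holomorphicP|move=> j /fA[]].
  have [_ fb] := (integrated_HooP n f).1 fH; split=> // j s jn.
  have [_ fe] := fA j jn.
  exact: (A_P complete_ell2 SC (hol_derive1n j complete_ell2 fh)).1 fe s.
move=> [fh fb fS]; have [_ fH] := (integrated_HooP n f).2 (conj fh fb).
split; first exact/holomorphicP.
move=> j jn; split; first exact: fH.
apply: (A_P complete_ell2 SC (hol_derive1n j complete_ell2 fh)).2 => s.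
exact: fS.
Qed.

Lemma sup_norm_ge0 f : (0 <= sup_norm f)%E.
Proof.
apply: (@le_trans _ _ (l2norm (f 0))%:E); first by rewrite lee_fin l2norm_ge0.
by apply: ereal_sup_ubound; exists 0 => //; apply/unit_diskE; rewrite nm0.
Qed.

Lemma Cn_norm_le n f (M : nat -> R) (B : R) :
  (forall j z, (j <= n)%N -> nm z < 1 -> nm (derive1n j f z) <= M j) ->
  \sum_(j < n.+1) M j / j`!%:R <= B -> (Cn_norm n f <= B%:E)%E.
Proof.
move=> fM MB; apply: (@le_trans _ _ (\sum_(j < n.+1) M j / j`!%:R)%:E); last first.
  by rewrite lee_fin.
rewrite /Cn_norm big_mkord -sumEFin; apply: lee_sum => j _.
rewrite mulrC EFinM; apply: lee_wpmul2l; first by rewrite lee_fin invr_ge0.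
apply: ge_ereal_sup => _ [z /unit_diskE z1 <-]; rewrite lee_fin -nm_l2.
by apply: fM => //; rewrite -ltnS.
Qed.

(** All terms are nonnegative and all weights positive, so a finite bound forces each supremum to be
    finite; the suprema, read in [R], serve as [M]. *)
Lemma le_Cn_norm n f (B : R) : (Cn_norm n f <= B%:E)%E -> exists M : nat -> R,
  [/\ forall j, 0 <= M j,
   forall j z, (j <= n)%N -> nm z < 1 -> nm (derive1n j f z) <= M j &
   \sum_(j < n.+1) M j / j`!%:R <= B].
Proof.
rewrite /Cn_norm big_mkord => fB.
have fj (j : 'I_n.+1) : sup_norm (derive1n j f) \is a fin_num.
  rewrite ge0_fin_numE ?sup_norm_ge0//; rewrite ltNge leye_eq; apply/negP => /eqP foo.
  move: fB; rewrite (bigD1 j)//= foo gt0_muley ?lte_fin ?invr_gt0 ?ltr0n ?fact_gt0//.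
  rewrite addye ?leye_eq//; apply/negP => /eqP h.
  have : (0 <= \sum_(i < n.+1 | i != j) (i`!%:R^-1 : R)%:E * sup_norm (derive1n i f))%E.
    apply: sume_ge0 => i _; apply: mule_ge0; last exact: sup_norm_ge0.
    by rewrite lee_fin invr_ge0.
  by rewrite h.
exists (fun j => fine (sup_norm (derive1n j f))); split.
- by move=> j; rewrite fine_ge0// sup_norm_ge0.
- move=> j z jn z1; rewrite -lee_fin (fineK (fj (Ordinal (jn : (j < n.+1)%N))))//.
  by apply: ereal_sup_ubound; exists z => //; exact/unit_diskE.
- rewrite -lee_fin -sumEFin; apply: le_trans fB.
  by apply: lee_sum => j _; rewrite mulrC EFinM (fineK (fj j)).
Qed.

Lemma Cn_norm_ge0 n f : (0 <= Cn_norm n f)%E.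
Proof.
apply: sume_ge0 => j _; apply: mule_ge0; last exact: sup_norm_ge0.
by rewrite lee_fin invr_ge0.
Qed.

End Bridges.

(** * From A_S to bounded functions *)

Section NormalFamilies.
Context {R : realType}.
Local Notation C := (C R).
Local Notation l2 := (ell2 R).
Implicit Types (z w c : C) (f g h : C -> l2).

Lemma derive1n_equibounded (g : nat -> C -> l2) (B : R) : (forall m, hol (g m)) ->
  (forall m z, nm z < 1 -> nm (g m z) <= B) ->
  forall j (r : R), r < 1 -> exists K, forall m z, nm z <= r -> nm (derive1n j (g m) z) <= K.
Proof.
move=> gh gB; elim=> [|j ih] r r1; first by exists B => m z zr; apply: gB; lra.
pose d := (1 - Num.max 0 r) / 2; have m1 : Num.max 0 r < 1 by rewrite gt_max ltr01.
have d0 : 0 < d by rewrite /d; lra.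
have rm : r <= Num.max 0 r by rewrite le_max lexx orbT.
have rd : r + d < 1 by rewrite /d; lra.
have [K hK] := ih _ rd; exists (32 * K / d) => m z zr.
have zd w : nm (w - z) <= d -> nm w <= r + d.
  by have := nmD (w - z) z; rewrite subrK; lra.
have gj := hol_derive1n j complete_ell2 (gh m).
apply: (@cauchy_estimate _ _ (derive1n j (g m)) z) => //.
- by move=> w /zd wd; exists (derive1n j.+1 (g m) w); apply: gj; lra.
- by move=> w /zd; exact: hK.
- by apply: gj; lra.
Qed.

(** Derivatives of every order have coordinatewise limits along the same ultrafilter. The Taylor
    bound holds with a constant independent of [m] and its balls are weakly closed, so the limit of
    order [j.+1] is the derivative of the limit of order [j]. *)
Lemma montel (U : set_system nat) (UU : UltraFilter U) (g : nat -> C -> l2) (B : R) :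
  (forall m, hol (g m)) -> (forall m z, nm z < 1 -> nm (g m z) <= B) ->
  exists2 G : C -> l2, hol G & forall j z k, nm z < 1 ->
    vcv U (fun m => derive1n j (g m) z k) (derive1n j G z k).
Proof.
move=> gh gB; have UP : ProperFilter U by exact: ultra_proper.
have wl (a : nat * C) : exists v : l2, nm a.2 < 1 ->
    forall k, vcv U (fun m => derive1n a.1 (g m) a.2 k) (v k).
  case: a => j z /=; have [z1|z1] := ltP (nm z) 1; last by exists 0.
  have [K hK] := derive1n_equibounded gh gB j z1.
  by have [v _ hv] := ell2_weak_compact UU (fun m => hK m z (lexx _)); exists v.
have {wl}/choice[W WP] := wl.
pose G j z := W (j, z).
have GP j z k : nm z < 1 -> vcv U (fun m => derive1n j (g m) z k) (G j z k).
  by move=> z1; exact: (WP (j, z) z1 k).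
have Gd j z : nm z < 1 -> cd (G j) z (G j.+1 z).
  move=> z1; pose r := (1 - nm z) / 2; have r0 : 0 < r by rewrite /r; lra.
  have zr : nm z + r < 1 by rewrite /r; lra.
  have [K hK] := derive1n_equibounded gh gB j zr.
  have gj m := hol_derive1n j complete_ell2 (gh m).
  have gb m : cd_ball (derive1n j (g m)) z r by exact: hol_ball.
  have gK m w : nm (w - z) <= r -> nm (derive1n j (g m) w) <= K.
    by move=> wz; apply: hK; have := nmD (w - z) z; rewrite subrK; lra.
  set L := 2 ^+ 14 * K / r ^+ 2.
  have L0 : 0 <= L.
    have : 0 <= K by rewrite (le_trans (nm_ge0 _) (gK 0%N z _))// subrr nm0 ltW.
    by move=> h; rewrite divr_ge0 ?exprn_ge0 ?(ltW r0)// mulr_ge0.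
  move=> e e0; exists (Num.min (r / 4) (e / (1 + L))).
    by rewrite lt_min; apply/andP; split; [lra|apply: divr_gt0 => //; lra].
  move=> w; rewrite lt_min => /andP[w4]; rewrite ltr_pdivlMr; last by lra.
  move=> we; have w0 := nm_ge0 w.
  apply: (@le_trans _ _ (L * nm w ^+ 2)); last first.
    by rewrite expr2 mulrA ler_wpM2r//; move: we; rewrite mulrDr mulr1; lra.
  have zw1 : nm (z + w) < 1 by have := nmD z w; rewrite /r in w4; lra.
  apply: (@ell2_weak_lsc _ U _ (fun m => derive1n j (g m) (z + w) -
      derive1n j (g m) z - w *: derive1n j.+1 (g m) z)).
    move=> k; apply: vcvB; first by apply: vcvB; exact: GP.
    exact: (vcvZ w (GP j.+1 z k z1)).
  by apply: filterE => m; apply: (taylor2 r0 (gb m) (gK m)); exact: ltW.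
have GE j z : nm z < 1 -> derive1n j (G 0%N) z = G j z.
  move=> z1; apply: (@jets_unique _ _ _ G j) => //.
  by move=> i w _; exact: Gd.
exists (G 0%N).
  by apply: hol_intro => z z1; exists (G 1%N z); exact: Gd.
by move=> j z k z1; rewrite GE//; exact: GP.
Qed.

Lemma cvg_big_sum (F : set_system nat) {FF : Filter F} n (M : nat -> nat -> R) (l : nat -> R) :
  (forall j, (j < n)%N -> (fun m => M m j) @ F --> l j) ->
  (fun m => \sum_(j < n) M m j) @ F --> \sum_(j < n) l j.
Proof.
elim: n => [|n ih] Ml.
  rewrite big_ord0 (_ : (fun m => _) = fun=> 0); first exact: cvg_cst.
  by apply/funext => m; rewrite big_ord0.
rewrite big_ord_recr/= (_ : (fun m => _) = fun m => \sum_(j < n) M m j + M m n).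
  apply: cvgD; last exact: Ml.
  by apply: ih => j jn; apply: Ml; rewrite ltnW.
by apply/funext => m; rewrite big_ord_recr.
Qed.

(* Compactness: solutions for the dilations [f (r z)] with a uniform bound
   converge weakly to a solution for [f], and the norm is lower
   semicontinuous. *)
Lemma bezout_dilation_limit n f (r : nat -> R) (g : nat -> C -> l2) (B : R) :
  (forall m, 0 <= r m <= 1) -> (r @ \oo --> (1 : R)) -> hol f ->
  (forall m, hol (g m)) -> (forall m, Cn_norm n (g m) <= B%:E)%E ->
  (forall m z, nm z < 1 -> pair (g m z) (f ((r m)%:C%C * z)) = 1) ->
  exists G, [/\ hol G, bddn n G, (Cn_norm n G <= B%:E)%E &
    forall z, nm z < 1 -> pair (G z) (f z) = 1].
Proof.
move=> r01 r1 fh gh gB gf.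
have [U [UU ooU]] := exists_ultra_nat.
have UP : ProperFilter U by exact: ultra_proper.
have hM m := le_Cn_norm (gB m).
have [M MP] := choice hM.
have M0 m j : 0 <= M m j by have [] := MP m.
have Mg m j z : (j <= n)%N -> nm z < 1 -> nm (derive1n j (g m) z) <= M m j.
  by have [_ h _] := MP m; exact: h.
have MB m : \sum_(j < n.+1) M m j / j`!%:R <= B by have [] := MP m.
have Mj m j : (j <= n)%N -> `|M m j| <= B * j`!%:R.
  move=> jn; rewrite ger0_norm// -ler_pdivrMr ?ltr0n ?fact_gt0//.
  apply: le_trans (MB m); rewrite (bigD1 (Ordinal (jn : (j < n.+1)%N)))//=.
  by rewrite lerDl sumr_ge0// => i _; rewrite divr_ge0.
have /choice[Ml MlP] : forall j, exists l : R, (j <= n)%N -> (fun m => M m j) @ U --> l.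
  move=> j; have [jn|jn] := leqP j n; last by exists 0.
  by have [l hl] := ultra_cvg_real UU (fun m => Mj m j jn); exists l.
have g0B m z : nm z < 1 -> nm (g m z) <= B.
  move=> z1; apply: (le_trans (Mg m 0%N z (leq0n _) z1)).
  by have := Mj m 0%N (leq0n _); rewrite fact0 mulr1; apply: le_trans; rewrite ler_norm.
have [G Gh GP] := montel UU gh g0B.
have GM j z : (j <= n)%N -> nm z < 1 -> nm (derive1n j G z) <= Ml j.
  move=> jn z1; apply/ler_addgt0Pl => e e0.
  apply: (@ell2_weak_lsc _ U _ (fun m => derive1n j (g m) z)) => [k|]; first exact: GP.
  have /cvgrPdist_le/(_ _ e0) := MlP j jn; apply: filterS => m.
  by rewrite ler_norml => /andP[h _]; have := Mg m j z jn z1; lra.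
exists G; split=> //.
- by move=> j jn; exists (Ml j) => z; exact: GM.
- apply: (@Cn_norm_le _ n G Ml) => //.
  have h : (fun m => \sum_(j < n.+1) M m j / j`!%:R) @ U --> \sum_(j < n.+1) Ml j / j`!%:R.
    apply: (@cvg_big_sum U _ n.+1 (fun m j => M m j / j`!%:R) (fun j => Ml j / j`!%:R)).
    by move=> j jn; apply: cvgM; [exact: MlP|exact: cvg_cst].
  by apply: (cvgr_to_le h); apply: filterE => m; exact: MB.
move=> z z1; apply: (vcv_unique (F := \oo) (pair_cv (G z) (f z))).
have B0 : 0 <= B by rewrite (le_trans (nm_ge0 _) (g0B 0%N z z1)).
apply/vcv_ooP => e e0.
(* Two errors are paired with [g m z], of norm at most [B]: the tail of [f z] and the displacement
   of [f] by the dilation. Each may cost [e / 2]. *)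
have e1 : 0 < e / (2 * (1 + B)) by rewrite divr_gt0// mulr_gt0//; lra.
have Be : B * (e / (2 * (1 + B))) <= e / 2.
  have -> : e / 2 = (1 + B) * (e / (2 * (1 + B))) by field; rewrite lt0r_neq0//; lra.
  by rewrite ler_wpM2r ?(ltW e1)//; lra.
have [N0 tP] := ell2_tail_small (f z) e1; exists N0 => N N0N.
have [t te tE] := tP N N0N.
(* Only finitely many coordinates enter the truncated pairing, so coordinatewise convergence is
   enough. *)
have partial_lim : vcv U (fun m => series (fun k => g m z k * f z k) N)
    (series (fun k => G z k * f z k) N).
  rewrite /series/=; elim: N {N0N tE} => [|N ih].
    rewrite big_geq// (_ : (fun m => _) = fun=> 0); first exact: vcv_cst.
    by apply/funext => m; rewrite big_geq.
  rewrite big_nat_recr//= (_ : (fun m => _) = fun m =>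
      \sum_(0 <= k < N) g m z k * f z k + g m z N * f z N); last first.
    by apply/funext => m; rewrite big_nat_recr.
  apply: vcvD => //; rewrite mulrC.
  rewrite (_ : (fun m => _) = fun m => f z N *: (g m z N : C)).
    by apply: vcvZ; exact: (GP 0%N z N z1).
  by apply/funext => m; rewrite mulrC.
apply: (vcv_le (vcvB partial_lim (vcv_cst (1 : C)))).
have [s s0 fs] := cd_cont (fh z z1) e1.
have /cvgrPdist_lt/(_ _ s0) r1s := r1.
apply: filterS (ooU _ r1s) => m; rewrite distrC => rms.
rewrite tE -(gf m z z1).
have -> : pair (g m z) (f z) - pair (g m z) t - pair (g m z) (f ((r m)%:C%C * z)) =
  - (pair (g m z) (f ((r m)%:C%C * z) - f z) + pair (g m z) t).
  have key (x y u : C) : x - y - u = - (u - x + y) by ring.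
  by rewrite pairBr; exact: key.
rewrite nmN; apply: (le_trans (nmD _ _)).
have h1 := pair_le (g m z) t.
have h2 := pair_le (g m z) (f ((r m)%:C%C * z) - f z).
have h3 : nm (f ((r m)%:C%C * z) - f z) <= e / (2 * (1 + B)).
  have -> : (r m)%:C%C * z = z + (r m - 1)%:C%C * z by rewrite rmorphB/=; ring.
  apply: fs; rewrite nmM nm_real (le_lt_trans _ rms)// ler_piMr//; exact: ltW.
have gz := g0B m z z1.
have h4 : nm (g m z) * nm t <= B * (e / (2 * (1 + B))) by rewrite ler_pM ?nm_ge0.
have h5 : nm (g m z) * nm (f ((r m)%:C%C * z) - f z) <= B * (e / (2 * (1 + B))).
  by rewrite ler_pM ?nm_ge0.
rewrite [leRHS]splitr.
exact: (lerD (le_trans (le_trans h2 h5) Be) (le_trans (le_trans h1 h4) Be)).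
Qed.

End NormalFamilies.

Section DirectionA.
Context {R : realType}.
Local Notation C := (C R).
Local Notation l2 := (ell2 R).

(** A dilation by [r < 1] keeps the lower bound [delta], multiplies the derivative of order [j] by
    [r ^+ j <= 1], and reads [f] on a smaller disc, where all its derivatives are Lipschitz; it is
    therefore a datum for every [S]. *)
Lemma bezout_const_Hoo_le (S : set C) n (delta : R) : open_in_circle S ->
  (bezout_const n (integrated n Hoo) delta <=
   bezout_const n (integrated n (A_ S)) delta)%E.
Proof.
move=> [W _ SW]; have SC : S `<=` unit_circle by rewrite SW => x [].
apply: ge_ereal_sup => _ [f [/integrated_HooP[fh fb] fn fd] <-].
have [Mf [Mf0 MfP MfS]] := le_Cn_norm fn.
have fs := smooth_hol complete_ell2 fh.
pose fr (r : R) (z : C) : l2 := f ((r%:C%C : C) * z).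
have data r : 0 <= r -> r < 1 -> bezout_data n (integrated n (A_ S)) delta (fr r).
  move=> r0 r1; have rE : nm (r%:C%C : C) = r by rewrite nm_real ger0_norm.
  have rle : nm (r%:C%C : C) <= 1 by rewrite rE ltW.
  have [frs frE] := smooth_dilate rle fs.
  have rz (z : C) : nm z < 1 -> nm ((r%:C%C : C) * z) < 1.
    by move=> z1; rewrite nmM rE (le_lt_trans _ z1)// ler_piMl ?nm_ge0 ?ltW.
  have rz' (z : C) : nm z < 1 -> nm ((r%:C%C : C) * z) <= r.
    by move=> z1; rewrite nmM rE ler_piMr// ltW.
  have frM j z : (j <= n)%N -> nm z < 1 -> nm (derive1n j (fr r) z) <= Mf j.
    move=> jn z1; rewrite frE// nmZ nmX rE.
    apply: (@le_trans _ _ (1 * nm (derive1n j f ((r%:C%C : C) * z)))).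
      by rewrite ler_wpM2r ?nm_ge0// exprn_ile1// ltW.
    by rewrite mul1r; apply: MfP => //; exact: rz.
  split.
  - apply/(integrated_AP n (fr r) SC); split; first exact: (frs 0%N).
      by move=> j jn; exists (Mf j) => z; exact: frM.
    move=> j s jn Ss e e0.
    have [K K0 hK] := hol_locally_lipschitz complete_ell2 (fs j) r1.
    have K1 : 0 < 2 * (1 + K) by lra.
    exists (e / (2 * (1 + K))); first exact: divr_gt0.
    move=> x y x1 y1; rewrite !ltr_pdivlMr// => xs ys.
    rewrite !frE// -scalerBr nmZ nmX rE.
    have := hK _ _ (rz' _ y1) (rz' _ x1); rewrite -mulrBr nmM rE.
    set D := nm (_ - _) => hD.
    have D0 : 0 <= D by exact: nm_ge0.
    apply: (@le_trans _ _ D).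
      by rewrite ler_piMl// exprn_ile1// ltW.
    apply: (le_trans hD); apply: (@le_trans _ _ (K * nm (x - y))).
      by rewrite ler_wpM2l// ler_piMl ?nm_ge0// ltW.
    have xy := nm_tri x s y; rewrite (nm_distC s y) in xy.
    apply: (@le_trans _ _ ((1 + K) * (nm (x - s) + nm (y - s)))).
      by apply: ler_pM; rewrite ?nm_ge0//; lra.
    by move: xs ys; rewrite !mulrDr !mulrDl; lra.
  - by apply: Cn_norm_le MfS => j z; exact: frM.
  - by move=> z /unit_diskE z1; apply: fd; apply/unit_diskE; exact: rz.
set c := bezout_const n (integrated n (A_ S)) delta.
have cost_le r : 0 <= r -> r < 1 -> (bezout_cost n (integrated n (A_ S)) (fr r) <= c)%E.
  by move=> r0 r1; apply: ereal_sup_ubound; exists (fr r) => //; exact: data.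
(* The dilation by 0 is a datum, so the supremum is not the value [-oo] of an empty family. *)
have c0 : (0 <= c)%E.
  apply: le_trans (cost_le 0 (lexx _) ltr01).
  by apply: le_ereal_inf_tmp => _ [g _ <-]; exact: Cn_norm_ge0.
case cE : c => [b| |]; last 2 first.
- by rewrite leey.
- by move: c0; rewrite cE.
apply/lee_addgt0Pr => eta eta0.
pose r (m : nat) : R := 1 - 1 / 2 ^+ m.
have r01 m : 0 <= r m < 1.
  rewrite /r; have p0 : 0 < 1 / 2 ^+ m :> R by rewrite divr_gt0// exprn_gt0.
  have : 1 / 2 ^+ m <= 1 :> R by rewrite ler_pdivrMr ?exprn_gt0// mul1r exprn_ege1// ler1n.
  by move=> h; apply/andP; split; lra.
have r1 : r @ \oo --> (1 : R).
  apply/cvgrPdist_le => e e0; have [N hN] := half_expn_small (1 : R) e0.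
  exists N => // m Nm; rewrite /r opprB addrC subrK ger0_norm ?divr_ge0 ?exprn_ge0//.
  apply: le_trans hN; rewrite ler_pM2l// lef_pV2 ?posrE ?exprn_gt0//.
  by rewrite ler_eXn2l// ltr1n.
have /choice[g gP] : forall m, exists g : C -> l2, [/\ hol g,
    (Cn_norm n g <= (b + eta)%:E)%E &
    forall z, nm z < 1 -> pair (g z) (fr (r m) z) = 1].
  move=> m; have /andP[rm0 rm1] := r01 m.
  have := cost_le _ rm0 rm1; rewrite cE => le.
  have : (bezout_cost n (integrated n (A_ S)) (fr (r m)) < (b + eta)%:E)%E.
    by apply: (le_lt_trans le); rewrite lte_fin ltrDl.
  move=> /ereal_inf_lt[_ [g [gA /bezout_solutionP gf] <-] gn].
  exists g; split; last by move=> z /unit_diskE; exact: gf.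
    by have [] := (integrated_AP n g SC).1 gA.
  exact: ltW.
have [||||||G [Gh Gb Gn Gf]] := @bezout_dilation_limit _ n f r g (b + eta).
- by move=> m; have /andP[-> /ltW ->] := r01 m.
- exact: r1.
- exact: fh.
- by move=> m; have [] := gP m.
- by move=> m; have [] := gP m.
- by move=> m; have [_ _] := gP m.
apply: le_trans Gn; apply: ereal_inf_lbound; exists G => //; split.
  exact/integrated_HooP.
by apply/bezout_solutionP => z /unit_diskE; exact: Gf.
Qed.

End DirectionA.

(** * Multipliers of n-th derivatives *)

Section Multipliers.
Context {R : realType}.
Local Notation C := (C R).
Local Notation l2 := (ell2 R).
Implicit Types (V : normedModType C) (x y z w c : C) (f g h : C -> l2).

Definition bdd V (h : C -> V) := exists M : R, forall z, nm z < 1 -> nm (h z) <= M.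

(* Equivalently, [h] extends continuously to the closed disk. *)
Definition uc V (h : C -> V) := forall e : R, 0 < e -> exists2 d : R, 0 < d &
  forall x y, nm x < 1 -> nm y < 1 -> nm (x - y) < d -> nm (h x - h y) <= e.

Lemma bddD V (h k : C -> V) : bdd h -> bdd k -> bdd (fun z => h z + k z).
Proof.
move=> [M hM] [K kK]; exists (M + K) => z z1; apply: (le_trans (nmD _ _)).
by rewrite lerD ?hM ?kK.
Qed.

Lemma bddN V (h : C -> V) : bdd h -> bdd (fun z => - h z).
Proof. by move=> [M hM]; exists M => z z1; rewrite nmN hM. Qed.

Lemma bddZ V (a : C -> C) (h : C -> V) : bdd a -> bdd h -> bdd (fun z => a z *: h z).
Proof.
move=> [M hM] [K kK]; exists (M * K) => z z1.
by rewrite nmZ ler_pM ?nm_ge0 ?hM ?kK.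
Qed.

Lemma bdd_cst V (v : V) : bdd (fun=> v).
Proof. by exists (nm v). Qed.

Lemma bdd_id : bdd (fun z : C => z).
Proof. by exists 1 => z /ltW. Qed.

Lemma eq_uc V (h k : C -> V) : (forall z, nm z < 1 -> h z = k z) -> uc h -> uc k.
Proof.
move=> hk hu e /hu[d d0 hd]; exists d => // x y x1 y1 xy.
by rewrite -!hk//; exact: hd.
Qed.

Lemma ucD V (h k : C -> V) : uc h -> uc k -> uc (fun z => h z + k z).
Proof.
move=> hu ku e e0; have e2 : 0 < e / 2 by lra.
have [d d0 hd] := hu _ e2; have [d' d'0 kd] := ku _ e2.
exists (Num.min d d'); first by rewrite lt_min d0.
move=> x y x1 y1; rewrite lt_min => /andP[xd xd'].
rewrite opprD addrACA; apply: (le_trans (nmD _ _)).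
by have := hd x y x1 y1 xd; have := kd x y x1 y1 xd'; lra.
Qed.

Lemma ucN V (h : C -> V) : uc h -> uc (fun z => - h z).
Proof.
move=> hu e /hu[d d0 hd]; exists d => // x y x1 y1 xy.
by rewrite -opprD nmN; exact: hd.
Qed.

Lemma uc_lip V (h : C -> V) (K : R) :
  (forall x y, nm x < 1 -> nm y < 1 -> nm (h x - h y) <= K * nm (x - y)) -> uc h.
Proof.
move=> hK e e0; have K0 : 0 < 1 + `|K| by rewrite ltr_pwDl.
exists (e / (1 + `|K|)); first exact: divr_gt0.
move=> x y x1 y1; rewrite ltr_pdivlMr// => xy; apply: (le_trans (hK x y x1 y1)).
apply: (@le_trans _ _ (nm (x - y) * (1 + `|K|))); last exact: ltW.
by rewrite mulrC ler_wpM2l ?nm_ge0//; have := ler_norm K; lra.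
Qed.

Lemma uc_cst V (v : V) : uc (fun=> v).
Proof. by apply: (@uc_lip _ _ 0) => x y _ _; rewrite subrr nm0 mul0r. Qed.

Lemma uc_id : uc (fun z : C => z).
Proof. by apply: (@uc_lip _ _ 1) => x y _ _; rewrite mul1r. Qed.

Lemma ucZ V (a : C -> C) (h : C -> V) : bdd a -> uc a -> bdd h -> uc h ->
  uc (fun z => a z *: h z).
Proof.
move=> [M aM] au [K hK] hu e e0.
have M0 : 0 <= M by rewrite (le_trans (nm_ge0 _) (aM 0 _))// nm0.
have K0 : 0 <= K by rewrite (le_trans (nm_ge0 _) (hK 0 _))// nm0.
have eM : 0 < e / (2 * (1 + M)) by rewrite divr_gt0// mulr_gt0//; lra.
have eK : 0 < e / (2 * (1 + K)) by rewrite divr_gt0// mulr_gt0//; lra.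
have [d d0 hd] := hu _ eM; have [d' d'0 ad] := au _ eK.
exists (Num.min d d'); first by rewrite lt_min d0.
move=> x y x1 y1; rewrite lt_min => /andP[xd xd'].
have -> : a x *: h x - a y *: h y = a x *: (h x - h y) + (a x - a y) *: h y.
  by module_ (Defs.C R) V.
apply: (le_trans (nmD _ _)); rewrite !nmZ.
have h1 : nm (a x) * nm (h x - h y) <= (1 + M) * (e / (2 * (1 + M))).
  by apply: ler_pM; rewrite ?nm_ge0 ?hd//; have := aM x x1; lra.
have h2 : nm (a x - a y) * nm (h y) <= (e / (2 * (1 + K))) * (1 + K).
  by apply: ler_pM; rewrite ?nm_ge0 ?ad//; have := hK y y1; lra.
have e1 : (1 + M) * (e / (2 * (1 + M))) = e / 2 by field; rewrite lt0r_neq0//; lra.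
have e2 : (e / (2 * (1 + K))) * (1 + K) = e / 2 by field; rewrite lt0r_neq0//; lra.
by move: h1 h2; rewrite e1 e2; lra.
Qed.

(** Near the circle both values are small; elsewhere both points lie in a smaller disc, where [h] is
    Lipschitz. *)
Lemma uc_vanish V (h : C -> V) :
  (forall r : R, r < 1 -> exists2 K : R, 0 <= K & forall x y, nm x <= r -> nm y <= r ->
     nm (h x - h y) <= K * nm (x - y)) ->
  (forall e : R, 0 < e -> exists2 r : R, r < 1 & forall z, nm z < 1 -> r < nm z -> nm (h z) <= e) ->
  uc h.
Proof.
move=> hL hv e e0; have e2 : 0 < e / 2 by lra.
have [r r1 hr] := hv _ e2; have r1' : (1 + r) / 2 < 1 by lra.
have [K K0 hK] := hL _ r1'.
exists (Num.min ((1 - r) / 2) (e / (1 + K))).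
  by rewrite lt_min; apply/andP; split; [lra|apply: divr_gt0 => //; lra].
move=> x y x1 y1; rewrite lt_min => /andP[xy]; rewrite ltr_pdivlMr; last by lra.
move=> xye; have xy0 := nm_ge0 (x - y).
have L : nm x <= (1 + r) / 2 -> nm y <= (1 + r) / 2 -> nm (h x - h y) <= e.
  by move=> xr yr; have := hK x y xr yr; move: xye; rewrite mulrDr mulr1; lra.
have h1 := nmD (x - y) y; have h2 := nmD (y - x) x.
rewrite subrK in h1; rewrite subrK nm_distC in h2.
have [xr|xr] := leP (nm x) r; first by apply: L; lra.
have [yr|yr] := leP (nm y) r; first by apply: L; lra.
have := hr x x1 xr; have := hr y y1 yr; have := nmB (h x) (h y); lra.
Qed.

(** Away from 0 division by [z] is harmless, and near 0 the Lipschitz bound on a smaller disc takes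
    over. *)
Lemma uc_unshift V (h : C -> V) : bdd h -> uc (fun z => z *: h z) ->
  (forall r : R, r < 1 -> exists2 K : R, 0 <= K & forall x y, nm x <= r -> nm y <= r ->
     nm (h x - h y) <= K * nm (x - y)) -> uc h.
Proof.
move=> [M hM] zu hL e e0.
have M0 : 0 <= M by rewrite (le_trans (nm_ge0 _) (hM 0 _))// nm0.
have [K K0 hK] := hL (3 / 4) ltac:(lra).
have e4 : 0 < e / 4 by lra.
have [d d0 hd] := zu _ e4.
(* The bound [1 / 4] puts both points in the disc of radius [3 / 4] as soon as [nm x <= 1 / 2].
   Otherwise [x *: (h x - h y)] is at most [e / 4 + e / 4], and dividing by [nm x > 1 / 2] gives
   [e]. *)
exists (Num.min d (Num.min (1 / 4) (Num.min (e / (1 + K)) (e / (4 * (1 + M)))))).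
  rewrite !lt_min d0/=; apply/and3P; split; first lra.
    by apply: divr_gt0 => //; lra.
  by apply: divr_gt0 => //; apply: mulr_gt0 => //; lra.
move=> x y x1 y1; rewrite !lt_min => /and4P[xd x4].
have K1 : 0 < 1 + K by lra.
have M1 : 0 < 4 * (1 + M) by lra.
rewrite !ltr_pdivlMr//.
move=> xK xM; have xy0 := nm_ge0 (x - y).
have L : nm x <= 3 / 4 -> nm y <= 3 / 4 -> nm (h x - h y) <= e.
  by move=> xr yr; have := hK x y xr yr; move: xK; rewrite mulrDr mulr1; lra.
have h1 := nmD (x - y) y; have h2 := nmD (y - x) x.
rewrite subrK in h1; rewrite subrK nm_distC in h2.
have [xr|xr] := leP (nm x) (1 / 2); first by apply: L; lra.
have hxy := hd x y x1 y1 xd.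
have E : x *: (h x - h y) = (x *: h x - y *: h y) - (x - y) *: h y.
  by module_ (Defs.C R) V.
have := congr1 nm E; rewrite nmZ => {}E.
have := nmB (x *: h x - y *: h y) ((x - y) *: h y); rewrite -E nmZ => h3.
have h4 : nm (x - y) * nm (h y) <= nm (x - y) * M by rewrite ler_wpM2l// hM.
have h5 : nm (x - y) * M <= e / 4 by move: xM; rewrite !mulrDr; lra.
have h6 : 1 / 2 * nm (h x - h y) <= nm x * nm (h x - h y).
  by rewrite ler_wpM2r ?nm_ge0// ltW.
by move: h3 h4 h5 h6 hxy; lra.
Qed.

(* Multiplication by [psi] preserves n-th derivatives modulo functions which are
   continuous up to the whole circle. *)
Definition mult n (psi : C -> C) := [/\ bdd psi, uc psi &
  forall g, hol g -> bddn n g -> exists G, [/\ hol G, bddn n G &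
    uc (fun z => derive1n n G z - psi z *: derive1n n g z)]].

Lemma mult_ext n (psi phi : C -> C) :
  (forall z, nm z < 1 -> psi z = phi z) -> mult n psi -> mult n phi.
Proof.
move=> pp [[M psiM] psiu psiG]; split.
- by exists M => z z1; rewrite -pp// psiM.
- exact: eq_uc psiu.
- move=> g gh gb; have [G [Gh Gb Gu]] := psiG g gh gb.
  exists G; split; [exact: Gh|exact: Gb|].
  apply: (@eq_uc _ (fun z => derive1n n G z - psi z *: derive1n n g z) _ _ Gu) => z z1.
  by rewrite pp.
Qed.

Lemma mult_cst n (a : C) : mult n (fun=> a).
Proof.
split; [exact: bdd_cst|exact: uc_cst|move=> g gh gb].
have [as_ aE] := smoothcZ a (smooth_hol complete_ell2 gh).
exists (fun z => a *: g z); split; first exact: (as_ 0%N).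
  move=> j jn; have [M gM] := gb j jn; exists (nm a * M) => z z1.
  by rewrite aE// nmZ ler_wpM2l ?nm_ge0// gM.
by apply: (eq_uc _ (uc_cst (0 : l2))) => z z1; rewrite aE// subrr.
Qed.

Lemma multD n (psi phi : C -> C) : mult n psi -> mult n phi ->
  mult n (fun z => psi z + phi z).
Proof.
move=> [pb pu pG] [qb qu qG]; split; [exact: bddD|exact: ucD|move=> g gh gb].
have [G [Gh Gb Gu]] := pG g gh gb; have [H [Hh Hb Hu]] := qG g gh gb.
have [GHs GHE] := smoothD (smooth_hol complete_ell2 Gh) (smooth_hol complete_ell2 Hh).
exists (fun z => G z + H z); split; first exact: (GHs 0%N).
  move=> j jn; have [M GM] := Gb j jn; have [K HK] := Hb j jn; exists (M + K) => z z1.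
  by rewrite (GHE j z z1); apply: (le_trans (nmD _ _)); apply: lerD; [exact: GM|exact: HK].
by apply: (eq_uc _ (ucD Gu Hu)) => z z1; rewrite GHE//; module_ (Defs.C R) (ell2 R).
Qed.

(** Apply [phi] to [g], then [psi] to the result [G]: the new error is that of [psi] plus [psi]
    times that of [phi], again uniformly continuous. *)
Lemma multM n (psi phi : C -> C) : mult n psi -> mult n phi ->
  mult n (fun z => psi z * phi z).
Proof.
move=> [pb pu pG] [qb qu qG]; split; [exact: bddZ|exact: (ucZ pb pu qb qu)|].
move=> g gh gb; have [G [Gh Gb Gu]] := qG g gh gb.
have [H [Hh Hb Hu]] := pG G Gh Gb; exists H; split; [exact: Hh|exact: Hb|].
have Gub : bdd (fun z => derive1n n G z - phi z *: derive1n n g z).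
  exact: bddD (Gb n (leqnn n)) (bddN (bddZ qb (gb n (leqnn n)))).
apply: (eq_uc _ (ucD Hu (ucZ pb pu Gub Gu))) => z z1.
by rewrite -scalerA; module_ (Defs.C R) (ell2 R).
Qed.

(** Two terms of the Leibniz formula survive; at [j = 0] the factor [j] erases the one with the
    truncated [j.-1]. *)
Lemma shift_jets g : hol g -> smooth (fun z => z *: g z) /\ forall j z, nm z < 1 ->
  derive1n j (fun z => z *: g z) z = z *: derive1n j g z + derive1n j.-1 g z *+ j.
Proof.
move=> gh; have gs := smooth_hol complete_ell2 gh.
pose F j z := z *: derive1n j g z + derive1n j.-1 g z *+ j.
have FS j z : nm z < 1 -> cd (F j) z (F j.+1 z).
  move=> z1; have h0 : cd (derive1n j g) z (derive1n j.+1 g z) := gs j z z1.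
  have h2 : cd (fun w => derive1n j.-1 g w *+ j) z (derive1n j g z *+ j).
    case: j {h0} => [|j]; last by apply: cdMn; exact: gs.
    by rewrite mulr0n; exact: cd_cst.
  have -> : F j.+1 z = 1 *: derive1n j g z + z *: derive1n j.+1 g z + derive1n j g z *+ j.
    by rewrite /F -[j.+1.-1]/j mulrS; module_ (Defs.C R) (ell2 R).
  exact: cdD (cdZ (cd_id z) h0) h2.
have E j z : nm z < 1 -> derive1n j (fun z => z *: g z) z = F j z.
  move=> z1; apply: (@jets_unique _ _ _ F j) => //.
    by move=> w _; rewrite /F mulr0n addr0.
  by move=> k w _; exact: FS.
split; last exact: E.
move=> j; apply: (@hol_local _ _ (F j)); first by move=> z z1; rewrite E.
by apply: hol_intro => z z1; exists (F j.+1 z); exact: FS.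
Qed.

(** A bounded next derivative gives a Lipschitz bound on the disk. For this reason only the
    derivative of highest order can fail to extend to the circle. *)
Lemma bddn_lip n g : hol g -> bddn n.+1 g -> uc (derive1n n g).
Proof.
move=> gh gb; have [M gM] := gb n.+1 (leqnn _); apply: (@uc_lip _ _ M) => x y x1 y1.
by apply: (disk_lipschitz (hol_derive1n n complete_ell2 gh)).
Qed.

(** The n-th derivative of [z *: g] differs from [z] times that of [g] by [n] times a derivative of
    order [n - 1], which is Lipschitz. *)
Lemma mult_id n : mult n (fun z => z).
Proof.
split; [exact: bdd_id|exact: uc_id|move=> g gh gb].
have [ss sE] := shift_jets gh.
exists (fun z => z *: g z); split; first exact: (ss 0%N).
  move=> j jn; have [M gM] := gb j jn.
  have [K gK] := gb j.-1 (leq_trans (leq_pred _) jn).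
  exists (M + K *+ j) => z z1; rewrite sE//.
  apply: (le_trans (nmD _ _)); apply: lerD; last first.
    by rewrite nmMn lerMn2r gK ?orbT.
  rewrite nmZ; apply: le_trans (gM z z1); rewrite ler_piMl ?nm_ge0//; exact: ltW.
case: n gb => [|n] gb.
  apply: (eq_uc _ (uc_cst (0 : l2))) => z z1.
  by rewrite sE// mulr0n addr0 subrr.
have h := bddn_lip gh gb.
have h' := ucZ (bdd_cst (n.+1%:R : C)) (uc_cst (n.+1%:R : C)) (gb n (leqnSn _)) h.
by apply: (eq_uc _ h') => z z1; rewrite sE// addrC addKr scaler_nat.
Qed.

Definition bshift g z : l2 := if z == 0 then derive1 g 0 else z^-1 *: (g z - g 0).

Lemma bshiftE g z : z *: bshift g z = g z - g 0.
Proof.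
rewrite /bshift; have [->|z0] := eqVneq z 0; first by rewrite scale0r subrr.
by rewrite scalerA mulfV// scale1r.
Qed.

(** Only the point 0 requires work, with derivative g''(0) / 2: the mean value bound applies to the
    second-order remainder [k] of [g], whose derivative is the first-order remainder of g'. *)
Lemma hol_bshift g : hol g -> hol (bshift g).
Proof.
move=> gh; apply: hol_intro => z z1; have [->|z0] := eqVneq z 0; last first.
  have h := cdZ (cdV z0 (cd_id z)) (cdB (gh z z1) (cd_cst (g 0) z)).
  eexists; apply: (@cd_local _ _ _ _ _ _ (nm z) _ _ h); first exact: nm_gt0.
  move=> w wz; rewrite /bshift; case: eqP => // zw0; move: wz.
  have -> : w = - z by apply/eqP; rewrite -addr_eq0 addrC zw0.
  by rewrite nmN ltxx.
have zz : nm (0 : C) < 1 by rewrite nm0.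
exists (2^-1 *: derive1 (derive1 g) 0) => e e0.
have g2 := hol_derive complete_ell2 gh.
have [r r0 hr] := g2 0 zz e e0.
exists (Num.min r 1); first by rewrite lt_min r0 ltr01.
move=> w; rewrite lt_min add0r => /andP[wr w1].
have [->|w0] := eqVneq w 0; first by rewrite subrr scale0r subr0 !nm0 mulr0.
have ww := nm_gt0 w0.
rewrite /bshift eqxx (negbTE w0) -(ler_pM2l ww) -nmZ.
pose k z := g z - z *: derive1 g 0 - (z * z) *: (2^-1 *: derive1 (derive1 g) 0).
have -> : w *: (w^-1 *: (g w - g 0) - derive1 g 0 - w *: (2^-1 *: derive1 (derive1 g) 0)) =
  k w - k 0.
  by rewrite /k; module_over (Defs.C R) (ell2 R); repeat split; field.
have -> : nm w * (e * nm w) = e * nm w * nm (w - 0) by rewrite subr0; ring.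
apply: (@mean_value_bound _ _ k 0 (nm w)); rewrite ?subrr ?nm0 ?nm_ge0 ?subr0//.
move=> y; rewrite subr0 => yw; have y1 : nm y < 1 by lra.
exists (derive1 g y - derive1 g 0 - y *: derive1 (derive1 g) 0).
  have c1 := cdZ (cd_id y) (cd_cst (derive1 g 0) y).
  have c2 := cdZ (cdM (cd_id y) (cd_id y)) (cd_cst (2^-1 *: derive1 (derive1 g) 0) y).
  have := cdB (cdB (gh y y1) c1) c2; rewrite /k.
  congr (cd _ _ _); module_over (Defs.C R) (ell2 R); repeat split; by field.
have := hr y; rewrite add0r => h; apply: (le_trans (h _)); first by lra.
by rewrite ler_pM2l.
Qed.

Lemma derive1n_subcst g v j z : hol g -> nm z < 1 ->
  derive1n j (fun z => g z - v) z = derive1n j g z - (if j is 0 then v else 0).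
Proof.
move=> gh z1; pose F j z : l2 := derive1n j g z - (if j is 0 then v else 0).
apply: (@jets_unique _ _ _ F j) => // k w _ w1.
rewrite /F subr0 -[X in cd _ _ X]subr0; apply: cdB; last exact: cd_cst.
exact: (hol_derive1n k complete_ell2 gh).
Qed.

Lemma bshift_jets g j z : hol g -> nm z < 1 ->
  z *: derive1n j (bshift g) z =
    derive1n j g z - (if j is 0 then g 0 else 0) - derive1n j.-1 (bshift g) z *+ j.
Proof.
move=> gh z1; have [_ E] := shift_jets (hol_bshift gh).
rewrite -derive1n_subcst// -(funext (bshiftE g)) E//.
by rewrite addrK.
Qed.

(** For [nm z > 1 / 2] the formula [bshift_jets] determines the derivative of order [j] from lower
    ones at the cost of a factor 2; on the smaller disc local boundedness suffices. *)
Lemma bddn_bshift n g : hol g -> bddn n g -> bddn n (bshift g).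
Proof.
move=> gh gb; have bh := hol_bshift gh.
have step j : (j <= n)%N -> bdd (fun z => derive1n j.-1 (bshift g) z *+ j) ->
    bdd (derive1n j (bshift g)).
  move=> jn [P hP]; have [M gM] := gb j jn.
  have r1 : (1 / 2 : R) < 1 by lra.
  have [K bK] := hol_locally_bounded (hol_derive1n j complete_ell2 bh) r1.
  exists (Num.max K (2 * (M + nm (g 0) + P))) => z z1; rewrite le_max.
  have [zr|zr] := leP (nm z) (1 / 2); first by rewrite bK.
  apply/orP; right; set q := derive1n j (bshift g) z.
  have h1 : nm (z *: q) <= M + nm (g 0) + P.
    rewrite bshift_jets//; apply: (le_trans (nmB _ _)); apply: lerD; last exact: hP.
    apply: (le_trans (nmB _ _)); apply: lerD; first exact: gM.
    by case: (j) => // _; rewrite nm0 nm_ge0.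
  have h2 : 1 / 2 * nm q <= nm (z *: q) by rewrite nmZ ler_wpM2r ?nm_ge0// ltW.
  by move: h1 h2; lra.
elim=> [|j ih] jn; apply: step => //.
  by exists 0 => z _; rewrite mulr0n nm0.
have [M hM] := ih (ltnW jn); exists (M *+ j.+1) => z z1.
by rewrite nmMn lerMn2r hM ?orbT.
Qed.

Definition cj z : C := (complex.Re z -i* complex.Im z)%C.

Lemma nm_cj z : nm (cj z) = nm z.
Proof. by rewrite !nm_modulus /modulus; case: z => a b /=; rewrite sqrrN. Qed.

Lemma cjB x y : cj (x - y) = cj x - cj y.
Proof.
case: x => a b; case: y => c d; apply/eqP; rewrite eq_complex/=.
by apply/andP; split; apply/eqP; ring.
Qed.

Lemma mul_cj z : z * cj z = (nm z ^+ 2)%:C%C.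
Proof.
rewrite sqr_nm; case: z => a b; apply/eqP; rewrite eq_complex/=.
by apply/andP; split; apply/eqP; ring.
Qed.

(** The factor vanishes on the circle, which kills a bounded function there whatever its boundary
    behaviour. *)
Lemma uc_one_sub_sqr V (h : C -> V) : complete_space V -> hol h -> bdd h ->
  uc (fun z => (1 - nm z ^+ 2)%:C%C *: h z).
Proof.
move=> VC hh [M hM].
have M0 : 0 <= M by rewrite (le_trans (nm_ge0 _) (hM 0 _))// nm0.
apply: uc_vanish => [r r1|e e0].
  have [K K0 hK] := hol_locally_lipschitz VC hh r1.
  exists (K + 2 * M); first by lra.
  move=> x y xr yr.
  have -> : (1 - nm x ^+ 2)%:C%C *: h x - (1 - nm y ^+ 2)%:C%C *: h y =
     (1 - nm x ^+ 2)%:C%C *: (h x - h y) + (nm y ^+ 2 - nm x ^+ 2)%:C%C *: h y.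
    by rewrite !rmorphB/=; module_ (Defs.C R) V.
  apply: (le_trans (nmD _ _)); rewrite !nmZ !nm_real mulrDl; apply: lerD.
    have x0 := nm_ge0 x.
    have x2 : nm x ^+ 2 <= 1 by rewrite expr_le1//; lra.
    have x2' : 0 <= nm x ^+ 2 by rewrite exprn_ge0.
    apply: (@le_trans _ _ (1 * nm (h x - h y))).
      by rewrite ler_wpM2r ?nm_ge0// ger0_norm; lra.
    by rewrite mul1r; exact: hK.
  have hy : nm (h y) <= M by apply: hM; lra.
  have h1 := nmD (x - y) y; have h2 := nmD (y - x) x.
  rewrite subrK in h1; rewrite subrK nm_distC in h2.
  have A : `|nm y ^+ 2 - nm x ^+ 2| <= 2 * nm (x - y).
    rewrite subr_sqr normrM mulrC; apply: ler_pM => //.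
      by rewrite ger0_norm ?addr_ge0 ?nm_ge0//; lra.
    by rewrite ler_norml; apply/andP; split; lra.
  apply: (@le_trans _ _ (2 * nm (x - y) * M)); first by apply: ler_pM; rewrite ?nm_ge0.
  by rewrite mulrAC.
pose d := Num.min 1 (e / (2 * (1 + M))).
have d0 : 0 < d by rewrite lt_min ltr01 divr_gt0//; lra.
have d1 : d <= 1 by rewrite ge_min lexx.
have dM : d * (2 * (1 + M)) <= e.
  by rewrite -ler_pdivlMr ?ge_min ?lexx ?orbT//; lra.
exists (1 - d); first by lra.
move=> z z1 dz; rewrite nmZ nm_real; have z0 := nm_ge0 z.
have z2 : nm z ^+ 2 <= 1 by rewrite expr_le1//; exact: ltW.
have z2' : 1 - 2 * d <= nm z ^+ 2.
  have : (1 - d) ^+ 2 <= nm z ^+ 2 by rewrite lerXn2r ?nnegrE//; lra.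
  have : 0 <= d ^+ 2 by exact: sqr_ge0.
  have -> : (1 - d) ^+ 2 = 1 - 2 * d + d ^+ 2 by ring.
  lra.
rewrite ger0_norm; last by lra.
apply: (@le_trans _ _ (2 * d * M)).
  by apply: ler_pM; rewrite ?nm_ge0 ?hM//; lra.
by move: dM; rewrite !mulrDr !mulr1 mulrA (mulrC d 2); lra.
Qed.

(** On the circle the conjugate is 1 / z, so the backward shift B of [g] is the candidate.
    Multiplied by [z], the error [B^(n) - cj z *: g^(n)] becomes [(1 - |z|^2) g^(n)] minus
    [n B^(n-1)] and, for [n = 0], minus [g 0]; each term extends to the circle, and [uc_unshift]
    removes the factor [z]. *)
Lemma mult_cj n : mult n cj.
Proof.
have cb : bdd cj by exists 1 => z /ltW; rewrite nm_cj.
have cu : uc cj by apply: (@uc_lip _ _ 1) => x y _ _; rewrite -cjB nm_cj mul1r.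
split; [exact: cb|exact: cu|move=> g gh gb].
have bh := hol_bshift gh; have bb := bddn_bshift gh gb.
exists (bshift g); split; [exact: bh|exact: bb|].
have gn := hol_derive1n n complete_ell2 gh.
have bn := hol_derive1n n complete_ell2 bh.
apply: uc_unshift.
- exact: bddD (bb n (leqnn n)) (bddN (bddZ cb (gb n (leqnn n)))).
- have h1 := uc_one_sub_sqr complete_ell2 gn (gb n (leqnn _)).
  have h2 : uc (fun z => - (if n is 0 then g 0 else 0) -
      derive1n n.-1 (bshift g) z *+ n).
    apply: ucD; first exact: (uc_cst (- (if n is 0 then g 0 else 0))).
    apply: ucN; case: (n) bb => [|m] bb.
      by apply: (eq_uc _ (uc_cst (0 : l2))) => z _; rewrite mulr0n.
    have h := ucZ (bdd_cst (m.+1%:R : C)) (uc_cst (m.+1%:R : C)) (bb m (leqnSn _))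
      (bddn_lip bh bb).
    by apply: (eq_uc _ h) => z _; rewrite scaler_nat.
  apply: (eq_uc _ (ucD h1 h2)) => z z1.
  rewrite scalerBr bshift_jets// scalerA mul_cj rmorphB/= scalerBl scale1r.
  by module_ (Defs.C R) (ell2 R).
move=> r r1; have [K K0 hK] := hol_locally_lipschitz complete_ell2 bn r1.
have [L L0 hL] := hol_locally_lipschitz complete_ell2 gn r1.
have [M gM] := gb n (leqnn _).
have M0 : 0 <= M by rewrite (le_trans (nm_ge0 _) (gM 0 _))// nm0.
exists (K + (M + L)); first by lra.
move=> x y xr yr; have x1 : nm x < 1 by lra.
have -> : derive1n n (bshift g) x - cj x *: derive1n n g x -
    (derive1n n (bshift g) y - cj y *: derive1n n g y) =
  (derive1n n (bshift g) x - derive1n n (bshift g) y) -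
  (cj (x - y) *: derive1n n g x + cj y *: (derive1n n g x - derive1n n g y)).
  by rewrite cjB; module_ (Defs.C R) (ell2 R).
apply: (le_trans (nmB _ _)); rewrite mulrDl; apply: lerD; first exact: hK.
apply: (le_trans (nmD _ _)); rewrite !nmZ !nm_cj mulrDl; apply: lerD.
  by rewrite mulrC ler_wpM2r ?nm_ge0// gM.
apply: le_trans (hL _ _ yr xr); rewrite ler_piMl ?nm_ge0//; lra.
Qed.

Lemma mult_Re n : mult n (fun z => (complex.Re z)%:C%C).
Proof.
apply: (mult_ext _ (multM (mult_cst n 2^-1) (multD (mult_id n) (mult_cj n)))) => z _.
have -> : z + cj z = 2 * (complex.Re z)%:C%C.
  rewrite mulr_natl mulr2n; case: z => a b; apply/eqP; rewrite eq_complex/=.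
  by apply/andP; split; apply/eqP; ring.
by rewrite mulrA mulVf// mul1r.
Qed.

Lemma mult_Im n : mult n (fun z => (complex.Im z)%:C%C).
Proof.
apply: (mult_ext _ (multM (mult_cst n (- 'i%C / 2))
  (multD (mult_id n) (multM (mult_cst n (-1)) (mult_cj n))))) => z _.
have -> : z + -1 * cj z = 2 * ('i%C * (complex.Im z)%:C%C).
  rewrite mulN1r mulr_natl mulr2n; case: z => a b; apply/eqP; rewrite eq_complex/=.
  by apply/andP; split; apply/eqP; ring.
have ii : 'i%C * 'i%C = -1 :> C by rewrite -expr2 sqr_i.
have E (w : C) : - 'i%C / 2 * (2 * ('i%C * w)) = - ('i%C * 'i%C) * w by field.
by rewrite E ii opprK mul1r.
Qed.

End Multipliers.

(** * Uniform approximation by multipliers *)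

Section Walk.
Context {R : realType}.
Local Notation C := (C R).

(* The expectation of [phi] after [N] steps of a random walk on the plane which
   moves up in its first (second) coordinate with probability [X] ([Y]). *)
Fixpoint walk (X Y : R) (N : nat) (phi : nat -> nat -> R) (s t : nat) : R :=
  match N with
  | 0 => phi s t
  | N'.+1 => X * walk X Y N' phi s.+1 t + Y * walk X Y N' phi s t.+1 +
             (1 - X - Y) * walk X Y N' phi s t
  end.

Lemma walk_le (X Y : R) N phi psi s t : 0 <= X -> 0 <= Y -> X + Y <= 1 ->
  (forall s t, phi s t <= psi s t) -> walk X Y N phi s t <= walk X Y N psi s t.
Proof.
move=> X0 Y0 XY h; elim: N s t => [|N ih] s t //=.
by apply: lerD; [apply: lerD|]; rewrite ler_wpM2l//; lra.
Qed.

Lemma walk_affine (X Y : R) N a b phi psi s t :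
  walk X Y N (fun s t => a + b * (phi s t + psi s t)) s t =
  a + b * (walk X Y N phi s t + walk X Y N psi s t).
Proof. by elim: N s t => [|N ih] s t //=; rewrite !ih; ring. Qed.

Lemma walk_addc (X Y : R) N a (b : R) phi s t :
  walk X Y N (fun s t => a + b * phi s t) s t = a + b * walk X Y N phi s t.
Proof. by elim: N s t => [|N ih] s t //=; rewrite !ih; ring. Qed.

(** The squared bias plus the variance [N * X * (1 - X)] of the binomial law. *)
Lemma walk_variance1 (X Y : R) N a s t :
  walk X Y N (fun s _ => (s%:R - a) ^+ 2) s t =
  (s%:R + N%:R * X - a) ^+ 2 + N%:R * (X * (1 - X)).
Proof.
elim: N s t => [|N ih] s t /=; first by rewrite !mul0r !addr0.
by rewrite !ih -![_.+1%:R]natr1; ring.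
Qed.

Lemma walk_variance2 (X Y : R) N a s t :
  walk X Y N (fun _ t => (t%:R - a) ^+ 2) s t =
  (t%:R + N%:R * Y - a) ^+ 2 + N%:R * (Y * (1 - Y)).
Proof.
elim: N s t => [|N ih] s t /=; first by rewrite !mul0r !addr0.
by rewrite !ih -![_.+1%:R]natr1; ring.
Qed.

(** Coordinates in [[-1, 1]] go to [[0, 1 / 2]], so [X], [Y] and [1 - X - Y] are probabilities for
    every point of the disk. *)
Definition walkX (z : C) : R := (1 + complex.Re z) / 4.
Definition walkY (z : C) : R := (1 + complex.Im z) / 4.

Lemma mult_real_add n (a b : C -> R) : mult n (fun z => (a z)%:C%C) ->
  mult n (fun z => (b z)%:C%C) -> mult n (fun z => (a z + b z)%:C%C).
Proof.
by move=> am bm; apply: (mult_ext _ (multD am bm)) => z _; rewrite rmorphD.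
Qed.

Lemma mult_real_mul n (a b : C -> R) : mult n (fun z => (a z)%:C%C) ->
  mult n (fun z => (b z)%:C%C) -> mult n (fun z => (a z * b z)%:C%C).
Proof.
by move=> am bm; apply: (mult_ext _ (multM am bm)) => z _; rewrite rmorphM.
Qed.

Lemma mult_real_cst n (a : R) : mult n (fun z : C => a%:C%C).
Proof. exact: mult_cst. Qed.

Lemma mult_walk n N phi s t :
  mult n (fun z => (walk (walkX z) (walkY z) N phi s t)%:C%C).
Proof.
have mX : mult n (fun z => (walkX z)%:C%C).
  exact: (mult_ext _ (mult_real_mul
    (mult_real_add (mult_real_cst n 1) (@mult_Re R n)) (mult_real_cst n 4^-1))).
have mY : mult n (fun z => (walkY z)%:C%C).
  exact: (mult_ext _ (mult_real_mul
    (mult_real_add (mult_real_cst n 1) (@mult_Im R n)) (mult_real_cst n 4^-1))).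
have mN (a : C -> R) : mult n (fun z => (a z)%:C%C) -> mult n (fun z => (- a z)%:C%C).
  move=> am; apply: (mult_ext _ (mult_real_mul (mult_real_cst n (-1)) am)) => z _.
  by rewrite mulN1r.
have mZ := mult_real_add (mult_real_add (mult_real_cst n 1) (mN _ mX)) (mN _ mY).
elim: N s t => [|N ih] s t; first exact: (mult_real_cst n (phi s t)).
exact: (mult_real_add (mult_real_add (mult_real_mul mX (ih s.+1 t))
  (mult_real_mul mY (ih s t.+1))) (mult_real_mul mZ (ih s t))).
Qed.

(** Bernstein's argument in two variables: the rescaled endpoint [pt] of the walk concentrates at
    [z], and the expectation of [Psi] there is a polynomial in the real and imaginary parts of [z],
    hence a multiplier. *)
Lemma mult_approx n (Psi : C -> R) (L e : R) : 0 <= L -> 0 < e ->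
  (forall z w, `|Psi z - Psi w| <= L * nm (z - w)) ->
  exists2 Phi : C -> R, mult n (fun z => (Phi z)%:C%C) &
    forall z, nm z < 1 -> `|Phi z - Psi z| <= e.
Proof.
move=> L0 e0 PsiL.
(* [eta] makes the deterministic error [8 * L * eta] at most [e / 2]; [N] is then chosen so that the
   variance contributes at most [8 * L / (N * eta) <= e / 2]. *)
pose eta := e / (16 * (L + 1)).
have eta0 : 0 < eta by apply: divr_gt0 => //; lra.
have Leta : 8 * L * eta <= e / 2.
  have -> : e / 2 = 8 * (L + 1) * eta by rewrite /eta; field; rewrite lt0r_neq0//; lra.
  by rewrite ler_pM2r//; lra.
have x0 : 0 <= 16 * L / (eta * e).
  by apply: divr_ge0; apply: mulr_ge0 => //; exact: ltW.
pose N := (Num.bound (16 * L / (eta * e))).+1.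
have N0 : 0 < N%:R :> R by rewrite ltr0n.
have LN : 8 * L / (N%:R * eta) <= e / 2.
  have : 16 * L / (eta * e) <= N%:R.
    by rewrite (le_trans (ltW (archi_boundP x0)))// ler_nat.
  have p1 : 0 < eta * e by exact: mulr_gt0.
  have p2 : 0 < N%:R * eta by exact: mulr_gt0.
  by rewrite (ler_pdivrMr _ _ p1) (ler_pdivrMr _ _ p2); lra.
have Nn : N%:R != 0 :> R by exact: lt0r_neq0.
have etan : eta != 0 by exact: lt0r_neq0.
pose pt (s t : nat) : C := ((4 * (s%:R / N%:R) - 1) +i* (4 * (t%:R / N%:R) - 1))%C.
exists (fun z => walk (walkX z) (walkY z) N (fun s t => Psi (pt s t)) 0 0).
  exact: mult_walk.
move=> z z1; set X := walkX z; set Y := walkY z.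
have := le_nm_Re z; have := le_nm_Im z; rewrite !ler_norml => /andP[i1 i2] /andP[r1 r2].
have X0 : 0 <= X by rewrite /X /walkX; lra.
have Y0 : 0 <= Y by rewrite /Y /walkY; lra.
have X1 : X <= 1 / 2 by rewrite /X /walkX; lra.
have Y1 : Y <= 1 / 2 by rewrite /Y /walkY; lra.
have XY : X + Y <= 1 by lra.
pose q1 (s t : nat) : R := (s%:R - N%:R * X) ^+ 2.
pose q2 (s t : nat) : R := (t%:R - N%:R * Y) ^+ 2.
pose c0 := 8 * L * eta; pose c1 := 4 * L / (eta * N%:R ^+ 2).
have dist s t : `|Psi (pt s t) - Psi z| <= c0 + c1 * (q1 s t + q2 s t).
  (* This trades the distance for its square, whose expectation is known exactly, and plays the role
     of Chebyshev's inequality. *)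
  have abs_le (u : R) : `|u| <= eta + u ^+ 2 / eta.
    have h : 0 <= (`|u| - eta) ^+ 2 / eta by rewrite divr_ge0 ?sqr_ge0// ltW.
    have E : (`|u| - eta) ^+ 2 / eta = u ^+ 2 / eta - 2 * `|u| + eta.
      by rewrite sqrrB real_normK ?num_real//; field; exact: lt0r_neq0.
    by have := normr_ge0 u; move: h; rewrite E; lra.
  apply: (le_trans (PsiL _ _)).
  have h1 := nm_leRI (pt s t - z).
  have h2 : complex.Re (pt s t - z) = 4 * (s%:R / N%:R - X).
    rewrite /X /walkX /pt; case: (z) => a b; rewrite /=.
    by field; exact: lt0r_neq0.
  have h3 : complex.Im (pt s t - z) = 4 * (t%:R / N%:R - Y).
    rewrite /Y /walkY /pt; case: (z) => a b; rewrite /=.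
    by field; exact: lt0r_neq0.
  rewrite h2 h3 !normrM (ger0_norm (_ : 0 <= 4 :> R))// in h1.
  have h4 := abs_le (s%:R / N%:R - X); have h5 := abs_le (t%:R / N%:R - Y).
  have h6 : nm (pt s t - z) <= 8 * eta + 4 * ((s%:R / N%:R - X) ^+ 2 / eta +
      (t%:R / N%:R - Y) ^+ 2 / eta) by lra.
  apply: (le_trans (ler_wpM2l L0 h6)).
  rewrite le_eqVlt; apply/orP; left; apply/eqP.
  rewrite /c0 /c1 /q1 /q2; field; apply/andP; split; (exact: Nn || exact: etan).
have W1 : walk X Y N (fun s t => c0 + c1 * (q1 s t + q2 s t)) 0 0 <= e.
  rewrite walk_affine walk_variance1 walk_variance2 !add0r !subrr expr0n/= !add0r.
  have c10 : 0 <= c1.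
    apply: divr_ge0; first by apply: mulr_ge0.
    by apply: mulr_ge0; [exact: ltW|apply: exprn_ge0; exact: ltW].
  have hX : N%:R * (X * (1 - X)) <= N%:R.
    by rewrite ler_piMr ?(ltW N0)// mulr_ile1//; lra.
  have hY : N%:R * (Y * (1 - Y)) <= N%:R.
    by rewrite ler_piMr ?(ltW N0)// mulr_ile1//; lra.
  apply: (@le_trans _ _ (c0 + c1 * (N%:R + N%:R))).
    by rewrite lerD2l ler_wpM2l// lerD.
  have -> : c1 * (N%:R + N%:R) = 8 * L / (N%:R * eta).
    rewrite /c1; field; apply/andP; split; (exact: Nn || exact: etan).
  by rewrite /c0; lra.
apply/andP; split.
  have : walk X Y N (fun s t => Psi z + -1 * (c0 + c1 * (q1 s t + q2 s t))) 0 0 <=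
      walk X Y N (fun s t => Psi (pt s t)) 0 0.
    apply: walk_le => // s t; have := dist s t; rewrite ler_norml => /andP[h _]; lra.
  by rewrite walk_addc; lra.
have : walk X Y N (fun s t => Psi (pt s t)) 0 0 <=
    walk X Y N (fun s t => Psi z + 1 * (c0 + c1 * (q1 s t + q2 s t))) 0 0.
  apply: walk_le => // s t; have := dist s t; rewrite ler_norml => /andP[_ h]; lra.
by rewrite walk_addc; lra.
Qed.

End Walk.

(** * Correction near S *)

Section NearOne.
Context {R : realType}.
Local Notation C := (C R).
Implicit Types (V : normedModType C) (P Q : R -> Prop).

Definition near1 P := exists2 d : R, 0 < d & forall r, 1 - d < r -> r < 1 -> P r.

Lemma near1_and P Q : near1 P -> near1 Q -> near1 (fun r => P r /\ Q r).
Proof.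
move=> [d d0 dP] [d' d'0 dQ]; exists (Num.min d d'); first by rewrite lt_min d0.
move=> r rd r1; have h1 : Num.min d d' <= d by rewrite ge_min lexx.
have h2 : Num.min d d' <= d' by rewrite ge_min lexx orbT.
by split; [apply: dP|apply: dQ]; lra.
Qed.

Lemma near1_ex P : near1 P -> exists r : R, [/\ 0 < r, r < 1 & P r].
Proof.
move=> [d d0 dP]; pose m := Num.min d 1.
have h1 : m <= d by rewrite ge_min lexx.
have h2 : m <= 1 by rewrite ge_min lexx orbT.
have h3 : 0 < m by rewrite lt_min d0 ltr01.
by exists (1 - m / 2); split; [lra|lra|apply: dP; lra].
Qed.

Lemma near1_forall n (P : nat -> R -> Prop) : (forall j, (j < n)%N -> near1 (P j)) ->
  near1 (fun r => forall j, (j < n)%N -> P j r).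
Proof.
elim: n => [|n ih] h; first by exists 1.
have [|d d0 dP] := near1_and (ih _) (h n (ltnSn n)).
  by move=> j jn; apply: h; rewrite ltnW.
exists d => // r rd r1 j; have [h1 h2] := dP r rd r1.
by rewrite ltnS leq_eqVlt => /predU1P[->|/h1].
Qed.

Lemma nm_dilate_sub (r : R) (z : C) : r < 1 -> nm z <= 1 -> nm ((r%:C%C : C) * z - z) <= 1 - r.
Proof.
move=> r1 z1; have -> : (r%:C%C : C) * z - z = (r - 1)%:C%C * z by rewrite rmorphB/=; ring.
by rewrite nmM nm_real ltr0_norm ?subr_lt0// opprB ler_piMr// ltW// subr_gt0.
Qed.

Lemma nm_dilate_le (r : R) (z : C) : 0 < r -> nm ((r%:C%C : C) * z) = r * nm z.
Proof. by move=> r0; rewrite nmM nm_real gtr0_norm. Qed.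

Lemma nm_dilate_lt1 (r : R) (z : C) : 0 < r -> r < 1 -> nm z < 1 -> nm ((r%:C%C : C) * z) < 1.
Proof.
move=> r0 r1 z1; rewrite nm_dilate_le// (le_lt_trans _ z1)// ler_piMl ?nm_ge0//.
exact: ltW.
Qed.

Lemma near1_uc V (h : C -> V) (e : R) : uc h -> 0 < e ->
  near1 (fun r => forall z, nm z < 1 -> nm (h ((r%:C%C : C) * z) - h z) <= e).
Proof.
move=> hu e0; have [d d0 hd] := hu e e0.
exists (Num.min d 1); first by rewrite lt_min d0 ltr01.
have h1 : Num.min d 1 <= d by rewrite ge_min lexx.
have h2 : Num.min d 1 <= 1 by rewrite ge_min lexx orbT.
move=> r rd r1 z z1; apply: hd => //; first by apply: nm_dilate_lt1 => //; lra.
by apply: (le_lt_trans (nm_dilate_sub r1 (ltW z1))); lra.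
Qed.

Lemma one_sub_exp (r : R) m : 0 <= r -> r <= 1 -> 1 - r ^+ m <= m%:R * (1 - r).
Proof.
move=> r0 r1; elim: m => [|m ih]; first by rewrite expr0 subrr mul0r.
have rm : r ^+ m <= 1 by rewrite exprn_ile1.
have rm0 : 0 <= r ^+ m by rewrite exprn_ge0.
have -> : 1 - r ^+ m.+1 = 1 - r ^+ m + r ^+ m * (1 - r) by rewrite exprS; ring.
rewrite -natr1 mulrDl mul1r; apply: lerD => //.
by rewrite ler_piMl// subr_ge0.
Qed.

Lemma near1_scale V (h : C -> V) m (e : R) : bdd h -> 0 < e ->
  near1 (fun r => forall z, nm z < 1 ->
    nm ((r%:C%C : C) ^+ m *: h ((r%:C%C : C) * z) - h ((r%:C%C : C) * z)) <= e).
Proof.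
move=> [M hM] e0; have M0 : 0 <= M by rewrite (le_trans (nm_ge0 _) (hM 0 _))// nm0.
have K0 : 0 < 1 + m%:R * M by rewrite ltr_pwDl// mulr_ge0.
exists (Num.min 1 (e / (1 + m%:R * M))).
  by rewrite lt_min ltr01 divr_gt0.
have h1 : Num.min 1 (e / (1 + m%:R * M)) <= 1 by rewrite ge_min lexx.
have h2 : Num.min 1 (e / (1 + m%:R * M)) <= e / (1 + m%:R * M) by rewrite ge_min lexx orbT.
move=> r rd r1 z z1; have r0 : 0 < r by lra.
rewrite -[X in _ - X]scale1r -scalerBl nmZ.
have -> : (r%:C%C : C) ^+ m - 1 = (r ^+ m - 1)%:C%C by rewrite rmorphB/= rmorphXn.
rewrite nm_real.
have re : (1 - r) * (1 + m%:R * M) <= e by rewrite -ler_pdivlMr//; lra.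
have rm : r ^+ m <= 1 by rewrite exprn_ile1// ltW.
have hh := one_sub_exp m (ltW r0) (ltW r1).
have -> : `|r ^+ m - 1| = 1 - r ^+ m by rewrite ler0_norm ?opprB ?subr_le0.
apply: (@le_trans _ _ (m%:R * (1 - r) * M)).
  apply: ler_pM; rewrite ?nm_ge0 ?subr_ge0//.
  by apply: hM; exact: nm_dilate_lt1.
by apply: le_trans re; rewrite mulrDr mulr1; lra.
Qed.

(** Counterexamples [z m] with [r m] tending to 1 would cluster at a point [s] of the closed disk
    with [c <= d s]; both [z m] and [r m * z m] approach [s], against the Cauchy criterion there. *)
Lemma near1_compact V (h : C -> V) (d : C -> R) (c e : R) : 0 < e ->
  (forall z w, `|d z - d w| <= nm (z - w)) ->
  (forall s, nm s <= 1 -> c <= d s -> cauchy_at h s) ->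
  near1 (fun r => forall z, nm z < 1 -> c <= d z -> nm (h ((r%:C%C : C) * z) - h z) <= e).
Proof.
move=> e0 dL hc; apply: contrapT => H.
have bad (m : nat) : exists a : R * C, [/\ 1 - 1 / 2 ^+ m.+1 < a.1, a.1 < 1, nm a.2 < 1, c <= d a.2 &
    e < nm (h (((a.1)%:C%C : C) * a.2) - h a.2)].
  apply: contrapT => /forallNP hb; apply: H; exists (1 / 2 ^+ m.+1).
    by rewrite divr_gt0// exprn_gt0.
  move=> r rd r1 z z1 cz; rewrite leNgt; apply/negP => lt.
  by apply: (hb (r, z)); split.
have [a aP] := choice bad.
have [U [UU ooU]] := exists_ultra_nat.
have UP : ProperFilter U by exact: ultra_proper.
have z1 m : nm (a m).2 <= 1 by have [_ _ /ltW] := aP m.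
have [s zs] := ultra_cvg_complex UU z1.
have s1 : nm s <= 1 by apply: (vcv_le zs); apply: filterE.
have cs : c <= d s.
  apply/ler_addgt0Pl => eta eta0; have [m ms] := filter_ex (zs _ eta0).
  have [_ _ _ cz _] := aP m; have := dL (a m).2 s; rewrite ler_norml => /andP[_ hd].
  lra.
have [t t0 ht] := hc s s1 cs e e0.
(* One third for the distance from [z m] to [s] and one for the effect of the dilation, leaving a
   strict inequality. *)
have t3 : 0 < t / 3 by lra.
have [N hN] := half_expn_small (1 : R) t3.
have ub : U [set m | (N <= m)%N] by apply: ooU; exists N.
have [m [Nm ms]] := filter_ex (filterI ub (zs _ t3)).
have [r1 r2 zz cz] := aP m; rewrite ltNge => /negP; apply.
have p2 : 1 / 2 ^+ m.+1 <= t / 3.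
  apply: le_trans hN; rewrite ler_pM2l// lef_pV2 ?posrE ?exprn_gt0//.
  by rewrite ler_eXn2l ?ltr1n// leqW.
have p1 : 1 / 2 ^+ m.+1 <= 1 :> R.
  by rewrite ler_pdivrMr ?exprn_gt0// mul1r exprn_ege1// ler1n.
have r0 : 0 < (a m).1 by lra.
apply: ht => //; first exact: nm_dilate_lt1.
  have := nm_tri (((a m).1%:C%C : C) * (a m).2) (a m).2 s.
  have := nm_dilate_sub r2 (ltW zz); lra.
lra.
Qed.

End NearOne.

(** * Correction by a single dilation *)

Section Correction.
Context {R : realType}.
Local Notation C := (C R).
Local Notation l2 := (ell2 R).

Lemma bddn_leq n m (g : C -> l2) : (m <= n)%N -> bddn n g -> bddn m g.
Proof. by move=> mn gb j jm; apply: gb; rewrite (leq_trans jm). Qed.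

Lemma uc_dilate (h : C -> l2) m (r : R) : hol h -> 0 < r -> r < 1 ->
  uc (fun z => (r%:C%C : C) ^+ m *: h ((r%:C%C : C) * z)).
Proof.
move=> hh r0 r1; have [K K0 hK] := hol_locally_lipschitz complete_ell2 hh r1.
have rz (z : C) : nm z < 1 -> nm ((r%:C%C : C) * z) <= r.
  by move=> z1; rewrite nm_dilate_le// ler_piMr// ltW.
apply: (@uc_lip _ _ _ K) => x y x1 y1.
rewrite -scalerBr nmZ nmX nm_real gtr0_norm//.
apply: (@le_trans _ _ (nm (h ((r%:C%C : C) * x) - h ((r%:C%C : C) * y)))).
  by rewrite ler_piMl ?nm_ge0// exprn_ile1// ltW.
apply: (le_trans (hK _ _ (rz _ y1) (rz _ x1))).
by rewrite -mulrBr nm_dilate_le// ler_wpM2l// ler_piMl ?nm_ge0// ltW.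
Qed.

(** With [P] supplied by the multiplier [phi] and [c = P^(n) - phi g^(n)], take
    [dl z = P (r z) - P z] and [T z = r^n P^(n)(r z) - c z]. Then [dl^(n) = T - phi g^(n)]: the
    irregular part is removed and [T], uniformly continuous and close to [phi g^(n)(r z)], takes its
    place. The predicate [Q] carries further demands on [r]. *)
Lemma dilation_correction n (g : C -> l2) (phi : C -> R) (e rho : R) (Q : R -> Prop) :
  hol g -> bddn n g -> mult n (fun z => (phi z)%:C%C) -> 0 < e -> rho < 1 -> near1 Q ->
  exists (r : R) (dl T : C -> l2), [/\ [/\ 0 < r, r < 1 & Q r], hol dl /\ bddn n dl,
   (forall j z, (j < n)%N -> nm z < 1 -> nm (derive1n j dl z) <= e) /\
   (forall z, nm z <= rho -> nm (dl z) <= e), uc T &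
   forall z, nm z < 1 ->
     derive1n n dl z = T z - (phi z)%:C%C *: derive1n n g z /\
     nm (T z - (phi z)%:C%C *: derive1n n g ((r%:C%C : C) * z)) <= e].
Proof.
move=> gh gb [phib phiu phiG] e0 rho1 nQ.
have [P [Ph Pb Pu]] := phiG g gh gb.
have Ps := smooth_hol complete_ell2 Ph.
pose c z := derive1n n P z - (phi z)%:C%C *: derive1n n g z.
have e2 : 0 < e / 2 by lra.
have e3 : 0 < e / 3 by lra.
have lowj j : (j < n)%N -> near1 (fun r => forall z, nm z < 1 ->
    nm ((r%:C%C : C) ^+ j *: derive1n j P ((r%:C%C : C) * z) - derive1n j P z) <= e).
  move=> jn; have ju : uc (derive1n j P) by apply: bddn_lip => //; exact: bddn_leq Pb.
  have [d d0 hd] := near1_and (near1_uc ju e2) (near1_scale j (Pb j (ltnW jn)) e2).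
  exists d => // r rd r1 z z1; have [h1 h2] := hd r rd r1.
  apply: (le_trans (nm_tri _ (derive1n j P ((r%:C%C : C) * z)) _)).
  rewrite [leRHS]splitr; exact: lerD (h2 z z1) (h1 z z1).
(* Smallness on a smaller disc makes the sum of all corrections converge locally uniformly, also for
   [n = 0], where the condition on orders below [n] is void. *)
have rhoP : near1 (fun r => forall z, nm z <= rho -> nm (P ((r%:C%C : C) * z) - P z) <= e).
  have [K K0 hK] := hol_locally_lipschitz complete_ell2 Ph rho1.
  exists (Num.min 1 (e / (1 + K))).
    by rewrite lt_min ltr01 divr_gt0//; lra.
  have h1 : Num.min 1 (e / (1 + K)) <= 1 by rewrite ge_min lexx.
  have h2 : Num.min 1 (e / (1 + K)) <= e / (1 + K) by rewrite ge_min lexx orbT.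
  move=> r rd r1 z zr; have r0 : 0 < r by lra.
  have re : (1 - r) * (1 + K) <= e by rewrite -ler_pdivlMr; lra.
  apply: (le_trans (hK _ _ zr _)).
    by rewrite nm_dilate_le//; apply: le_trans zr; rewrite ler_piMl ?nm_ge0// ltW.
  have := nm_dilate_sub r1 (le_trans zr (ltW rho1)) => h.
  apply: (le_trans (ler_wpM2l K0 h)).
  by lra.
have cP : near1 (fun r => forall z, nm z < 1 -> nm (c ((r%:C%C : C) * z) - c z) <= e / 3).
  exact: near1_uc Pu e3.
have [M gM] := gb n (leqnn n).
have M0 : 0 <= M by rewrite (le_trans (nm_ge0 _) (gM 0 _))// nm0.
have eM : 0 < e / (3 * (1 + M)) by apply: divr_gt0 => //; apply: mulr_gt0 => //; lra.
have phiP := near1_uc phiu eM.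
have PnP := near1_scale n (Pb n (leqnn n)) e3.
have [r [r0 r1 [Qr [lowr [rhor [cr [phir Pnr]]]]]]] := near1_ex (near1_and nQ
  (near1_and (near1_forall lowj) (near1_and rhoP (near1_and cP (near1_and phiP PnP))))).
have rle : nm (r%:C%C : C) <= 1 by rewrite nm_real gtr0_norm// ltW.
have [Prs PrE] := smooth_dilate rle Ps.
have [dls dlE] := smoothB Prs Ps.
pose dl z := P ((r%:C%C : C) * z) - P z.
pose T z := (r%:C%C : C) ^+ n *: derive1n n P ((r%:C%C : C) * z) - c z.
have dlj j z : nm z < 1 -> derive1n j dl z =
    (r%:C%C : C) ^+ j *: derive1n j P ((r%:C%C : C) * z) - derive1n j P z.
  by move=> z1; rewrite dlE// PrE.
exists r, dl, T; split.
- by split.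
- split; first exact: (dls 0%N).
  move=> j jn; have [K PK] := Pb j jn; exists (K + K) => z z1; rewrite dlj//.
  apply: (le_trans (nmB _ _)); apply: lerD; last exact: PK.
  rewrite nmZ nmX nm_real gtr0_norm//; apply: le_trans (PK _ (nm_dilate_lt1 r0 r1 z1)).
  by rewrite ler_piMl ?nm_ge0// exprn_ile1// ltW.
- split; last exact: rhor.
  by move=> j z jn z1; rewrite dlj//; exact: lowr.
- apply: ucD; last exact: ucN.
  exact: (uc_dilate n (hol_derive1n n complete_ell2 Ph) r0 r1).
move=> z z1; split.
  by rewrite dlj// /T /c; module_ (Defs.C R) (ell2 R).
have rz1 := nm_dilate_lt1 r0 r1 z1.
have -> : T z - (phi z)%:C%C *: derive1n n g ((r%:C%C : C) * z) =
  ((r%:C%C : C) ^+ n *: derive1n n P ((r%:C%C : C) * z) - derive1n n P ((r%:C%C : C) * z)) +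
  ((c ((r%:C%C : C) * z) - c z) +
   ((phi ((r%:C%C : C) * z))%:C%C - (phi z)%:C%C) *: derive1n n g ((r%:C%C : C) * z)).
  by rewrite /T /c; module_ (Defs.C R) (ell2 R).
have h1 := Pnr z z1; have h2 := cr z z1; have h3 := phir z z1.
have h4 : nm (((phi ((r%:C%C : C) * z))%:C%C - (phi z)%:C%C) *: derive1n n g ((r%:C%C : C) * z)) <=
    e / (3 * (1 + M)) * (1 + M).
  rewrite nmZ; apply: ler_pM; rewrite ?nm_ge0//.
  by apply: (le_trans (gM _ rz1)); lra.
have E : e / (3 * (1 + M)) * (1 + M) = e / 3 by field; rewrite lt0r_neq0//; lra.
rewrite E in h4.
apply: (le_trans (nmD _ _)); have -> : e = e / 3 + (e / 3 + e / 3) by field.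
apply: (lerD h1); apply: (le_trans (nmD _ _)); exact: lerD h2 h4.
Qed.

End Correction.

(** * Cut-offs and the Cauchy criterion at the boundary *)

Section CutOff.
Context {R : realType}.
Local Notation C := (C R).
Implicit Types (z w s : C).

(** The distance to the complement, capped at 1. Putting 1 into the set keeps it nonempty when [U]
    is the whole plane. *)
Lemma open_dist (U : set C) : open U -> exists d : C -> R,
  [/\ forall z w, `|d z - d w| <= nm (z - w), forall z, 0 <= d z <= 1,
      forall z, 0 < d z -> U z & forall z, U z -> 0 < d z].
Proof.
move=> Uo; pose D z : set R := [set r | r = 1 \/ exists2 w, ~ U w & r = nm (z - w)].
have D1 z : D z !=set0 by exists 1; left.
have D0 z : lbound (D z) 0 by move=> r [->//|[w _ ->]]; exact: nm_ge0.
have Dl z : has_lbound (D z) by exists 0; exact: D0.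
have dle z r : D z r -> inf (D z) <= r by move=> Dr; exact: ge_inf.
have sub z w : inf (D z) <= inf (D w) + nm (z - w).
  rewrite -lerBlDr; apply: lb_le_inf => // r [->|[x Ux ->]]; rewrite lerBlDr.
    have : inf (D z) <= 1 by apply: dle; left.
    by have := nm_ge0 (z - w); lra.
  have : inf (D z) <= nm (z - x) by apply: dle; right; exists x.
  by have := nm_tri z w x; lra.
exists (fun z => inf (D z)); split.
- move=> z w; rewrite ler_norml; apply/andP; split.
    by have := sub w z; rewrite nm_distC; lra.
  by have := sub z w; lra.
- by move=> z; apply/andP; split; [exact: lb_le_inf|apply: dle; left].
- move=> z d0; apply: contrapT => Uz.
  have : inf (D z) <= 0 by apply: dle; right; exists z => //; rewrite subrr nm0.
  by lra.
move=> z Uz; have /nbhs_nmP[r r0 hr] : nbhs z U by exact: open_nbhs_nbhs.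
apply: (@lt_le_trans _ _ (Num.min 1 r)); first by rewrite lt_min ltr01.
apply: lb_le_inf => // x [->|[w Uw ->]]; first by rewrite ge_min lexx.
rewrite ge_min; apply/orP; right; rewrite leNgt; apply/negP => h; apply: Uw.
by apply: hr; rewrite nm_distC.
Qed.

(** It is 0 where [d <= 2^-k] and 1 where [d >= 2^(1-k)]. For [d <= 1] level 0 vanishes, so
    differences of consecutive levels telescope to a partition of unity on [{d > 0}]. *)
Definition cutoff (d : C -> R) (k : nat) z : R := Num.max 0 (Num.min 1 (2 ^+ k * d z - 1)).

Lemma cutoff_ge0 d k z : 0 <= cutoff d k z.
Proof. by rewrite /cutoff le_max lexx. Qed.

Lemma cutoff_le1 d k z : cutoff d k z <= 1.
Proof. by rewrite /cutoff ge_max ler01 ge_min lexx. Qed.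

Lemma cutoff_eq0 d k z : 2 ^+ k * d z <= 1 -> cutoff d k z = 0.
Proof.
move=> h; apply/eqP; rewrite eq_le cutoff_ge0 andbT /cutoff ge_max lexx/=.
by rewrite ge_min subr_le0 h orbT.
Qed.

Lemma cutoff_eq1 d k z : 2 <= 2 ^+ k * d z -> cutoff d k z = 1.
Proof.
move=> h; apply/eqP; rewrite eq_le cutoff_le1 /cutoff le_max le_min lexx/=.
by apply/orP; right; lra.
Qed.

Lemma cutoff_le d k z : 0 <= d z -> cutoff d k z <= cutoff d k.+1 z.
Proof.
move=> d0; rewrite /cutoff ge_max le_max lexx/= le_max; apply/orP; right.
rewrite le_min ge_min lexx/= ge_min; apply/orP; right.
rewrite lerD2r ler_wpM2r// exprS ler_peMl ?exprn_ge0// ler1n//.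
Qed.

Lemma cutoff_lip d k : (forall z w, `|d z - d w| <= nm (z - w)) ->
  forall z w, `|cutoff d k z - cutoff d k w| <= 2 ^+ k * nm (z - w).
Proof.
move=> dL; suff H z w : cutoff d k z <= cutoff d k w + 2 ^+ k * nm (z - w).
  move=> z w; rewrite ler_norml; apply/andP; split.
    by have := H w z; rewrite nm_distC; lra.
  by have := H z w; lra.
have p0 : 0 <= 2 ^+ k * nm (z - w) by rewrite mulr_ge0 ?exprn_ge0 ?nm_ge0.
rewrite {1}/cutoff ge_max; apply/andP; split.
  by have := cutoff_ge0 d k w; lra.
have [h|h] := leP (2 ^+ k * d w - 1) 1; last first.
  have -> : cutoff d k w = 1 by apply: cutoff_eq1; lra.
  by rewrite ge_min; apply/orP; left; lra.
rewrite ge_min; apply/orP; right.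
have h1 : 2 ^+ k * d w - 1 <= cutoff d k w.
  by rewrite /cutoff le_max le_min lexx h orbT.
have h2 : 2 ^+ k * d z <= 2 ^+ k * d w + 2 ^+ k * nm (z - w).
  rewrite -mulrDr ler_wpM2l ?exprn_ge0//.
  by have := dL z w; rewrite ler_norml => /andP[_]; lra.
lra.
Qed.

End CutOff.

Section BoundaryContinuity.
Context {R : realType}.
Local Notation C := (C R).
Implicit Types (V : normedModType C) (z w s : C).

Lemma cauchy_at_hol V (h : C -> V) s : nm s < 1 -> hol h -> cauchy_at h s.
Proof.
move=> s1 hh e e0; have e2 : 0 < e / 2 by lra.
have [d d0 hd] := cd_cont (hh s s1) e2; exists d => // x y _ _ xs ys.
have h1 := hd (x - s) xs; have h2 := hd (y - s) ys.
rewrite (addrC s) subrK in h1; rewrite (addrC s) subrK nm_distC in h2.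
apply: (le_trans (nm_tri _ (h s) _)); rewrite [leRHS]splitr; exact: lerD.
Qed.

Lemma uc_cauchy_at V (h : C -> V) s : uc h -> cauchy_at h s.
Proof.
move=> hu e e0; have [d d0 hd] := hu e e0; have d2 : 0 < d / 2 by lra.
exists (d / 2) => // x y x1 y1 xs ys; apply: hd => //.
by have := nm_tri x s y; rewrite (nm_distC s y); lra.
Qed.

Lemma cauchy_at_ext V (h k : C -> V) s : (forall z, nm z < 1 -> h z = k z) ->
  cauchy_at h s -> cauchy_at k s.
Proof.
move=> hk hc e e0; have [d d0 hd] := hc e e0; exists d => // x y x1 y1 xs ys.
by rewrite -!hk//; exact: hd.
Qed.

Lemma cauchy_at_cst V (v : V) s : cauchy_at (fun=> v) s.
Proof. by apply: uc_cauchy_at; exact: uc_cst. Qed.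

Lemma cauchy_atD V (h k : C -> V) s : cauchy_at h s -> cauchy_at k s ->
  cauchy_at (fun z => h z + k z) s.
Proof.
move=> hc kc e e0; have e2 : 0 < e / 2 by lra.
have [d d0 hd] := hc _ e2; have [d' d'0 kd] := kc _ e2.
exists (Num.min d d'); first by rewrite lt_min d0.
move=> x y x1 y1; rewrite !lt_min => /andP[x2 x3] /andP[y2 y3].
rewrite opprD addrACA; apply: (le_trans (nmD _ _)).
by rewrite [leRHS]splitr; apply: lerD; [exact: hd|exact: kd].
Qed.

Lemma cauchy_at_bilin (V1 V2 V3 : normedModType C) (b : bilin V1 V2 V3)
    (h : C -> V1) (k : C -> V2) s : bdd h -> bdd k ->
  cauchy_at h s -> cauchy_at k s -> cauchy_at (fun z => b (h z) (k z)) s.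
Proof.
move=> [M hM] [K kK] hc kc e e0.
have z0 : nm (0 : C) < 1 by rewrite nm0.
have M0 : 0 <= M by exact: le_trans (nm_ge0 _) (hM 0 z0).
have K0 : 0 <= K by exact: le_trans (nm_ge0 _) (kK 0 z0).
have eM : 0 < e / (2 * (1 + M)) by apply: divr_gt0 => //; apply: mulr_gt0 => //; lra.
have eK : 0 < e / (2 * (1 + K)) by apply: divr_gt0 => //; apply: mulr_gt0 => //; lra.
have [d d0 kd] := kc _ eM; have [d' d'0 hd] := hc _ eK.
exists (Num.min d d'); first by rewrite lt_min d0.
move=> x y x1 y1; rewrite !lt_min => /andP[x2 x3] /andP[y2 y3].
have bNl u v : b (- u) v = - b u v by rewrite -scaleN1r bilinZl scaleN1r.
have bNr u v : b u (- v) = - b u v by rewrite -scaleN1r bilinZr scaleN1r.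
have -> : b (h x) (k x) - b (h y) (k y) = b (h x) (k x - k y) + b (h x - h y) (k y).
  by rewrite bilinDr bilinDl bNl bNr addrA subrK.
apply: (le_trans (nmD _ _)); rewrite [leRHS]splitr; apply: lerD.
  apply: (le_trans (bilin_le _ _ _)).
  have -> : e / 2 = (1 + M) * (e / (2 * (1 + M))) by field; rewrite lt0r_neq0//; lra.
  apply: ler_pM; rewrite ?nm_ge0 ?kd//.
  by apply: (le_trans (hM x x1)); lra.
apply: (le_trans (bilin_le _ _ _)).
have -> : e / 2 = e / (2 * (1 + K)) * (1 + K) by field; rewrite lt0r_neq0//; lra.
apply: ler_pM; rewrite ?nm_ge0 ?hd//.
by apply: (le_trans (kK y y1)); lra.
Qed.

Lemma cauchy_atN V (h : C -> V) s : cauchy_at h s -> cauchy_at (fun z => - h z) s.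
Proof.
move=> hc e e0; have [d d0 hd] := hc e e0; exists d => // x y x1 y1 xs ys.
by rewrite -opprD nmN; exact: hd.
Qed.

Lemma cauchy_atMn V (h : C -> V) k s : cauchy_at h s -> cauchy_at (fun z => h z *+ k) s.
Proof.
move=> hc; elim: k => [|k ih].
  by apply: (cauchy_at_ext _ (cauchy_at_cst (0 : V) s)) => z _; rewrite mulr0n.
by apply: (cauchy_at_ext _ (cauchy_atD hc ih)) => z _; rewrite mulrS.
Qed.

Lemma cauchy_at_sum V n (h : nat -> C -> V) s :
  (forall i, (i < n)%N -> cauchy_at (h i) s) -> cauchy_at (fun z => \sum_(i < n) h i z) s.
Proof.
elim: n => [|n ih] hc.
  by apply: (cauchy_at_ext _ (cauchy_at_cst (0 : V) s)) => z _; rewrite big_ord0.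
have h1 : cauchy_at (fun z => \sum_(i < n) h i z) s.
  by apply: ih => i i_n; apply: hc; rewrite ltnW.
by apply: (cauchy_at_ext _ (cauchy_atD h1 (hc n (ltnSn n)))) => z _; rewrite big_ord_recr.
Qed.

Lemma uc_sum V n (h : nat -> C -> V) :
  (forall i, (i < n)%N -> uc (h i)) -> uc (fun z => \sum_(i < n) h i z).
Proof.
elim: n => [|n ih] hc.
  by apply: (eq_uc _ (uc_cst (0 : V))) => z _; rewrite big_ord0.
have h1 : uc (fun z => \sum_(i < n) h i z).
  by apply: ih => i i_n; apply: hc; rewrite ltnW.
by apply: (eq_uc _ (ucD h1 (hc n (ltnSn n)))) => z _; rewrite big_ord_recr.
Qed.

Lemma derive1n_cst V (v : V) j z : nm z < 1 ->
  derive1n j (fun _ : C => v) z = if j is 0 then v else 0.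
Proof.
move=> z1; pose F j (_ : C) : V := if j is 0 then v else 0.
by apply: (@jets_unique _ _ _ F j) => // k w _ _; exact: cd_cst.
Qed.

(** The n-th derivative of g . f = 1, solved for its only term with the derivative of order [n] of
    [g]. The right side contains lower derivatives of [g], which are Lipschitz, so the pairing is as
    regular as [f]. *)
Lemma pair_top_term n (f g : C -> ell2 R) (z : C) : hol f -> hol g ->
  (forall w, nm w < 1 -> pair (g w) (f w) = 1) -> nm z < 1 ->
  pair (derive1n n g z) (f z) = (if n is 0 then 1 else 0) -
   \sum_(i < n) pair (derive1n i g z) (derive1n (n - i) f z) *+ 'C(n, i).
Proof.
move=> fh gh gf z1.
have fs := smooth_hol complete_ell2 fh; have gs := smooth_hol complete_ell2 gh.
have [ps pE] := smooth_bilin (@pair_bilin R) gs fs.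
have h1 : derive1n n (fun z => pair (g z) (f z)) z = leibniz (@pair_bilin R) g f n z.
  exact: pE n z z1.
have h2 : derive1n n (fun z => pair (g z) (f z)) z = if n is 0 then 1 else 0.
  rewrite (@derive1n_local R (C : normedModType C) _ (fun=> (1 : C)) n ps gf z z1).
  exact: (@derive1n_cst (C : normedModType C)).
have h3 : (if n is 0 then 1 else 0 : C) = \sum_(i < n)
    pair (derive1n i g z) (derive1n (n - i) f z) *+ 'C(n, i) + pair (derive1n n g z) (f z).
  by rewrite -(etrans (esym h1) h2) /leibniz big_ord_recr/= subnn binn mulr1n.
rewrite h3.
by rewrite [RHS]addrC; exact: (esym (addKr _ _)).
Qed.

End BoundaryContinuity.

Section Series.
Context {R : realType}.
Local Notation C := (C R).

Lemma geometric_sum_le (c : R) n : 0 <= c -> \sum_(k < n) c / 2 ^+ k <= 2 * c.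
Proof.
move=> c0; suff -> : \sum_(k < n) c / 2 ^+ k = 2 * c - 2 * c / 2 ^+ n.
  by rewrite gerBl divr_ge0 ?mulr_ge0 ?exprn_ge0.
elim: n => [|n ih]; first by rewrite big_ord0 expr0 divr1 subrr.
by rewrite big_ord_recr/= ih exprS; field; rewrite expf_neq0.
Qed.

(** Step [k] is controlled only on the disc of radius [1 - 1 / 2^k]; a given [z] enters these discs
    at a least index [k0], from which the halving argument starts. *)
Lemma lucv_series (V : normedModType C) (F : nat -> C -> V) (c : R) : complete_space V ->
  0 <= c ->
  (forall k z, nm z <= 1 - 1 / 2 ^+ k -> nm (F k.+1 z - F k z) <= c / 2 ^+ k.+1) ->
  exists G, lucv F G.
Proof.
move=> VC c0 FS.
have p1 k j : (k <= j)%N -> 1 / 2 ^+ j <= 1 / 2 ^+ k :> R.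
  by move=> kj; rewrite ler_pM2l// lef_pV2 ?posrE ?exprn_gt0// ler_eXn2l// ltr1n.
have lim z : exists l : V, forall k, nm z <= 1 - 1 / 2 ^+ k ->
    forall m, (k <= m)%N -> nm (F m z - l) <= c / 2 ^+ m.
  have [ex|nex] := pselect (exists k, nm z <= 1 - 1 / 2 ^+ k); last first.
    by exists 0 => k zk; case: nex; exists k.
  case: (ex_minnP ex) => k0 zk0 k0min.
  have [|l lP] := @halving_cvg _ _ (fun n => F (k0 + n)%N z) (c / 2 ^+ k0) VC.
    move=> n; rewrite addnS; have -> : c / 2 ^+ k0 / 2 ^+ n.+1 = c / 2 ^+ (k0 + n).+1.
      by rewrite -addnS exprD invfM mulrA.
    apply: FS; apply: (le_trans zk0); rewrite lerB// p1// leq_addr//.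
  exists l => k zk m km; have k0m : (k0 <= m)%N by rewrite (leq_trans (k0min _ zk)).
  have := lP (m - k0)%N; rewrite subnKC// => h; apply: (le_trans h).
  by rewrite -mulrA -invfM -exprD subnKC.
have [G GP] := choice lim; exists G => r e r1 e0.
have r0 : 0 < 1 - r by lra.
have [k1 hk1] := half_expn_small (1 : R) r0.
have [k2 hk2] := half_expn_small c e0.
exists (maxn k1 k2) => m; rewrite geq_max => /andP[m1 m2] z zr.
apply: (le_trans (GP z k1 _ m m1)); first by lra.
apply: le_trans hk2; rewrite ler_wpM2l// lef_pV2 ?posrE ?exprn_gt0//.
by rewrite ler_eXn2l// ltr1n.
Qed.

End Series.

(** * Summation of the corrections *)

Section Gluing.
Context {R : realType}.
Local Notation C := (C R).
Local Notation l2 := (ell2 R).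
Implicit Types (z w s : C).

(** The estimates on order [n], freed of analyticity: [gn] stands for g^(n) and [H] for the limit
    G^(n). Up to summable errors the partial sums are convex combinations of [gn z] and the
    [gn (r k * z)], which gives the first bound. In the last one, [Mf] comes from replacing [T k],
    [2 * (1 + M)] from points where the dilation hardly moves [f], and [4 * M * Mf] from points
    where only the error of [Phi] remains. *)
Lemma glue_core (gn f H : C -> l2) (T : nat -> C -> l2) (Phi : nat -> C -> R)
    (d : C -> R) (r : nat -> R) (eps M Mf : R) (e := fun k => eps / 8 / 2 ^+ k) :
  0 < eps -> eps <= 1 ->
  (forall z, nm z < 1 -> nm (gn z) <= M) -> (forall z, nm z < 1 -> nm (f z) <= Mf) ->
  (forall z, 0 <= d z <= 1) -> (forall z w, `|d z - d w| <= nm (z - w)) ->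
  (forall z, Phi 0%N z = 0) ->
  (forall k z, nm z < 1 -> `|Phi k z - cutoff d k z| <= e k) ->
  (forall k, uc (T k)) -> (forall k, 0 < r k < 1) ->
  (forall k z, nm z < 1 -> nm (T k z - (Phi k.+1 z - Phi k z)%:C%C *:
      gn (((r k)%:C%C : C) * z)) <= e k) ->
  (forall k z, nm z < 1 -> 1 <= 2 ^+ k.+1 * d z ->
     nm (f (((r k)%:C%C : C) * z) - f z) <= e k /\
     nm (pair (gn (((r k)%:C%C : C) * z)) (f (((r k)%:C%C : C) * z)) -
         pair (gn z) (f z)) <= e k) ->
  (forall z, nm z < 1 ->
     vcv \oo (fun m => (1 - Phi m z)%:C%C *: gn z + \sum_(k < m) T k z) (H z)) ->
  [/\ forall z, nm z < 1 -> nm (H z) <= (1 + eps) * M + eps,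
      forall s, 0 < d s -> cauchy_at H s &
      forall z, nm z < 1 -> nm (pair (H z - gn z) (f z)) <=
        (Mf + 2 * (1 + M) + 4 * M * Mf) * eps].
Proof.
move=> eps0 eps1 gM fM d01 dL Phi0 PhiP Tu r01 TP rP HP.
have z0 : nm (0 : C) < 1 by rewrite nm0.
have M0 : 0 <= M by exact: le_trans (nm_ge0 _) (gM 0 z0).
have Mf0 : 0 <= Mf by exact: le_trans (nm_ge0 _) (fM 0 z0).
have e0 k : 0 < e k by rewrite /e divr_gt0 ?exprn_gt0// divr_gt0.
have eS k : e k.+1 = e k / 2 by rewrite /e exprS; field; rewrite expf_neq0.
have e8 k : e k <= eps / 8.
  by rewrite /e ler_pdivrMr ?exprn_gt0// ler_peMr ?exprn_ege1 ?ler1n//; lra.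
have esum m : \sum_(k < m) e k <= eps / 4.
  apply: (le_trans (geometric_sum_le m _)); lra.
pose phi k z := Phi k.+1 z - Phi k z.
pose psi k z := cutoff d k.+1 z - cutoff d k z.
have psi0 k z : 0 <= psi k z.
  by rewrite subr_ge0 cutoff_le//; have /andP[] := d01 z.
have psi1 k z : psi k z <= 1.
  by have := cutoff_le1 d k.+1 z; have := cutoff_ge0 d k z; rewrite /psi; lra.
have phipsi k z : nm z < 1 -> `|phi k z - psi k z| <= 2 * e k.
  move=> z1; have := PhiP k z z1; have := PhiP k.+1 z z1; rewrite eS /phi /psi.
  by rewrite !ler_norml => /andP[a1 a2] /andP[b1 b2]; apply/andP; have := e0 k; split; lra.
have phile k z : nm z < 1 -> `|phi k z| <= psi k z + 2 * e k.
  move=> z1; have := phipsi k z z1; have := psi0 k z.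
  by rewrite !ler_norml => h /andP[a1 a2]; apply/andP; split; lra.
have cut0 z : cutoff d 0 z = 0.
  by apply: cutoff_eq0; rewrite expr0 mul1r; have /andP[] := d01 z.
have psisum m z : \sum_(k < m) psi k z = cutoff d m z.
  elim: m => [|m ih]; first by rewrite big_ord0 cut0.
  by rewrite big_ord_recr/= ih /psi; ring.
have phisum m z : \sum_(k < m) phi k z = Phi m z.
  elim: m => [|m ih]; first by rewrite big_ord0 Phi0.
  by rewrite big_ord_recr/= ih /phi; ring.
have rz k z : nm z < 1 -> nm (((r k)%:C%C : C) * z) < 1.
  by have /andP[a b] := r01 k; exact: nm_dilate_lt1.
have Tle k z : nm z < 1 -> nm (T k z) <= e k + `|phi k z| * M.
  move=> z1; have h := nmD (T k z - (phi k z)%:C%C *: gn (((r k)%:C%C : C) * z))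
    ((phi k z)%:C%C *: gn (((r k)%:C%C : C) * z)).
  rewrite subrK in h; apply: (le_trans h); apply: lerD; first exact: TP.
  by rewrite nmZ nm_real ler_wpM2l// gM// rz.
have Phim m z : nm z < 1 -> `|1 - Phi m z| <= 1 - cutoff d m z + e m.
  move=> z1; have := PhiP m z z1; have := cutoff_le1 d m z.
  by rewrite !ler_norml => h /andP[a1 a2]; apply/andP; have := e0 m; split; lra.
pose S m z := (1 - Phi m z)%:C%C *: gn z + \sum_(k < m) T k z.
split.
- move=> z z1; apply: (vcv_le (HP z z1)); apply: filterE => m.
  apply: (le_trans (nmD _ _)); rewrite nmZ nm_real.
  have h1 : `|1 - Phi m z| * nm (gn z) <= (1 - cutoff d m z + e m) * M.
    by apply: ler_pM; rewrite ?nm_ge0 ?gM ?Phim.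
  have h2 : nm (\sum_(k < m) T k z) <= (1 + 2 * M) * (eps / 4) + cutoff d m z * M.
    apply: (le_trans (nm_sum _ _ _)).
    apply: (@le_trans _ _ (\sum_(k < m) ((1 + 2 * M) * e k + psi k z * M))).
      apply: ler_sum => k _; apply: (le_trans (Tle k z z1)).
      by have := ler_wpM2r M0 (phile k z z1); lra.
    rewrite big_split/= -mulr_sumr -mulr_suml psisum lerD2r.
    by apply: ler_wpM2l; [lra|exact: esum].
  have h3 : e m * M <= eps / 8 * M by apply: ler_wpM2r.
  have h4 : 0 <= eps * M by apply: mulr_ge0 => //; exact: ltW.
  by move: h1 h2 h3 h4; lra.
(* Near [s] all cut-offs of large index equal 1. There the coefficient of [gn] and the tail of the
   sum of [T k] are uniformly small, so [H] is close to a finite sum of uniformly continuous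
   functions. *)
- move=> s ds e' e'0.
  have K0 : 0 <= 2 * (eps / 4) * (1 + 3 * M) by apply: mulr_ge0; lra.
  have e3 : 0 < e' / 3 by lra.
  have [m1 hm1] := half_expn_small (2 * (eps / 4) * (1 + 3 * M)) e3.
  have ds2 : 0 < d s / 2 by lra.
  have [m2 hm2] := half_expn_small (2 : R) ds2.
  pose m := maxn m1 m2.
  have cut1 k z : (m <= k)%N -> nm (z - s) < d s / 2 -> cutoff d k z = 1.
    move=> mk zs; apply: cutoff_eq1.
    have dz : d s / 2 <= d z by have := dL z s; rewrite ler_norml => /andP[h _]; lra.
    have p0 : 0 < 2 ^+ k :> R by rewrite exprn_gt0.
    rewrite mulrC -ler_pdivrMr//; apply: le_trans dz; apply: le_trans hm2.
    rewrite ler_pM2l// lef_pV2 ?posrE ?exprn_gt0// ler_eXn2l ?ltr1n//.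
    by rewrite (leq_trans (leq_maxr m1 m2)).
  pose A z := \sum_(k < m) T k z.
  have HA z : nm z < 1 -> nm (z - s) < d s / 2 -> nm (H z - A z) <= e' / 3.
    move=> z1 zs; apply: (vcv_le (vcvB (HP z z1) (vcv_cst (A z)))).
    exists m => // m' /= mm'.
    have tail n : nm (\sum_(k < m + n) T k z - A z) <= \sum_(k < n) (1 + 2 * M) * e (m + k)%N.
      elim: n => [|n ih]; first by rewrite addn0 subrr nm0 big_ord0.
      rewrite addnS big_ord_recr/= [X in _ <= X]big_ord_recr/=.
      have -> : \sum_(k < m + n) T k z + T (m + n)%N z - A z =
        (\sum_(k < m + n) T k z - A z) + T (m + n)%N z by rewrite addrAC.
      apply: (le_trans (nmD _ _)); apply: lerD => //.
      apply: (le_trans (Tle _ z z1)).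
      have ps : psi (m + n)%N z = 0.
        by rewrite /psi !cut1 ?subrr// ?leqW// leq_addr.
      have := phile (m + n)%N z z1; rewrite ps add0r => h.
      by have := ler_wpM2r M0 h; lra.
    have tsum n : \sum_(k < n) (1 + 2 * M) * e (m + k)%N <= (1 + 2 * M) * (2 * e m).
      rewrite -mulr_sumr; apply: ler_wpM2l; first by lra.
      have -> : \sum_(k < n) e (m + k)%N = \sum_(k < n) e m / 2 ^+ k.
        by apply: eq_bigr => k _; rewrite /e exprD invfM mulrA.
      by apply: geometric_sum_le; exact: ltW.
    rewrite -addrA; apply: (le_trans (nmD _ _)); rewrite nmZ nm_real.
    have h1 : `|1 - Phi m' z| * nm (gn z) <= e m * M.
      apply: ler_pM; rewrite ?nm_ge0 ?gM//; apply: (le_trans (Phim m' z z1)).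
      rewrite cut1// subrr add0r /e ler_pM2l ?divr_gt0// lef_pV2 ?posrE ?exprn_gt0//.
      by rewrite ler_eXn2l// ltr1n.
    have h2 : nm (\sum_(k < m') T k z - A z) <= (1 + 2 * M) * (2 * e m).
      by have := le_trans (tail (m' - m)%N) (tsum (m' - m)%N); rewrite subnKC.
    have h3 : 2 * (eps / 4) * (1 + 3 * M) / 2 ^+ m <= e' / 3.
      apply: le_trans hm1; apply: ler_wpM2l => //.
      by rewrite lef_pV2 ?posrE ?exprn_gt0// ler_eXn2l ?ltr1n// leq_maxl.
    have h4 : 2 * (eps / 4) * (1 + 3 * M) / 2 ^+ m = 4 * (1 + 3 * M) * e m.
      by rewrite /e; field; rewrite expf_neq0.
    have h5 : 0 <= e m * M by apply: mulr_ge0 => //; exact: ltW.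
    rewrite h4 in h3; have e0m := e0 m; apply: (le_trans (lerD h1 h2)); lra.
  have Au : uc A by apply: uc_sum => k _; exact: Tu.
  have [t t0 ht] := @uc_cauchy_at _ _ _ s Au _ e3.
  exists (Num.min t (d s / 2)); first by rewrite lt_min t0.
  move=> x y x1 y1; rewrite !lt_min => /andP[x2 x3] /andP[y2 y3].
  have h1 := HA x x1 x3; have h2 := HA y y1 y3; have h3 := ht x y x1 y1 x2 y2.
  rewrite nm_distC in h2.
  apply: (le_trans (nm_tri _ (A x) _)).
  have -> : e' = e' / 3 + (e' / 3 + e' / 3) by field.
  apply: (lerD h1); apply: (le_trans (nm_tri _ (A y) _)); exact: lerD h3 h2.
move=> z z1.
pose B := Mf + 2 * (1 + M) + 4 * M * Mf.
have K2 : 0 <= 2 * (1 + M) by lra.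
have K1 : 0 < 1 + Mf by lra.
have eps4 : eps / 4 <= eps by lra.
have MMf : 0 <= M * Mf by exact: mulr_ge0.
have B0 : 0 <= B by rewrite /B; lra.
have lim : vcv \oo (fun m => S m z - gn z) (H z - gn z).
  by apply: vcvB; [exact: HP|exact: vcv_cst].
pose D k := T k z - (phi k z)%:C%C *: gn z.
have key (a b : C) (u v w : l2) :
    (a - b) *: u + (v + w) - u = a *: u + v - u + (w - b *: u).
  by module_ (Defs.C R) (ell2 R).
have SE m : S m z - gn z = \sum_(k < m) D k.
  rewrite /S /D; elim: m => [|m ih].
    by rewrite !big_ord0 Phi0 subr0 scale1r addr0 subrr.
  rewrite [in RHS]big_ord_recr/= -ih [in LHS]big_ord_recr/=.
  have -> : (1 - Phi m.+1 z)%:C%C = (1 - Phi m z)%:C%C - (phi m z)%:C%C :> C.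
    by rewrite -rmorphB /phi; congr (_%:C%C); ring.
  exact: key.
have Dle k : nm (pair (D k) (f z)) <= B * e k.
  set rzk := ((r k)%:C%C : C) * z.
  have DE : D k = (T k z - (phi k z)%:C%C *: gn rzk) + (phi k z)%:C%C *: (gn rzk - gn z).
    by rewrite /D; module_ (Defs.C R) (ell2 R).
  rewrite DE pairDl pairZl; apply: (le_trans (nmD _ _)).
  have h1 : nm (pair (T k z - (phi k z)%:C%C *: gn rzk) (f z)) <= e k * Mf.
    apply: (le_trans (pair_le _ _)); apply: ler_pM; rewrite ?nm_ge0//; last exact: fM.
    exact: TP.
  have h2 : nm ((phi k z)%:C%C *: (pair (gn rzk - gn z) (f z) : C)) <=
      (2 * (1 + M) + 4 * M * Mf) * e k.
    rewrite nmZ nm_real.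
    (* Either [z] lies where the choice of [r k] controls the dilation, or the k-th difference of
       cut-offs vanishes and [phi k z] is a mere approximation error. *)
    have [dz|dz] := leP 1 (2 ^+ k.+1 * d z).
      have [f1 f2] := rP k z z1 dz.
      (* The increment of [gn], which need not be small, is rewritten as an increment of the regular
         function [gn . f] and one of [f]. *)
      have pe : pair (gn rzk - gn z) (f z) =
        (pair (gn rzk) (f rzk) - pair (gn z) (f z)) - pair (gn rzk) (f rzk - f z).
        have pq (a b c : C) : a - b = c - b - (c - a) by ring.
        by rewrite pairBl pairBr; exact: pq.
      have p1 : nm (pair (gn rzk - gn z) (f z)) <= (1 + M) * e k.
        rewrite pe mulrDl mul1r; apply: (le_trans (nmB _ _)); apply: (lerD f2).
        apply: (le_trans (pair_le _ _)); apply: ler_pM; rewrite ?nm_ge0//.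
        by apply: gM; exact: rz.
      have p2 : `|phi k z| <= 2.
        apply: (le_trans (phile k z z1)); have := psi1 k z; have := e8 k; clear -eps1; lra.
      have p3 := ler_pM (normr_ge0 _) (nm_ge0 _) p2 p1.
      apply: (le_trans p3).
      have : 0 <= M * Mf * e k by apply: mulr_ge0; [exact: mulr_ge0|exact: ltW].
      clear; lra.
    have ps : psi k z = 0.
      have c1 : cutoff d k.+1 z = 0 by apply: cutoff_eq0; exact: ltW.
      have c2 : cutoff d k z <= 0 by rewrite -c1 cutoff_le//; have /andP[] := d01 z.
      by have := cutoff_ge0 d k z; rewrite /psi c1; lra.
    have p2 : `|phi k z| <= 2 * e k by have := phile k z z1; rewrite ps add0r.
    have p1 : nm (pair (gn rzk - gn z) (f z)) <= 2 * M * Mf.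
      apply: (le_trans (pair_le _ _)); apply: ler_pM; rewrite ?nm_ge0//; last exact: fM.
      apply: (le_trans (nmB _ _)); have a1 := gM z z1; have a2 := gM _ (rz k z z1).
      by rewrite mulr2n mulrDl mul1r; exact: lerD.
    have p3 := ler_pM (normr_ge0 _) (nm_ge0 _) p2 p1.
    apply: (le_trans p3).
    have -> : (2 * (1 + M) + 4 * M * Mf) * e k =
      2 * e k * (2 * M * Mf) + 2 * (1 + M) * e k by ring.
    by rewrite lerDl; apply: mulr_ge0 => //; exact: ltW.
  apply: (le_trans (lerD h1 h2)); rewrite le_eqVlt; apply/orP; left; apply/eqP.
  by rewrite /B; ring.
have step m : nm (pair (S m z - gn z) (f z)) <= B * (eps / 4).
  rewrite SE; have -> : pair (\sum_(k < m) D k) (f z) = \sum_(k < m) pair (D k) (f z).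
    elim: m => [|m ih]; first by rewrite !big_ord0 pair0l.
    by rewrite !big_ord_recr/= pairDl ih.
  apply: (le_trans (nm_sum _ _ _)).
  apply: (@le_trans _ _ (\sum_(k < m) B * e k)); first by apply: ler_sum => k _.
  by rewrite -mulr_sumr; apply: ler_wpM2l => //; exact: esum.
have Be : B * (eps / 4) <= B * eps by exact: ler_wpM2l.
apply: le_trans Be.
apply/ler_addgt0Pl => eta eta0.
have [N hN] := (vcv_ooP _ _).1 lim _ (divr_gt0 eta0 K1).
have hNN := hN N (leqnn N).
have pk (a b c : l2) : pair a c = pair b c - pair (b - a) c.
  by rewrite pairBl opprB addrC subrK.
rewrite (pk _ (S N z - gn z)).
apply: (le_trans (nmB _ _)); rewrite [leRHS]addrC; apply: (lerD (step N)).
apply: (le_trans (pair_le _ _)).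
have -> : eta = eta / (1 + Mf) * (1 + Mf) by rewrite divfK// lt0r_neq0.
apply: ler_pM; rewrite ?nm_ge0//.
by apply: (le_trans (fM z z1)); rewrite lerDr.
Qed.

Lemma telescoping_sum (u : l2) (T : nat -> l2) (Phi : nat -> R) m : Phi 0%N = 0 ->
  u + \sum_(k < m) (T k - (Phi k.+1 - Phi k)%:C%C *: u) =
  (1 - Phi m)%:C%C *: u + \sum_(k < m) T k.
Proof.
move=> Phi0; have key (a b : C) (x y v : l2) :
    a *: x + y + (v - b *: x) = (a - b) *: x + (y + v).
  by module_ (Defs.C R) (ell2 R).
elim: m => [|m ih]; first by rewrite !big_ord0 Phi0 subr0 scale1r.
rewrite [in LHS]big_ord_recr [in RHS]big_ord_recr/= addrA ih key.
congr (_ *: _ + _); rewrite -rmorphB; congr (_%:C%C); ring.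
Qed.

Lemma mult_real_sub n (a b : C -> R) : mult n (fun z => (a z)%:C%C) ->
  mult n (fun z => (b z)%:C%C) -> mult n (fun z => (a z - b z)%:C%C).
Proof.
move=> am bm.
apply: (mult_ext _ (mult_real_add am (mult_real_mul (mult_real_cst n (-1)) bm))) => z _.
by rewrite mulN1r.
Qed.

Lemma smooth_sum (g : C -> l2) (dl : nat -> C -> l2) m : hol g -> (forall k, hol (dl k)) ->
  hol (fun z => g z + \sum_(k < m) dl k z) /\
  forall j z, nm z < 1 -> derive1n j (fun z => g z + \sum_(k < m) dl k z) z =
    derive1n j g z + \sum_(k < m) derive1n j (dl k) z.
Proof.
move=> gh dh; elim: m => [|m [ihh ihE]].
  rewrite (_ : (fun z => _) = g); last by apply/funext => z; rewrite big_ord0 addr0.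
  by split=> // j z _; rewrite big_ord0 addr0.
rewrite (_ : (fun z => _) = fun z => (g z + \sum_(k < m) dl k z) + dl m z); last first.
  by apply/funext => z; rewrite big_ord_recr/= addrA.
have [h1 h2] := smoothD (smooth_hol complete_ell2 ihh) (smooth_hol complete_ell2 (dh m)).
split; first exact: (h1 0%N).
move=> j z z1; rewrite (h2 j z z1) (ihE j z z1) big_ord_recr/=.
exact: (esym (addrA _ _ _)).
Qed.

(** [G] is [g] plus the sum of the corrections. Locally uniform limits commute with derivatives, so
    orders below [n] inherit the summed errors, and order [n] is left to [glue_core]. *)
Lemma gluing n (S U : set C) (f g : C -> l2) (M Mf eps : R) : open U -> S = unit_circle `&` U ->
  hol f -> bddn n f -> (forall j s, (j <= n)%N -> S s -> cauchy_at (derive1n j f) s) ->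
  hol g -> bddn n g -> (forall z, nm z < 1 -> pair (g z) (f z) = 1) ->
  (forall z, nm z < 1 -> nm (derive1n n g z) <= M) ->
  (forall z, nm z < 1 -> nm (f z) <= Mf) -> 0 < eps -> eps <= 1 ->
  exists G, [/\ hol G /\ bddn n G,
    forall j z, (j < n)%N -> nm z < 1 -> nm (derive1n j G z - derive1n j g z) <= eps,
    forall z, nm z < 1 -> nm (derive1n n G z) <= (1 + eps) * M + eps,
    forall j s, (j <= n)%N -> S s -> cauchy_at (derive1n j G) s &
    forall z, nm z < 1 -> nm (pair (derive1n n G z - derive1n n g z) (f z)) <=
      (Mf + 2 * (1 + M) + 4 * M * Mf) * eps].
Proof.
move=> Uo SU fh fb fS gh gb gf gM fM eps0 eps1.
have [d [dL d01 dU Ud]] := open_dist Uo.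
pose e k : R := eps / 8 / 2 ^+ k.
have e0 k : 0 < e k by rewrite /e divr_gt0 ?exprn_gt0// divr_gt0.
have PhiE k : exists Phi : C -> R, [/\ mult n (fun z => (Phi z)%:C%C),
    forall z, nm z < 1 -> `|Phi z - cutoff d k z| <= e k & k = 0%N -> forall z, Phi z = 0].
  case: k => [|k].
    (* The exact value 0 at level 0 lets the sum of the differences telescope to [Phi m], with
       nothing left over. *)
    exists (fun=> 0); split; [exact: mult_real_cst| |by []].
    move=> z z1; rewrite cutoff_eq0 ?subrr ?normr0 ?(ltW (e0 _))//.
    by rewrite expr0 mul1r; have /andP[] := d01 z.
  have p0 : 0 <= 2 ^+ k.+1 :> R by rewrite exprn_ge0.
  have [Phi Pm PP] := mult_approx n p0 (e0 k.+1) (cutoff_lip k.+1 dL).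
  by exists Phi; split; [exact: Pm|exact: PP|by []].
have [Phi PhiP] := choice PhiE.
have Phim k : mult n (fun z => (Phi k z)%:C%C) by have [] := PhiP k.
have Phie k z : nm z < 1 -> `|Phi k z - cutoff d k z| <= e k.
  by have [_ h _] := PhiP k; exact: h.
have Phi0 z : Phi 0%N z = 0 by have [_ _ h] := PhiP 0%N; exact: h.
have fc j s : (j <= n)%N -> nm s <= 1 -> 0 < d s -> cauchy_at (derive1n j f) s.
  move=> jn s1 ds; have [s1'|s1'] := ltP (nm s) 1.
    exact: (cauchy_at_hol s1' (hol_derive1n j complete_ell2 fh)).
  apply: (fS j s jn); rewrite SU; split; last exact: dU.
  have sE : nm s = 1 by apply/eqP; rewrite eq_le s1 s1'.
  by rewrite /unit_circle/= normE sE.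
pose w z : C := pair (derive1n n g z) (f z).
have wc s : nm s <= 1 -> 0 < d s -> cauchy_at w s.
  move=> s1 ds.
  pose top z : C := (if n is 0 then 1 else 0) -
    \sum_(i < n) pair (derive1n i g z) (derive1n (n - i) f z) *+ 'C(n, i).
  apply: (@cauchy_at_ext _ C top); first by move=> z z1; rewrite /w pair_top_term.
  apply: cauchy_atD; first exact: cauchy_at_cst.
  apply: cauchy_atN.
  apply: (@cauchy_at_sum _ C n
    (fun i z => pair (derive1n i g z) (derive1n (n - i) f z) *+ 'C(n, i))) => i i_n.
  apply: cauchy_atMn; apply: (@cauchy_at_bilin _ _ _ _ (@pair_bilin R)).
  - exact: (gb i (ltnW i_n)).
  - exact: (fb _ (leq_subr _ _)).
  - exact: (uc_cauchy_at s (bddn_lip gh (bddn_leq i_n gb))).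
  - exact: (fc _ s (leq_subr _ _) s1 ds).
(* The k-th difference of cut-offs vanishes where [2 ^+ k.+1 * d z <= 1]. On the rest, [d] is
   bounded below and [near1_compact] yields an [r] for this [k]. *)
pose Q k (r : R) := forall z, nm z < 1 -> 1 <= 2 ^+ k.+1 * d z ->
     nm (f ((r%:C%C : C) * z) - f z) <= e k /\ nm (w ((r%:C%C : C) * z) - w z) <= e k.
have nQ k : near1 (Q k).
  have p0 : 0 < 2 ^+ k.+1 :> R by rewrite exprn_gt0.
  have cpos : 0 < 1 / 2 ^+ k.+1 :> R by rewrite divr_gt0.
  have hf s : nm s <= 1 -> 1 / 2 ^+ k.+1 <= d s -> cauchy_at f s.
    by move=> s1 cs; exact: (fc 0%N s (leq0n _) s1 (lt_le_trans cpos cs)).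
  have hw s : nm s <= 1 -> 1 / 2 ^+ k.+1 <= d s -> cauchy_at w s.
    by move=> s1 cs; exact: (wc s s1 (lt_le_trans cpos cs)).
  have h1 := near1_compact (e0 k) dL hf; have h2 := near1_compact (e0 k) dL hw.
  have [t t0 ht] := near1_and h1 h2; exists t => // r rt r1 z z1 dz.
  have [a1 a2] := ht r rt r1.
  have cz : 1 / 2 ^+ k.+1 <= d z by rewrite ler_pdivrMr// mulrC.
  by split; [exact: a1|exact: a2].
have rho1 k : 1 - 1 / 2 ^+ k < 1 :> R.
  by rewrite gtrBl divr_gt0// exprn_gt0.
have stepk k : exists a : R * (C -> l2) * (C -> l2), [/\ [/\ 0 < a.1.1, a.1.1 < 1 & Q k a.1.1],
   hol a.1.2 /\ bddn n a.1.2,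
   (forall j z, (j < n)%N -> nm z < 1 -> nm (derive1n j a.1.2 z) <= e k) /\
   (forall z, nm z <= 1 - 1 / 2 ^+ k -> nm (a.1.2 z) <= e k), uc a.2 &
   forall z, nm z < 1 ->
     derive1n n a.1.2 z = a.2 z - (Phi k.+1 z - Phi k z)%:C%C *: derive1n n g z /\
     nm (a.2 z - (Phi k.+1 z - Phi k z)%:C%C *: derive1n n g (((a.1.1)%:C%C : C) * z)) <= e k].
  have [r [dl [T H]]] := dilation_correction gh gb
    (mult_real_sub (Phim k.+1) (Phim k)) (e0 k) (rho1 k) (nQ k).
  by exists (r, dl, T).
have [a aP] := choice stepk.
pose r k := (a k).1.1; pose dl k := (a k).1.2; pose T k := (a k).2.
have rP k : [/\ 0 < r k, r k < 1 & Q k (r k)] by have [] := aP k.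
have dlh k : hol (dl k) by have [_ []] := aP k.
have dlj k j z : (j < n)%N -> nm z < 1 -> nm (derive1n j (dl k) z) <= e k.
  by have [_ _ [h _] _ _] := aP k; exact: h.
have dlr k z : nm z <= 1 - 1 / 2 ^+ k -> nm (dl k z) <= e k.
  by have [_ _ [_ h] _ _] := aP k; exact: h.
have Tu k : uc (T k) by have [] := aP k.
have Td k z : nm z < 1 ->
    derive1n n (dl k) z = T k z - (Phi k.+1 z - Phi k z)%:C%C *: derive1n n g z.
  by move=> z1; have [_ _ _ _ h] := aP k; exact: (h z z1).1.
have Te k z : nm z < 1 -> nm (T k z - (Phi k.+1 z - Phi k z)%:C%C *:
    derive1n n g (((r k)%:C%C : C) * z)) <= e k.
  by move=> z1; have [_ _ _ _ h] := aP k; exact: (h z z1).2.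
pose F m z := g z + \sum_(k < m) dl k z.
have FE m := smooth_sum m gh dlh.
have Fh m : hol (F m) by exact: (FE m).1.
have Fj m j z : nm z < 1 -> derive1n j (F m) z =
    derive1n j g z + \sum_(k < m) derive1n j (dl k) z.
  exact: (FE m).2.
have c0 : 0 <= eps / 4 by lra.
have FS k z : nm z <= 1 - 1 / 2 ^+ k -> nm (F k.+1 z - F k z) <= eps / 4 / 2 ^+ k.+1.
  move=> zk; have -> : F k.+1 z - F k z = dl k z.
    have key (x y u : l2) : x + (y + u) - (x + y) = u by module_ (Defs.C R) (ell2 R).
    by rewrite /F big_ord_recr/= key.
  have -> : eps / 4 / 2 ^+ k.+1 = e k by rewrite /e exprS; field; rewrite expf_neq0.
  exact: dlr.
have [G FG] := lucv_series complete_ell2 c0 FS.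
have Gh : hol G := lucv_hol complete_ell2 Fh FG.
have lim j z : nm z < 1 -> vcv \oo (fun m => derive1n j (F m) z) (derive1n j G z).
  move=> z1; apply/vcv_ooP => t t0.
  have [N hN] := lucv_derive1n j complete_ell2 Fh FG z1 t0.
  by exists N => m Nm; exact: hN.
have esum m : \sum_(k < m) e k <= eps.
  have := @geometric_sum_le R (eps / 8) m; rewrite -/(e _) => h.
  by apply: (le_trans (h _)); lra.
have Gj j z : (j < n)%N -> nm z < 1 -> nm (derive1n j G z - derive1n j g z) <= eps.
  move=> jn z1; apply: (vcv_le (vcvB (lim j z z1) (vcv_cst (derive1n j g z)))).
  apply: filterE => m; rewrite (Fj m j z z1) addrAC subrr add0r.
  apply: (le_trans (nm_sum _ _ _)); apply: le_trans (esum m).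
  by apply: ler_sum => k _; exact: dlj.
have HP z : nm z < 1 -> vcv \oo (fun m => (1 - Phi m z)%:C%C *: derive1n n g z +
    \sum_(k < m) T k z) (derive1n n G z).
  move=> z1; suff -> : (fun m => (1 - Phi m z)%:C%C *: derive1n n g z + \sum_(k < m) T k z) =
    (fun m => derive1n n (F m) z) by exact: (lim n z z1).
  apply/funext => m; rewrite (Fj m n z z1).
  rewrite -(@telescoping_sum _ (fun k => T k z) (fun k => Phi k z) m (Phi0 z)).
  by congr (_ + _); apply: eq_bigr => k _; rewrite (Td k z z1).
have r01 k : 0 < r k < 1 by have [-> ->] := rP k.
have Qr k z : nm z < 1 -> 1 <= 2 ^+ k.+1 * d z ->
    nm (f (((r k)%:C%C : C) * z) - f z) <= e k /\
    nm (pair (derive1n n g (((r k)%:C%C : C) * z)) (f (((r k)%:C%C : C) * z)) -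
       pair (derive1n n g z) (f z)) <= e k.
  by have [_ _ h] := rP k; exact: h.
have [H1 H2 H3] := glue_core eps0 eps1 gM fM d01 dL Phi0 Phie Tu r01 Te Qr HP.
have Gb : bddn n G.
  move=> j; rewrite leq_eqVlt => /predU1P[->|jn]; first by exists ((1 + eps) * M + eps).
  have [K gK] := gb j (ltnW jn); exists (eps + K) => z z1.
  have -> : derive1n j G z = (derive1n j G z - derive1n j g z) + derive1n j g z.
    by rewrite subrK.
  by apply: (le_trans (nmD _ _)); apply: lerD; [exact: Gj|exact: gK].
exists G; split; [exact: (conj Gh Gb)|exact: Gj|exact: H1| |exact: H3].
move=> j s; rewrite leq_eqVlt => /predU1P[->|jn] Ss.
  by apply: H2; apply: Ud; move: Ss; rewrite SU => -[].
exact: (uc_cauchy_at s (bddn_lip Gh (bddn_leq jn Gb))).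
Qed.

End Gluing.

(** * Division *)

Section Reciprocal.
Context {R : realType}.
Local Notation C := (C R).
Implicit Types (p : C -> C) (z s : C).

Lemma hol_inv p : hol p -> (forall z, nm z < 1 -> p z != 0) -> hol (fun z => (p z)^-1).
Proof.
move=> ph p0; apply: hol_intro => z z1; eexists.
exact: (cdV (p0 z z1) (ph z z1)).
Qed.

(** The Leibniz formula for p times 1/p, solved for the highest derivative of 1/p, whose coefficient
    is [p z]. *)
Lemma derive1n_inv_rec p m z : hol p -> (forall z, nm z < 1 -> p z != 0) -> nm z < 1 ->
  derive1n m.+1 (fun z => (p z)^-1) z = - ((p z)^-1 *
    \sum_(i < m.+1) (derive1n i.+1 p z * derive1n (m - i) (fun z => (p z)^-1) z) *+ 'C(m.+1, i.+1)).
Proof.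
move=> ph p0 z1; set v := fun z => (p z)^-1.
have ps := smooth_hol complete_complex ph.
have vs := smooth_hol complete_complex (hol_inv ph p0).
have [_ LE] := smooth_bilin (scale_bilin C) ps vs.
have one w : nm w < 1 -> (1 : C) = scale_bilin C (p w) (v w).
  by move=> w1; rewrite /v /= /GRing.scale/= divff// p0.
have s1 : smooth (fun _ : C => (1 : C)).
  by apply: (smooth_hol complete_complex); apply: hol_intro => w _; exists 0; exact: cd_cst.
have := derive1n_local m.+1 s1 one z1.
rewrite (derive1n_cst _ _ z1) (LE m.+1 z z1) /leibniz big_ord_recl bin0 mulr1n subn0.
rewrite -[bilin_fun _ _ _]/(p z * derive1n m.+1 v z).
have -> : \sum_(i < m.+1) scale_bilin C (derive1n (lift ord0 i) p z)
     (derive1n (m.+1 - lift ord0 i) v z) *+ 'C(m.+1, lift ord0 i) =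
   \sum_(i < m.+1) (derive1n i.+1 p z * derive1n (m - i) v z) *+ 'C(m.+1, i.+1).
  by apply: eq_bigr => i _; rewrite lift0 subSS.
move=> /esym/eqP; rewrite addr_eq0 => /eqP h.
by rewrite -mulrN -h mulrA mulVf ?mul1r// p0.
Qed.

(** Induction on the order. In the recursion each term carries a derivative of [p] of positive
    order, hence a factor [eta], while [eta <= 1 / 2] keeps [nm (p z)] above [1 / 2]. *)
Lemma reciprocal_small m : exists2 K : R, 0 <= K & forall (eta : R) p,
  0 <= eta -> eta <= 1 / 2 -> hol p ->
  (forall j z, (j <= m)%N -> nm z < 1 ->
     nm (derive1n j p z - (if j is 0 then 1 else 0)) <= eta) ->
  forall j z, (j <= m)%N -> nm z < 1 ->
    nm (derive1n j (fun z => (p z)^-1) z - (if j is 0 then 1 else 0)) <= K * eta.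
Proof.
have half (x : C) (eta : R) : eta <= 1 / 2 -> nm (x - 1) <= eta -> 1 / 2 <= nm x.
  move=> e2 xe; have := nmD (- (x - 1)) x.
  by rewrite nmN opprB subrK -[nm (1 : C)]/(nm (1 : C)) nm1; lra.
have neq0 (x : C) : 1 / 2 <= nm x -> x != 0.
  by apply: contraTneq => ->; rewrite nm0 -ltNge; lra.
have inv2 (x : C) : 1 / 2 <= nm x -> nm x^-1 <= 2.
  by move=> x2; rewrite nmV invf_ple ?posrE//; lra.
elim: m => [|m [K K0 ih]].
  exists 2 => // eta p e0 e2 ph hp [|//] z _ z1.
  have h := hp 0%N z isT z1; have x2 := half _ _ e2 h.
  have -> : (p z)^-1 - 1 = - ((p z)^-1 * (p z - 1)) by field; exact: neq0.
  by rewrite nmN nmM ler_pM ?nm_ge0 ?inv2.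
(* Lower derivatives of the reciprocal are at most [1 + K] by induction; the factor 2 in the new
   constant bounds the reciprocal itself. *)
pose D : R := \sum_(i < m.+1) (1 + K) *+ 'C(m.+1, i.+1).
have D0 : 0 <= D by rewrite sumr_ge0// => i _; rewrite mulrn_wge0//; lra.
exists (K + 2 * D); first by lra.
move=> eta p e0 e2 ph hp; have p2 z : nm z < 1 -> 1 / 2 <= nm (p z).
  by move=> z1; exact: (half _ _ e2 (hp 0%N z isT z1)).
have p0 z : nm z < 1 -> p z != 0 by move=> z1; exact: (neq0 _ (p2 z z1)).
have ihp := ih eta p e0 e2 ph (fun j z jm => hp j z (leq_trans jm (leqnSn m))).
move=> j z; rewrite leq_eqVlt => /predU1P[->|jm] z1; last first.
  apply: (le_trans (ihp j z jm z1)).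
  by rewrite ler_wpM2r//; lra.
rewrite subr0 (derive1n_inv_rec _ ph p0 z1) nmN nmM.
have sumle : nm (\sum_(i < m.+1) (derive1n i.+1 p z *
    derive1n (m - i) (fun z => (p z)^-1) z) *+ 'C(m.+1, i.+1)) <= D * eta.
  apply: (le_trans (nm_sum _ _ _)); rewrite /D mulr_suml; apply: ler_sum => i _.
  rewrite nmMn mulrnAl lerMn2r; apply/orP; right; rewrite nmM mulrC.
  have h1 := hp i.+1 z (ltn_ord i) z1; rewrite subr0 in h1.
  have h2 := ihp (m - i)%N z (leq_subr _ _) z1.
  apply: ler_pM; [exact: nm_ge0|exact: nm_ge0| |exact: h1].
  move: h2; set x := derive1n (m - i) _ z; set c : C := (if _ is 0 then _ else _) => h2.
  have c1 : nm c <= 1 by rewrite /c; case: (m - i)%N => [|k]; rewrite ?nm1 ?nm0.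
  have h3 : K * eta <= K by rewrite ler_piMr//; lra.
  by have := nmD (x - c) c; rewrite subrK; lra.
have h4 : nm (p z)^-1 * nm (\sum_(i < m.+1) (derive1n i.+1 p z *
    derive1n (m - i) (fun z => (p z)^-1) z) *+ 'C(m.+1, i.+1)) <= 2 * (D * eta).
  by apply: ler_pM; [exact: nm_ge0|exact: nm_ge0|exact: (inv2 _ (p2 z z1))|exact: sumle].
apply: (le_trans h4); rewrite [leRHS](_ : _ = K * eta + 2 * (D * eta)); last by ring.
by rewrite lerDr mulr_ge0.
Qed.

Lemma cauchy_at_inv p s (c : R) : 0 < c -> (forall z, nm z < 1 -> c <= nm (p z)) ->
  cauchy_at p s -> cauchy_at (fun z => (p z)^-1) s.
Proof.
move=> c0 pc hp e e0; have [d d0 hd] := hp (c * c * e) (mulr_gt0 (mulr_gt0 c0 c0) e0).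
exists d => // x y x1 y1 xs ys.
have neq0 z : nm z < 1 -> p z != 0.
  by move=> z1; apply: contraTneq (pc z z1) => ->; rewrite nm0 -ltNge.
have -> : (p x)^-1 - (p y)^-1 = (p y - p x) * ((p x)^-1 * (p y)^-1).
  by field; apply/andP; split; exact: neq0.
rewrite !nmM !nmV -invfM ler_pdivrMr; last by rewrite mulr_gt0// (lt_le_trans c0)// pc.
rewrite nm_distC; apply: (le_trans (hd x y x1 y1 xs ys)); rewrite mulrC ler_wpM2l ?(ltW e0)//.
by apply: ler_pM; rewrite ?(ltW c0)// pc.
Qed.

Lemma cauchy_at_reciprocal p s (c : R) m : 0 < c -> hol p ->
  (forall z, nm z < 1 -> c <= nm (p z)) ->
  (forall j, (j <= m)%N -> bdd (derive1n j p) /\ cauchy_at (derive1n j p) s) ->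
  (forall j, (j <= m)%N -> bdd (derive1n j (fun z => (p z)^-1))) ->
  forall j, (j <= m)%N -> cauchy_at (derive1n j (fun z => (p z)^-1)) s.
Proof.
move=> c0 ph pc hp vb; have p0 z : nm z < 1 -> p z != 0.
  by move=> z1; apply: contraTneq (pc z z1) => ->; rewrite nm0 -ltNge.
have v0 : cauchy_at (fun z => (p z)^-1) s := cauchy_at_inv c0 pc (hp 0%N (leq0n m)).2.
elim/ltn_ind => -[_ _|j ih jm]; first exact: v0.
pose rhs z := - ((p z)^-1 * \sum_(i < j.+1) (derive1n i.+1 p z *
  derive1n (j - i) (fun z => (p z)^-1) z) *+ 'C(j.+1, i.+1)).
have rhsE z : nm z < 1 -> rhs z = derive1n j.+1 (fun z => (p z)^-1) z.
  by move=> z1; exact: (esym (derive1n_inv_rec j ph p0 z1)).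
apply: (@cauchy_at_ext _ C _ _ s rhsE).
apply: cauchy_atN.
apply: (@cauchy_at_bilin _ _ _ _ (scale_bilin C) (fun z => (p z)^-1)
  (fun z => \sum_(i < j.+1) (derive1n i.+1 p z *
    derive1n (j - i) (fun z => (p z)^-1) z) *+ 'C(j.+1, i.+1))).
- exact: (vb 0%N (leq0n m)).
- have /choice[A AP] : forall i, exists A, (i <= m)%N ->
      forall z, nm z < 1 -> nm (derive1n i p z) <= A.
    move=> i; case: (leqP i m) => im; last by exists 0.
    by have [[A hA] _] := hp i im; exists A.
  have /choice[B BP] : forall i, exists B, (i <= m)%N ->
      forall z, nm z < 1 -> nm (derive1n i (fun z => (p z)^-1) z) <= B.
    move=> i; case: (leqP i m) => im; last by exists 0.
    by have [B hB] := vb i im; exists B.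
  exists (\sum_(i < j.+1) A i.+1 * B (j - i)%N *+ 'C(j.+1, i.+1)) => z z1.
  apply: (le_trans (nm_sum _ _ _)); apply: ler_sum => i _.
  rewrite nmMn lerMn2r; apply/orP; right; rewrite nmM.
  apply: ler_pM; [exact: nm_ge0|exact: nm_ge0| |].
    by apply: AP => //; exact: (leq_trans (ltn_ord i) jm).
  by apply: BP => //; exact: (leq_trans (leq_subr _ _) (ltnW jm)).
- exact: v0.
- apply: (@cauchy_at_sum _ C j.+1 (fun i z => (derive1n i.+1 p z *
    derive1n (j - i) (fun z => (p z)^-1) z) *+ 'C(j.+1, i.+1))) => i ij.
  have im : (i.+1 <= m)%N by exact: leq_trans ij jm.
  have jim : (j - i <= m)%N by exact: (leq_trans (leq_subr _ _) (ltnW jm)).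
  apply: cauchy_atMn; apply: (@cauchy_at_bilin _ _ _ _ (scale_bilin C) (derive1n i.+1 p)
    (derive1n (j - i) (fun z => (p z)^-1))).
  + exact: (hp _ im).1.
  + exact: (vb _ jim).
  + exact: (hp _ im).2.
  + by apply: ih => //; rewrite ltnS leq_subr.
Qed.

End Reciprocal.

Section Division.
Context {R : realType}.
Local Notation C := (C R).
Local Notation l2 := (ell2 R).
Implicit Types (z s : C).

Lemma cauchy_at_leibniz (V1 V2 V3 : normedModType C) (b : bilin V1 V2 V3) f g j s :
  smooth f -> smooth g ->
  (forall i, (i <= j)%N -> bdd (derive1n i f) /\ cauchy_at (derive1n i f) s) ->
  (forall i, (i <= j)%N -> bdd (derive1n i g) /\ cauchy_at (derive1n i g) s) ->
  cauchy_at (derive1n j (fun z => b (f z) (g z))) s.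
Proof.
move=> fs gs hf hg; have [_ E] := smooth_bilin b fs gs.
have E' z : nm z < 1 -> leibniz b f g j z = derive1n j (fun z => b (f z) (g z)) z.
  by move=> z1; exact: esym (E j z z1).
apply: (cauchy_at_ext E').
apply: (@cauchy_at_sum _ V3 j.+1
  (fun i z => b (derive1n i f z) (derive1n (j - i) g z) *+ 'C(j, i))) => i ij.
apply: cauchy_atMn; apply: (@cauchy_at_bilin _ _ _ _ b).
- exact: (hf i ij).1.
- exact: (hg (j - i)%N (leq_subr _ _)).1.
- exact: (hf i ij).2.
- exact: (hg (j - i)%N (leq_subr _ _)).2.
Qed.

Lemma leibniz_unit (x : nat -> l2) j :
  \sum_(i < j.+1) ((if (i : nat) is 0 then 1 else 0 : C) *: x (j - i)%N) *+ 'C(j, i) = x j.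
Proof.
rewrite big_ord_recl bin0 mulr1n subn0 scale1r big1 ?addr0// => i _.
by rewrite lift0 scale0r mul0rn.
Qed.

(** The solution is [G / (G . f)] with [G] from [gluing]. As [G . f] is within [eps * L] of 1
    together with its derivatives, division changes [G] by a multiple of [eps], with constants
    depending on [M], [Mf] and [n] but not on [eps]. *)
Lemma exact_division n (S U : set C) (f g : C -> l2) (M Mf : nat -> R) :
  open U -> S = unit_circle `&` U -> (forall j, 0 <= M j) -> (forall j, 0 <= Mf j) ->
  hol f -> (forall j z, (j <= n)%N -> nm z < 1 -> nm (derive1n j f z) <= Mf j) ->
  (forall j s, (j <= n)%N -> S s -> cauchy_at (derive1n j f) s) ->
  hol g -> (forall j z, (j <= n)%N -> nm z < 1 -> nm (derive1n j g z) <= M j) ->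
  (forall z, nm z < 1 -> pair (g z) (f z) = 1) ->
  exists B : nat -> R, exists2 e0 : R, 0 < e0 & forall eps : R, 0 < eps -> eps <= e0 ->
  exists h, [/\ hol h,
    forall j z, (j <= n)%N -> nm z < 1 -> nm (derive1n j h z) <= M j + eps * B j,
    forall j s, (j <= n)%N -> S s -> cauchy_at (derive1n j h) s &
    forall z, nm z < 1 -> pair (h z) (f z) = 1].
Proof.
move=> Uo SU M0 Mf0 fh fM fS gh gM gf.
have [K K0 KP] := @reciprocal_small R n.
have fs := smooth_hol complete_ell2 fh; have gs := smooth_hol complete_ell2 gh.
pose A := Mf 0%N + 2 * (1 + M n) + 4 * M n * Mf 0%N.
have A0 : 0 <= A.
  by rewrite /A !addr_ge0 ?mulr_ge0// ?addr_ge0.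
(* Term [i] of the Leibniz sum for G . f - 1 is bounded through [Mf] when [i < n] and through [A],
   the constant of [gluing], when [i = n]; adding both covers every case. *)
pose c j := \sum_(i < j.+1) (Mf (j - i)%N *+ 'C(j, i) + A).
have c0 j : 0 <= c j by apply: sumr_ge0 => i _; rewrite addr_ge0// mulrn_wge0.
pose L := \sum_(j < n.+1) c j.
have L0 : 0 <= L by apply: sumr_ge0 => i _.
have cL j : (j <= n)%N -> c j <= L.
  move=> jn; rewrite /L (bigD1 (Ordinal (jn : (j < n.+1)%N)))//= lerDl.
  by apply: sumr_ge0 => i _.
(* The first summand is the growth from [g] to [G]; the other is the Leibniz sum of [v - 1] with the
   derivatives of [G], which are at most [1 + 2 * M]. *)
pose B j := (1 + M j) + K * L * \sum_(i < j.+1) (1 + 2 * M (j - i)%N) *+ 'C(j, i).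
(* This threshold gives [eps <= 1] for [gluing] and [eps * L <= 1 / 2] for [reciprocal_small]. *)
exists B, (1 / (2 * (1 + L))); first by rewrite divr_gt0// mulr_gt0//; lra.
move=> eps eps0 epsL.
have L1 : 0 < 2 * (1 + L) by rewrite mulr_gt0//; lra.
have eta2 : eps * (2 * (1 + L)) <= 1 by move: epsL; rewrite ler_pdivlMr.
have epsL0 : 0 <= eps * L by rewrite mulr_ge0// ltW.
have etal : eps * L <= 1 / 2 by lra.
have eps1 : eps <= 1 by lra.
have [||G [[Gh Gb] Gj Gn GS Gf]] := @gluing R n S U f g (M n) (Mf 0%N) eps Uo SU fh _ fS gh _ gf
  (fun z => gM n z (leqnn n)) (fun z => fM 0%N z (leq0n n)) eps0 eps1.
- by move=> j jn; exists (Mf j) => z; exact: fM.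
- by move=> j jn; exists (M j) => z; exact: gM.
have Gs := smooth_hol complete_ell2 Gh.
pose p z : C := pair (G z) (f z); pose v z : C := (p z)^-1.
have [ps pE] := smooth_bilin (@pair_bilin R) Gs fs.
have [_ oneE] := smooth_bilin (@pair_bilin R) gs fs.
have ph : hol p by exact: (ps 0%N).
have psmall j z : (j <= n)%N -> nm z < 1 ->
    nm (derive1n j p z - (if j is 0 then 1 else 0)) <= eps * L.
  move=> jn z1.
  have s1 : smooth (fun _ : C => (1 : C)).
    by apply: (smooth_hol complete_complex); apply: hol_intro => w _; exists 0; exact: cd_cst.
  have d1 := derive1n_local j s1 (fun w w1 => esym (gf w w1)) z1.
  rewrite -(derive1n_cst (1 : C) j z1) d1 (oneE j z z1) (pE j z z1) /leibniz -sumrB.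
  apply: (le_trans (nm_sum _ _ _)); apply: (@le_trans _ _ (eps * c j)); last first.
    by rewrite ler_wpM2l ?(ltW eps0)// cL.
  rewrite /c mulr_sumr; apply: ler_sum => i _.
  have -> : @pair_bilin R (derive1n i G z) (derive1n (j - i) f z) *+ 'C(j, i) -
      @pair_bilin R (derive1n i g z) (derive1n (j - i) f z) *+ 'C(j, i) =
      pair (derive1n i G z - derive1n i g z) (derive1n (j - i) f z) *+ 'C(j, i).
    by rewrite -mulrnBl pairBl.
  rewrite nmMn mulrDr; have ij : (i <= j)%N by rewrite -ltnS.
  have [i_n|] := ltnP i n.
    apply: (@le_trans _ _ (eps * Mf (j - i)%N *+ 'C(j, i))).
      rewrite lerMn2r; apply/orP; right; apply: (le_trans (pair_le _ _)).
      apply: ler_pM; [exact: nm_ge0|exact: nm_ge0|exact: Gj|].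
      by apply: fM => //; exact: (leq_trans (leq_subr _ _) jn).
    by rewrite mulrnAr lerDl mulr_ge0// ltW.
  (* The case [i = n] forces [j = n], so the top difference meets [f] itself, undifferentiated:
     exactly the pairing that [gluing] bounds. *)
  move=> ni; have iE : nat_of_ord i = n by apply/eqP; rewrite eqn_leq ni (leq_trans ij jn).
  have jE : j = n by apply/eqP; rewrite eqn_leq jn -{1}iE.
  rewrite iE jE subnn binn mulr1n; apply: (le_trans (Gf z z1)).
  rewrite -/A [leLHS]mulrC lerDr; apply: mulr_ge0; [exact: ltW|exact: Mf0].
have vsmall := KP (eps * L) p epsL0 etal ph psmall.
have delta1 (j : nat) : nm ((if j is 0 then 1 else 0) : C) <= 1.
  by case: j => [|j]; rewrite ?nm1 ?nm0.
have p2 z : nm z < 1 -> 1 / 2 <= nm (p z).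
  move=> z1; have h1 := psmall 0%N z (leq0n n) z1; have h2 := nmD (- (p z - 1)) (p z).
  by rewrite nmN opprB subrK nm1 in h2; move: h1 h2; rewrite /=; lra.
have p0 z : nm z < 1 -> p z != 0.
  by move=> /p2; apply: contraTneq => ->; rewrite nm0 -ltNge; lra.
have pb j : (j <= n)%N -> bdd (derive1n j p).
  move=> jn; exists (eps * L + 1) => z z1; have := psmall j z jn z1.
  have := delta1 j; set d : C := (if _ is 0 then _ else _); set x := derive1n _ _ _ => d1 xd.
  by have := nmD (x - d) d; rewrite subrK; lra.
have vb j : (j <= n)%N -> bdd (derive1n j v).
  move=> jn; exists (K * (eps * L) + 1) => z z1; have := vsmall j z jn z1.
  have := delta1 j; set d : C := (if _ is 0 then _ else _); set x := derive1n _ _ _ => d1 xd.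
  by have := nmD (x - d) d; rewrite subrK; lra.
have GM j z : (j <= n)%N -> nm z < 1 -> nm (derive1n j G z) <= M j + eps * (1 + M j).
  rewrite leq_eqVlt => /predU1P[->|jn] z1.
    by apply: (le_trans (Gn z z1)); lra.
  have h := nmD (derive1n j G z - derive1n j g z) (derive1n j g z); rewrite subrK in h.
  have em : 0 <= eps * M j by rewrite mulr_ge0// ltW.
  have h' := lerD (Gj j z jn z1) (gM j z (ltnW jn) z1).
  by apply: (le_trans h); apply: (le_trans h'); lra.
have vh : hol v := hol_inv ph p0.
have vs := smooth_hol complete_complex vh.
have [hs hE] := smooth_bilin (scale_bilin l2) vs Gs.
exists (fun z => scale_bilin l2 (v z) (G z)); split.
- exact: (hs 0%N).
- move=> j z jn z1; rewrite (hE j z z1).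
  (* Subtracting the jet of the constant 1 from that of [v] singles out the derivative of [G]; the
     rest is small because [v] is close to 1. *)
  have -> : leibniz (scale_bilin l2) v G j z = derive1n j G z +
      \sum_(i < j.+1) ((derive1n i v z - (if (i : nat) is 0 then 1 else 0)) *:
        derive1n (j - i) G z) *+ 'C(j, i).
    rewrite -[in RHS](leibniz_unit (fun i => derive1n i G z) j) -big_split/=.
    by apply: eq_bigr => i _; rewrite -mulrnDl -scalerDl addrC subrK.
  apply: (le_trans (nmD _ _)); rewrite /B mulrDr addrA; apply: lerD; first exact: GM.
  apply: (le_trans (nm_sum _ _ _)); rewrite mulrA mulr_sumr; apply: ler_sum => i _.
  rewrite nmMn mulrnAr lerMn2r; apply/orP; right; rewrite nmZ.
  have ij : (i <= j)%N by rewrite -ltnS.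
  have h1 := vsmall i z (leq_trans ij jn) z1.
  have jin : (j - i <= n)%N := leq_trans (leq_subr _ _) jn.
  have h2 := GM (j - i)%N z jin z1.
  have h3 : eps * (1 + M (j - i)%N) <= 1 * (1 + M (j - i)%N).
    by rewrite ler_wpM2r// addr_ge0.
  have -> : eps * (K * L) = K * (eps * L) by ring.
  apply: ler_pM; [exact: nm_ge0|exact: nm_ge0|exact: h1|].
  by apply: (le_trans h2); lra.
- move=> j s jn Ss.
  have pS i : (i <= n)%N -> bdd (derive1n i p) /\ cauchy_at (derive1n i p) s.
    move=> i_n; split; first exact: pb.
    apply: (@cauchy_at_leibniz _ _ _ (@pair_bilin R) G f i s Gs fs) => k ki; have kn := leq_trans ki i_n; split.
    + exact: (Gb k kn).
    + exact: GS.
    + by exists (Mf k) => z; exact: fM.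
    + exact: fS.
  have i2 : 0 < 1 / 2 :> R by lra.
  have vS := cauchy_at_reciprocal i2 ph p2 pS vb.
  apply: (@cauchy_at_leibniz _ _ _ (scale_bilin l2) v G j s vs Gs) => k kj; have kn := leq_trans kj jn; split.
  + exact: vb.
  + exact: vS.
  + exact: (Gb k kn).
  + exact: GS.
- move=> z z1; rewrite [scale_bilin _ _ _]/(v z *: G z) pairZl /v.
  by rewrite -[X in X = _]/((p z)^-1 * p z) mulVf// p0.
Qed.

End Division.

Section DirectionB.
Context {R : realType}.
Local Notation C := (C R).
Local Notation l2 := (ell2 R).

Lemma bezout_const_A_le (S : set C) n (delta : R) : open_in_circle S ->
  (bezout_const n (integrated n (A_ S)) delta <=
   bezout_const n (integrated n Hoo) delta)%E.
Proof.
move=> [U Uo SU]; have SC : S `<=` unit_circle by rewrite SU => x [].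
apply: ge_ereal_sup => _ [f [/(integrated_AP n f SC)[fh fb fS] fn fd] <-].
have [Mf [Mf0 MfP _]] := le_Cn_norm fn.
set c := bezout_const n (integrated n Hoo) delta.
have cost_le : (bezout_cost n (integrated n Hoo) f <= c)%E.
  apply: ereal_sup_ubound; exists f => //; split=> //.
  exact/integrated_HooP.
have c0 : (0 <= c)%E.
  apply: le_trans cost_le.
  by apply: le_ereal_inf_tmp => _ [g _ <-]; exact: Cn_norm_ge0.
case cE : c => [b| |]; last 2 first.
- by rewrite leey.
- by move: c0; rewrite cE.
apply/lee_addgt0Pr => eta eta0.
have : (bezout_cost n (integrated n Hoo) f < (b + eta / 2)%:E)%E.
  by rewrite (le_lt_trans cost_le)// cE lte_fin ltrDl divr_gt0.
move=> /ereal_inf_lt[_ [g [/integrated_HooP[gh gb] /bezout_solutionP gf] <-] gn].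
have [M [M0 MP MS]] := le_Cn_norm (ltW gn).
have gf1 z : nm z < 1 -> pair (g z) (f z) = 1 by move=> /unit_diskE; exact: gf.
have [B [e0 e00 H]] := exact_division Uo SU M0 Mf0 fh MfP fS gh MP gf1.
(* Half of [eta] is spent on the nearly optimal [g], the other half on the loss [eps * B j] of the
   division, weighted as in the norm. *)
pose Q := \sum_(j < n.+1) `|B j| / j`!%:R.
have Q0 : 0 <= Q by apply: sumr_ge0 => j _; rewrite divr_ge0.
have Q1 : 0 < 2 * (1 + Q) by lra.
pose eps := Num.min e0 (eta / (2 * (1 + Q))).
have eps0 : 0 < eps by rewrite lt_min e00 divr_gt0.
have epsQ : eps * Q <= eta / 2.
  have h : eps * (2 * (1 + Q)) <= eta by rewrite -ler_pdivlMr// ge_min lexx orbT.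
  by lra.
have [h [hh hM hS hf]] := H eps eps0 (ltac:(by rewrite ge_min lexx)).
apply: (@le_trans _ _ (Cn_norm n h)).
  apply: ereal_inf_lbound; exists h => //; split.
    apply/(integrated_AP n h SC); split=> // j jn.
    by exists (M j + eps * B j) => z; exact: hM.
  by apply/bezout_solutionP => z /unit_diskE; exact: hf.
apply: (Cn_norm_le hM).
have -> : \sum_(j < n.+1) (M j + eps * B j) / j`!%:R =
    \sum_(j < n.+1) M j / j`!%:R + eps * \sum_(j < n.+1) B j / j`!%:R.
  by rewrite mulr_sumr -big_split/=; apply: eq_bigr => j _; rewrite mulrDl mulrA.
have BQ : \sum_(j < n.+1) B j / j`!%:R <= Q.
  by apply: ler_sum => j _; rewrite ler_wpM2r ?invr_ge0// ler_norm.
have : eps * \sum_(j < n.+1) B j / j`!%:R <= eps * Q by rewrite ler_wpM2l// ltW.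
by lra.
Qed.

End DirectionB.

Theorem theorem4p7 (R : realType) (S : set (C R)) (n : nat) (delta : R)
  (hS : open_in_circle S) (hdelta : 0 < delta) :
  bezout_const n (integrated n Hoo) delta =
  bezout_const n (integrated n (A_ S)) delta.
Proof.
by apply/eqP; rewrite eq_le bezout_const_Hoo_le// bezout_const_A_le.
Qed.
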